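(* Let $\Gamma=(\Gamma,+)$ be an irreducible spherical Artin-Tits group, written additively. Each non-trivial $\mathrm{I}_\Gamma$-formation $(H,\iota)$ is equivalent to exactly one $\mathrm{I}_\Gamma$-formation of the form $(\Gamma_\alpha,\mathrm{id}_\Gamma)$, where $\Gamma_\alpha=(\Gamma,\circ_\alpha)$ with $g\circ_\alpha h=g+\alpha_g(h)$ (and the order of $\Gamma$), and $\alpha:(\Gamma,+)\to\mathfrak{D}_\Gamma$, $g\mapsto\alpha_g$, is a homomorphism listed, for the type of $\Gamma$, in the following table (given by its values on the standard generators): - $A_n$ ($n\geq 2$): $\sigma_i\mapsto\delta_{(1\ n)(2\ n-1)\cdots}$ for $1\leq i\leq n$; - $D_n$ ($n\geq 4$): $\sigma_i\mapsto\delta_{(1\ 2)}$ for $1\leq i\leq n$; - $D_4$: $\sigma_i\mapsto\delta_{(a\ 3)}$ for $1\leq i\leq 4$, with $a\in\{1,2\}$; - $D_4$: $\sigma_i\mapsto\delta_{(1\ a\ b)}$ for $1\leq i\leq 4$, with $\{a,b\}=\{2,3\}$; - $D_4$: $\sigma_i\mapsto\delta_{(a\ b)}$ for $1\leq i\leq 3$ and $\sigma_4\mapsto\delta_{(b\ c)}$, with $\{a,b,c\}=\{1,2,3\}$; - $E_6$: $\sigma_i\mapsto\delta_{(1\ 5)(2\ 4)}$ for $1\leq i\leq 6$; - $F_4$: $\sigma_i\mapsto\delta_{(1\ 4)(2\ 3)}$ for $1\leq i\leq 4$; - $I_n$ ($n\geq 4$): $\sigma_i\mapsto\delta_{(1\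 2)}$ for $1\leq i\leq 2$.
   Context: A Coxeter matrix on a set $S$ is a map $m:S\times S\to\mathbb{Z}_{\geq 1}$, $(i,j)\mapsto m_{ij}$, with $m_{ij}=m_{ji}$ and $m_{ij}=1$ iff $i=j$. For $k\geq 1$, $r_k(x,y)=xyxy\cdots$ denotes the alternating product with $k$ factors starting with $x$. The Artin-Tits monoid $\Gamma^+$ (resp. group $\Gamma$) of $m$ is the monoid (resp. group) with standard generators $\sigma_i$ ($i\in S$) and relations $r_{m_{ij}}(\sigma_i,\sigma_j)=r_{m_{ij}}(\sigma_j,\sigma_i)$. It is spherical if the Coxeter group, obtained from $\Gamma$ by adding the relations $\sigma_i^2=1$, is finite. It is irreducible if its Coxeter graph (vertex set $S$, an edge $\{i,j\}$ iff $m_{ij}\geq 3$, labelled $m_{ij}$, the label $3$ being omitted) is connected. For spherical $\Gamma$, by Brieskorn–Saito the canonical map $\Gamma^+\to\Gamma$ is injective and its image is the positive cone of a left-invariant lattice order $\leq$ on $\Gamma$: $g\leq h$ iff $g^{-1}h\in\Gamma^+$ (multiplicatively). $\Gamma$ always carries this order. In this statement the group operation of $\Gamma$ is written $+$ (it need not be commutative). Types and numbering of generators (all $m_{ij}$ with $i\neq j$ not mentioned are $2$): $A_n$: $S=\{1,\dots,n\}$, $m_{i,i+1}=3$ for $1\leq i<n$. $D_n$ ($n\geq4$): $S=\{1,\dots,n\}$, $m_{1n}=m_{2n}=m_{3n}=3$ and $m_{i,i+1}=3$ for $3\leq i\leq n-2$. $E_6$: $S=\{1,\dots,6\}$, $m_{12}=m_{23}=m_{34}=m_{45}=m_{36}=3$.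 $F_4$: $S=\{1,2,3,4\}$, $m_{12}=m_{34}=3$, $m_{23}=4$. $I_n$ ($n\geq4$): $S=\{1,2\}$, $m_{12}=n$. If the type of $\Gamma$ does not occur in the table, there are no table entries for $\Gamma$. For a permutation $\phi$ of $S$ with $m_{\phi(i)\phi(j)}=m_{ij}$ for all $i,j$, let $\delta_\phi$ be the automorphism of $\Gamma$ with $\delta_\phi(\sigma_i)=\sigma_{\phi(i)}$ (a diagram automorphism); $\mathfrak{D}_\Gamma$ is the group of these. The permutation $(1\ n)(2\ n-1)\cdots$ is $i\mapsto n+1-i$. A left-ordered group is a group with a partial order such that $y\leq z$ implies $xy\leq xz$. For a left-ordered group $G$, an $\mathrm{I}_G$-formation is a pair $(H,\iota)$ where $H$ is a left-ordered group and $\iota:(H,\leq)\to(G,\leq)$ is an order-isomorphism (not necessarily a group homomorphism) with $\iota(e_H)=e_G$. Two $\mathrm{I}_G$-formations $(H,\iota)$, $(H',\iota')$ are equivalent if there is an isomorphism of left-ordered groups $f:H\to H'$ with $\iota'\circ f=\iota$. An $\mathrm{I}_G$-formation is trivial if it is equivalent to $(G,\mathrm{id}_G)$, i.e. if $\iota$ is an isomorphism of left-ordered groups. *)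

(* Defs.v *)
From HB Require Import structures.
From mathcomp Require Import all_boot all_order.
From mathcomp Require Import all_classical zify.

Set Implicit Arguments.
Unset Strict Implicit.
Unset Printing Implicit Defensive.

Import Order.TTheory.
Local Open Scope group_scope.

HB.mixin Record isLeftOrdered (d : Order.disp_t) G
    of Order.POrder d G & Group G := {
  le_mulg2l : forall x y z : G, (y <= z)%O -> (x * y <= x * z)%O
}.

#[short(type="loGroupType")]
HB.structure Definition LOGroup (d : Order.disp_t) :=
  {G of Order.POrder d G & Group G & isLeftOrdered d G}.

(* [iota_of] is only an order isomorphism, not a group morphism. *)
Record formation (d : Order.disp_t) (G : loGroupType d) := Formation {
  fdisp : Order.disp_t;
  fgroup :> loGroupType fdisp;
  iota_of : fgroup -> G;
  iota_bij : bijective iota_of;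
  iota_mono : {mono iota_of : x y / (x <= y)%O};
  iota1 : iota_of 1 = 1 }.

Definition equiv_formation (d : Order.disp_t) (G : loGroupType d)
    (F F' : formation G) : Prop :=
  exists f : F -> F',
    [/\ bijective f, {morph f : x y / x * y}, {mono f : x y / (x <= y)%O}
      & forall x, iota_of (f x) = iota_of x].

Definition id_formation (d : Order.disp_t) (G : loGroupType d) : formation G :=
  @Formation d G d G id (Bijective (fun=> erefl) (fun=> erefl))
    (fun _ _ => erefl) erefl.

Definition trivial_formation (d : Order.disp_t) (G : loGroupType d)
    (F : formation G) : Prop :=
  equiv_formation F (id_formation G).

(* The letter [(s, false)] is the generator [s], and [(s, true)] its inverse. *)
Definition gword (S : Type) := seq (S * bool).

Definition gpos (S : Type) (w : seq S) : gword S := [seq (s, false) | s <- w].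

Definition ginv (S : Type) (w : gword S) : gword S :=
  rev [seq (x.1, ~~ x.2) | x <- w].

Inductive gcongr (S : Type) (R : seq S -> seq S -> Prop) :
    gword S -> gword S -> Prop :=
| GRefl u : gcongr R u u
| GSym u v : gcongr R u v -> gcongr R v u
| GTrans u v w : gcongr R u v -> gcongr R v w -> gcongr R u w
| GCat u v w w' : gcongr R w w' -> gcongr R (u ++ w ++ v) (u ++ w' ++ v)
| GCancel s b : gcongr R [:: (s, b); (s, ~~ b)] [::]
| GRel u v : R u v -> gcongr R (gpos u) (gpos v).

Lemma gcongr_cat S (R : seq S -> seq S -> Prop) u u' v v' :
  gcongr R u u' -> gcongr R v v' -> gcongr R (u ++ v) (u' ++ v').
Proof.
move=> uu' vv'; apply: (@GTrans _ _ _ (u' ++ v)).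
  exact: (@GCat _ _ [::] v _ _ uu').
by have := @GCat _ _ u' [::] _ _ vv'; rewrite !cats0.
Qed.

Lemma gcongr_invr S (R : seq S -> seq S -> Prop) u :
  gcongr R (u ++ ginv u) [::].
Proof.
elim: u => [|[s b] u IHu]; first exact: GRefl.
rewrite /ginv /= rev_cons -cats1 catA.
apply: GTrans (GCancel R s b).
exact: (@GCat _ R [:: (s, b)] [:: (s, ~~ b)] _ _ IHu).
Qed.

Lemma ginvK S : involutive (@ginv S).
Proof.
move=> u; rewrite /ginv map_rev revK -map_comp -[RHS]map_id.
by apply: eq_map => -[s b] /=; rewrite negbK.
Qed.

Lemma gcongr_invl S (R : seq S -> seq S -> Prop) u :
  gcongr R (ginv u ++ u) [::].
Proof. by have := gcongr_invr R (ginv u); rewrite ginvK. Qed.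

Lemma gcongr_ginv S (R : seq S -> seq S -> Prop) u v :
  gcongr R u v -> gcongr R (ginv u) (ginv v).
Proof.
move=> uv; apply: (@GTrans _ _ _ (ginv u ++ v ++ ginv v)).
  apply: GSym; rewrite -[X in gcongr _ _ X]cats0.
  by apply: gcongr_cat (GRefl _ _) _; apply: gcongr_invr.
rewrite catA -[X in gcongr _ _ X]cat0s.
apply: gcongr_cat (GRefl _ _).
apply: GTrans (gcongr_invl R u).
by apply: gcongr_cat (GRefl _ _) _; apply: GSym.
Qed.

Definition gcongrb (S : choiceType) (R : seq S -> seq S -> Prop) :
  rel (gword S) := fun u v => `[< gcongr R u v >].

Lemma gcongrb_refl (S : choiceType) (R : seq S -> seq S -> Prop) :
  reflexive (gcongrb R).
Proof. by move=> u; apply/asboolP; apply: GRefl. Qed.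

Lemma gcongrb_sym (S : choiceType) (R : seq S -> seq S -> Prop) :
  symmetric (gcongrb R).
Proof. by move=> u v; apply/asboolP/asboolP; apply: GSym. Qed.

Lemma gcongrb_trans (S : choiceType) (R : seq S -> seq S -> Prop) :
  transitive (gcongrb R).
Proof. by move=> v u w /asboolP uv /asboolP vw; apply/asboolP/(GTrans uv). Qed.

Definition gcongr_equiv (S : choiceType) (R : seq S -> seq S -> Prop) :=
  EquivRel (gcongrb R) (gcongrb_refl R) (gcongrb_sym R) (@gcongrb_trans S R).

Definition presented (S : choiceType) (R : seq S -> seq S -> Prop) :=
  {eq_quot (gcongr_equiv R)}%qT.

HB.instance Definition _ (S : choiceType) (R : seq S -> seq S -> Prop) :=
  Choice.on (presented R).

Definition gclass (S : choiceType) (R : seq S -> seq S -> Prop)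
  (w : gword S) : presented R := (\pi_({eq_quot (gcongr_equiv R)}) w)%qT.

Definition grepr (S : choiceType) (R : seq S -> seq S -> Prop)
  (x : presented R) : gword S := repr (x : {eq_quot (gcongr_equiv R)}%qT).

Lemma greprK (S : choiceType) (R : seq S -> seq S -> Prop) (x : presented R) :
  gclass R (grepr x) = x.
Proof. exact: reprK. Qed.

Lemma gclassP (S : choiceType) (R : seq S -> seq S -> Prop) u v :
  gclass R u = gclass R v <-> gcongr R u v.
Proof.
split=> [/eqmodP/asboolP//|uv].
by apply/eqmodP/asboolP.
Qed.

Lemma gcongr_repr (S : choiceType) (R : seq S -> seq S -> Prop) u :
  gcongr R (grepr (gclass R u)) u.
Proof. by apply/gclassP; rewrite greprK. Qed.

Definition gmul (S : choiceType) (R : seq S -> seq S -> Prop)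
  (x y : presented R) : presented R := gclass R (grepr x ++ grepr y).

Definition ginvg (S : choiceType) (R : seq S -> seq S -> Prop)
  (x : presented R) : presented R := gclass R (ginv (grepr x)).

Lemma gmul_class (S : choiceType) (R : seq S -> seq S -> Prop) u v :
  gmul (gclass R u) (gclass R v) = gclass R (u ++ v).
Proof. by apply/gclassP; apply: gcongr_cat; apply: gcongr_repr. Qed.

Lemma ginvg_class (S : choiceType) (R : seq S -> seq S -> Prop) u :
  ginvg (gclass R u) = gclass R (ginv u).
Proof. by apply/gclassP; apply: gcongr_ginv; apply: gcongr_repr. Qed.

Lemma gmulA (S : choiceType) (R : seq S -> seq S -> Prop) :
  associative (@gmul S R).
Proof.
move=> x y z; rewrite -(greprK x) -(greprK y) -(greprK z).
by rewrite !gmul_class catA.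
Qed.

Lemma gmul1g (S : choiceType) (R : seq S -> seq S -> Prop) :
  left_id (gclass R [::]) (@gmul S R).
Proof. by move=> x; rewrite -(greprK x) gmul_class. Qed.

Lemma gmulg1 (S : choiceType) (R : seq S -> seq S -> Prop) :
  right_id (gclass R [::]) (@gmul S R).
Proof. by move=> x; rewrite -(greprK x) gmul_class cats0. Qed.

Lemma gmulVg (S : choiceType) (R : seq S -> seq S -> Prop) :
  left_inverse (gclass R [::]) (@ginvg S R) (@gmul S R).
Proof.
move=> x; rewrite -(greprK x) ginvg_class gmul_class.
by apply/gclassP; apply: gcongr_invl.
Qed.

Lemma gmulgV (S : choiceType) (R : seq S -> seq S -> Prop) :
  right_inverse (gclass R [::]) (@ginvg S R) (@gmul S R).
Proof.
move=> x; rewrite -(greprK x) ginvg_class gmul_class.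
by apply/gclassP; apply: gcongr_invr.
Qed.

HB.instance Definition _ (S : choiceType) (R : seq S -> seq S -> Prop) :=
  isGroup.Build (presented R)
    (@gmulA S R) (@gmul1g S R) (@gmulg1 S R) (@gmulVg S R) (@gmulgV S R).

Definition ggen (S : choiceType) (R : seq S -> seq S -> Prop) (s : S) :
  presented R := gclass R [:: (s, false)].

Definition geval (S : Type) (G : groupType) (f : S -> G) (w : gword S) : G :=
  \prod_(x <- w) (if x.2 then (f x.1)^-1 else f x.1).

(* The group morphism sending each generator [s] to [f s]; meaningful when [f]
   respects [R], see [gliftM] and [glift_gen]. *)
Definition glift (S : choiceType) (R : seq S -> seq S -> Prop)
  (G : groupType) (f : S -> G) (x : presented R) : G := geval f (grepr x).

Lemma geval_cat (S : Type) (G : groupType) (f : S -> G) u v :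
  geval f (u ++ v) = geval f u * geval f v.
Proof. exact: big_cat. Qed.

Lemma geval_congr (S : Type) (R : seq S -> seq S -> Prop) (G : groupType)
    (f : S -> G) :
    (forall u v, R u v -> \prod_(s <- u) f s = \prod_(s <- v) f s) ->
  forall u v, gcongr R u v -> geval f u = geval f v.
Proof.
move=> fR u v; elim=> {u v} //.
- by move=> u v w _ -> _ ->.
- by move=> u v w w' _ ww'; rewrite !geval_cat ww'.
- move=> s b; rewrite /geval big_cons big_seq1 big_nil /=.
  by case: b; rewrite /= ?mulVg ?mulgV.
- by move=> u v /fR; rewrite /geval !big_map.
Qed.

Lemma glift_class (S : choiceType) (R : seq S -> seq S -> Prop)
    (G : groupType) (f : S -> G) :
    (forall u v, R u v -> \prod_(s <- u) f s = \prod_(s <- v) f s) ->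
  forall w, glift f (gclass R w) = geval f w.
Proof. by move=> fR w; apply: (geval_congr fR); apply: gcongr_repr. Qed.

Lemma gliftM (S : choiceType) (R : seq S -> seq S -> Prop)
    (G : groupType) (f : S -> G) :
    (forall u v, R u v -> \prod_(s <- u) f s = \prod_(s <- v) f s) ->
  {morph glift f : x y / (x : presented R) * y >-> x * y}.
Proof.
move=> fR x y; rewrite -(greprK x) -(greprK y).
rewrite -[X in glift f X]/(gmul _ _) gmul_class.
by rewrite !(glift_class fR) geval_cat.
Qed.

Lemma glift_gen (S : choiceType) (R : seq S -> seq S -> Prop)
    (G : groupType) (f : S -> G) :
    (forall u v, R u v -> \prod_(s <- u) f s = \prod_(s <- v) f s) ->
  forall s, glift f (ggen R s) = f s.
Proof. by move=> fR s; rewrite (glift_class fR) /geval big_seq1. Qed.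

Lemma gclass_pos (S : choiceType) (R : seq S -> seq S -> Prop) w :
  gclass R (gpos w) = \prod_(s <- w) ggen R s.
Proof.
elim: w => [|s w IHw]; first by rewrite big_nil.
by rewrite big_cons -IHw -[RHS]/(gmul _ _) gmul_class.
Qed.

Lemma gprod_rel (S : choiceType) (R : seq S -> seq S -> Prop) u v :
  R u v -> \prod_(s <- u) ggen R s = \prod_(s <- v) ggen R s.
Proof. by move=> uv; rewrite -!gclass_pos; apply/gclassP; apply: GRel. Qed.

Lemma geval_gen (S : choiceType) (R : seq S -> seq S -> Prop) w :
  geval (ggen R) w = gclass R w.
Proof.
elim: w => [|[s b] w IHw]; first by rewrite /geval big_nil.
rewrite -cat1s geval_cat IHw -[LHS]/(gmul _ _).
rewrite {1}/geval big_seq1 /=; case: b; last by rewrite gmul_class.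
by rewrite -[_^-1]/(ginvg _) ginvg_class gmul_class.
Qed.

Record coxeter_matrix (S : Type) := CoxeterMatrix {
  cox_entry :> S -> S -> nat;
  cox_gt0 : forall i j, 0 < cox_entry i j;
  cox_sym : forall i j, cox_entry i j = cox_entry j i;
  cox_eq1 : forall i j, cox_entry i j = 1%N <-> i = j }.

Definition alt_word (S : Type) (k : nat) (x y : S) : seq S :=
  mkseq (fun t => if odd t then y else x) k.

Inductive artin_rel (S : Type) (m : coxeter_matrix S) :
    seq S -> seq S -> Prop :=
| ArtinBraid i j :
    artin_rel m (alt_word (m i j) i j) (alt_word (m i j) j i).

Inductive coxeter_rel (S : Type) (m : coxeter_matrix S) :
    seq S -> seq S -> Prop :=
| CoxeterBraid u v : artin_rel m u v -> coxeter_rel m u v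
| CoxeterSquare i : coxeter_rel m [:: i; i] [::].

Definition artin (S : choiceType) (m : coxeter_matrix S) : Type :=
  presented (artin_rel m).

HB.instance Definition _ (S : choiceType) (m : coxeter_matrix S) :=
  Group.on (artin m).

Definition coxeter (S : choiceType) (m : coxeter_matrix S) : Type :=
  presented (coxeter_rel m).

HB.instance Definition _ (S : choiceType) (m : coxeter_matrix S) :=
  Group.on (coxeter m).

Definition sigma (S : choiceType) (m : coxeter_matrix S) (i : S) : artin m :=
  ggen (artin_rel m) i.

Definition spherical (S : choiceType) (m : coxeter_matrix S) : Prop :=
  finite_set [set: coxeter m].

Definition irreducible (S : choiceType) (m : coxeter_matrix S) : Prop :=
  forall i j : S, exists p : seq S,
    path (fun a b => 3 <= m a b) i p /\ last i p = j.

(* The image of the Artin-Tits monoid: an element of that monoid is the class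
   of a word in the generators. *)
Definition artin_pos (S : choiceType) (m : coxeter_matrix S) (g : artin m) :
  Prop := exists w : seq S, g = \prod_(i <- w) sigma m i.

Definition artin_le (S : choiceType) (m : coxeter_matrix S) :
  rel (artin m) := fun g h => `[< artin_pos (g^-1 * h) >].

Lemma artin_pos1 (S : choiceType) (m : coxeter_matrix S) :
  artin_pos (1 : artin m).
Proof. by exists [::]; rewrite big_nil. Qed.

Lemma artin_posM (S : choiceType) (m : coxeter_matrix S) (g h : artin m) :
  artin_pos g -> artin_pos h -> artin_pos (g * h).
Proof. by move=> [u ->] [v ->]; exists (u ++ v); rewrite big_cat. Qed.

Lemma count_gposN (S : Type) (w : seq S) :
  count (fun x => ~~ x.2) (gpos w) = size w.
Proof. by rewrite /gpos count_map -[RHS]count_predT; apply: eq_count. Qed.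

Lemma count_gposV (S : Type) (w : seq S) : count (fun x => x.2) (gpos w) = 0%N.
Proof. by rewrite /gpos count_map -(count_pred0 w); apply: eq_count. Qed.

Lemma artin_gcongr_length (S : choiceType) (m : coxeter_matrix S) u v :
    gcongr (artin_rel m) u v ->
  (count (fun x => ~~ x.2) u + count (fun x => x.2) v
   = count (fun x => ~~ x.2) v + count (fun x => x.2) u)%N.
Proof.
elim=> {u v} //.
- by move=> u v w _ uv _ vw; lia.
- by move=> u v w w' _; rewrite !count_cat; lia.
- by move=> s [].
- by move=> _ _ [i j]; rewrite !count_gposN !count_gposV !size_mkseq.
Qed.

Lemma artin_pos_inv (S : choiceType) (m : coxeter_matrix S) (g : artin m) :
  artin_pos g -> artin_pos g^-1 -> g = 1.
Proof.
move=> [u gu] [v gv].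
have: gclass (artin_rel m) (gpos (u ++ v)) = gclass _ [::].
  by rewrite gclass_pos big_cat -gu -gv; apply: mulgV.
move/gclassP/artin_gcongr_length.
rewrite count_gposN count_gposV !addn0.
by move/size0nil; case: u gu => // -> _; rewrite big_nil.
Qed.

Lemma artin_le_refl (S : choiceType) (m : coxeter_matrix S) :
  reflexive (@artin_le S m).
Proof. by move=> g; apply/asboolP; rewrite mulVg; apply: artin_pos1. Qed.

Lemma artin_le_anti (S : choiceType) (m : coxeter_matrix S) :
  antisymmetric (@artin_le S m).
Proof.
move=> g h /andP[/asboolP gh /asboolP hg].
have: g^-1 * h = 1.
  by apply: artin_pos_inv => //; rewrite invgM invgK.
by move/(congr1 (fun x => g * x)); rewrite mulgA mulgV mul1g mulg1.
Qed.

Lemma artin_le_trans (S : choiceType) (m : coxeter_matrix S) :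
  transitive (@artin_le S m).
Proof.
move=> h g k /asboolP gh /asboolP hk; apply/asboolP.
have -> : g^-1 * k = (g^-1 * h) * (h^-1 * k) by rewrite mulgA -(mulgA g^-1) mulgV mulg1.
exact: artin_posM.
Qed.

Fact artin_display : Order.disp_t. Proof. exact: Order.Disp tt tt. Qed.

HB.instance Definition _ (S : choiceType) (m : coxeter_matrix S) :=
  Order.Le_isPOrder.Build artin_display (artin m)
    (@artin_le_refl S m) (@artin_le_anti S m) (@artin_le_trans S m).

Lemma artin_leE (S : choiceType) (m : coxeter_matrix S) (g h : artin m) :
  (g <= h)%O <-> artin_pos (g^-1 * h).
Proof. by split=> /asboolP. Qed.

Lemma artin_le_mulg2l (S : choiceType) (m : coxeter_matrix S)
    (x y z : artin m) :
  (y <= z)%O -> (x * y <= x * z)%O.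
Proof. by rewrite !artin_leE invgM -mulgA (mulgA x^-1) mulVg mul1g. Qed.

HB.instance Definition _ (S : choiceType) (m : coxeter_matrix S) :=
  isLeftOrdered.Build artin_display (artin m) (@artin_le_mulg2l S m).

Definition diagram_perm (S : Type) (m : coxeter_matrix S) (phi : S -> S) :
  Prop := bijective phi /\ forall i j, m (phi i) (phi j) = m i j.

Definition delta (S : choiceType) (m : coxeter_matrix S) (phi : S -> S) :
  artin m -> artin m := glift (fun i => sigma m (phi i)).

Definition diagram_aut (S : choiceType) (m : coxeter_matrix S)
    (f : artin m -> artin m) : Prop :=
  exists phi : S -> S, diagram_perm m phi /\ f = delta phi.

Lemma delta_rel (S : choiceType) (m : coxeter_matrix S) (phi : S -> S) :
    diagram_perm m phi -> forall u v, artin_rel m u v ->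
  \prod_(i <- u) sigma m (phi i) = \prod_(i <- v) sigma m (phi i).
Proof.
move=> [_ phim] _ _ [i j].
have e x y : \prod_(s <- alt_word (m i j) x y) sigma m (phi s) =
    \prod_(s <- alt_word (m (phi i) (phi j)) (phi x) (phi y)) sigma m s.
  rewrite phim /alt_word /mkseq !big_map; apply: eq_bigr => t _.
  by case: (odd t).
by rewrite !e; apply: gprod_rel; constructor.
Qed.

Lemma deltaM (S : choiceType) (m : coxeter_matrix S) (phi : S -> S) :
  diagram_perm m phi -> {morph @delta S m phi : g h / g * h}.
Proof. by move=> /delta_rel phiR; apply: gliftM. Qed.

Lemma delta_sigma (S : choiceType) (m : coxeter_matrix S) (phi : S -> S) :
  diagram_perm m phi -> forall i, delta phi (sigma m i) = sigma m (phi i).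
Proof. by move=> /delta_rel phiR i; apply: (glift_gen phiR). Qed.

Lemma delta1 (S : choiceType) (m : coxeter_matrix S) (phi : S -> S) :
  diagram_perm m phi -> delta phi (1 : artin m) = 1.
Proof.
move=> phim; have := deltaM phim 1 1; rewrite mul1g.
by move/(congr1 (fun x => (delta phi 1)^-1 * x)); rewrite mulgA mulVg mul1g.
Qed.

Lemma deltaV (S : choiceType) (m : coxeter_matrix S) (phi : S -> S) :
  diagram_perm m phi -> {morph @delta S m phi : g / g^-1}.
Proof.
move=> phim g; have := deltaM phim g g^-1; rewrite mulgV delta1 //.
move/(congr1 (fun x => (delta phi g)^-1 * x)).
by rewrite mulgA mulVg mul1g mulg1.
Qed.

Lemma delta_prod (S : choiceType) (m : coxeter_matrix S) (phi : S -> S) w :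
    diagram_perm m phi ->
  delta phi (\prod_(i <- w) sigma m i) = \prod_(i <- w) sigma m (phi i).
Proof.
move=> phim; elim: w => [|i w IHw]; first by rewrite !big_nil delta1.
by rewrite !big_cons deltaM // delta_sigma // IHw.
Qed.

Lemma delta_pos (S : choiceType) (m : coxeter_matrix S) (phi : S -> S) g :
  diagram_perm m phi -> artin_pos g -> artin_pos (@delta S m phi g).
Proof.
move=> phim [w ->]; exists (map phi w).
by rewrite delta_prod // big_map.
Qed.

Lemma deltaK (S : choiceType) (m : coxeter_matrix S) (phi psi : S -> S) :
    diagram_perm m phi -> diagram_perm m psi -> cancel phi psi ->
  cancel (@delta S m phi) (delta psi).
Proof.
move=> phim psim phiK g; rewrite -(greprK g).
elim: (grepr g) => [|[i b] w IHw]; first by rewrite !delta1.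
have -> : gclass (artin_rel m) ((i, b) :: w) =
    (gclass (artin_rel m) [:: (i, b)] : artin m) * gclass _ w.
  by rewrite -[RHS]/(gmul _ _) gmul_class.
rewrite !deltaM // IHw; congr (_ * _).
have dK : delta psi (delta phi (sigma m i)) = sigma m i.
  by rewrite !delta_sigma // phiK.
case: b; last exact: dK.
have -> : gclass (artin_rel m) [:: (i, true)] = (sigma m i)^-1.
  by rewrite -[RHS]/(ginvg _) ginvg_class.
by rewrite !deltaV // dK.
Qed.

Lemma diagram_perm_inv (S : Type) (m : coxeter_matrix S) phi psi :
  diagram_perm m phi -> cancel phi psi -> cancel psi phi -> diagram_perm m psi.
Proof.
move=> [_ phim] phiK psiK; split; first by exists phi.
by move=> i j; rewrite -phim !psiK.
Qed.

Lemma diagram_aut_inj (S : choiceType) (m : coxeter_matrix S) f :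
  @diagram_aut S m f -> injective f.
Proof.
move=> [phi [phim ->]]; have [[psi phiK psiK] _] := phim.
exact: can_inj (deltaK phim (diagram_perm_inv phim phiK psiK) phiK).
Qed.

Lemma diagram_autM (S : choiceType) (m : coxeter_matrix S) f :
  @diagram_aut S m f -> {morph f : g h / g * h}.
Proof. by move=> [phi [phim ->]]; apply: deltaM. Qed.

Lemma diagram_aut1 (S : choiceType) (m : coxeter_matrix S) f :
  @diagram_aut S m f -> f 1 = 1.
Proof. by move=> [phi [phim ->]]; apply: delta1. Qed.

Lemma diagram_autV (S : choiceType) (m : coxeter_matrix S) f :
  @diagram_aut S m f -> {morph f : g / g^-1}.
Proof. by move=> [phi [phim ->]]; apply: deltaV. Qed.

Lemma diagram_aut_pos (S : choiceType) (m : coxeter_matrix S) f g :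
  @diagram_aut S m f -> artin_pos g -> artin_pos (f g).
Proof. by move=> [phi [phim ->]]; apply: delta_pos. Qed.

(* Homomorphisms from the Artin-Tits group to its group of diagram
   automorphisms, the latter with composition of functions. *)
Record diagram_hom (S : choiceType) (m : coxeter_matrix S) := DiagramHom {
  dhom :> artin m -> artin m -> artin m;
  dhom_aut : forall g, diagram_aut (dhom g);
  dhomM : forall g h, dhom (g * h) = dhom g \o dhom h }.

Definition circ (S : choiceType) (m : coxeter_matrix S) (alpha : diagram_hom m)
  (g h : artin m) : artin m := g * alpha g h.

(* For an arbitrary [alpha], associativity is all that [circ] may lack in order to be a group law. *)
Definition twisted (S : choiceType) (m : coxeter_matrix S)
  (alpha : diagram_hom m) (alphaA : associative (circ alpha)) : Type := artin m.

Definition circ_inv (S : choiceType) (m : coxeter_matrix S)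
  (alpha : diagram_hom m) (g : artin m) : artin m := alpha g^-1 g^-1.

Lemma dhom1 (S : choiceType) (m : coxeter_matrix S) (alpha : diagram_hom m) g :
  alpha 1 g = g.
Proof.
apply: (diagram_aut_inj (dhom_aut alpha 1)).
by rewrite -[in RHS](mulg1 1) dhomM.
Qed.

Lemma circ1g (S : choiceType) (m : coxeter_matrix S) (alpha : diagram_hom m) :
  left_id 1 (circ alpha).
Proof. by move=> g; rewrite /circ dhom1 mul1g. Qed.

Lemma circg1 (S : choiceType) (m : coxeter_matrix S) (alpha : diagram_hom m) :
  right_id 1 (circ alpha).
Proof. by move=> g; rewrite /circ (diagram_aut1 (dhom_aut _ _)) mulg1. Qed.

Lemma circgV (S : choiceType) (m : coxeter_matrix S) (alpha : diagram_hom m) :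
  right_inverse 1 (circ_inv alpha) (circ alpha).
Proof.
move=> g; rewrite /circ /circ_inv -[alpha g _]/((alpha g \o alpha g^-1) g^-1).
by rewrite -dhomM mulgV dhom1 mulgV.
Qed.

Lemma circVg (S : choiceType) (m : coxeter_matrix S) (alpha : diagram_hom m) :
  associative (circ alpha) -> left_inverse 1 (circ_inv alpha) (circ alpha).
Proof.
move=> aA g; set i := circ_inv alpha g.
have -> : circ alpha i g = circ alpha (circ alpha i g)
    (circ alpha i (circ_inv alpha i)) by rewrite circgV circg1.
by rewrite -aA (aA g i) circgV circ1g circgV.
Qed.

HB.instance Definition _ (S : choiceType) (m : coxeter_matrix S)
    (alpha : diagram_hom m) (alphaA : associative (circ alpha)) :=
  Order.POrder.copy (twisted alphaA) (artin m).

HB.instance Definition _ (S : choiceType) (m : coxeter_matrix S)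
    (alpha : diagram_hom m) (alphaA : associative (circ alpha)) :=
  isGroup.Build (twisted alphaA) alphaA
    (circ1g alpha) (circg1 alpha) (circVg alphaA) (circgV alpha).

Lemma circ_le2l (S : choiceType) (m : coxeter_matrix S)
    (alpha : diagram_hom m) (x y z : artin m) :
  (y <= z)%O -> (circ alpha x y <= circ alpha x z)%O.
Proof.
move=> /artin_leE yz; apply/artin_leE.
rewrite /circ invgM -mulgA (mulgA x^-1) mulVg mul1g.
have ax := dhom_aut alpha x.
by rewrite -(diagram_autV ax) -(diagram_autM ax); apply: (diagram_aut_pos ax).
Qed.

Lemma twisted_le_mulg2l (S : choiceType) (m : coxeter_matrix S)
    (alpha : diagram_hom m) (alphaA : associative (circ alpha))
    (x y z : twisted alphaA) :
  (y <= z)%O -> (x * y <= x * z)%O.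
Proof. exact: (@circ_le2l S m alpha x y z). Qed.

HB.instance Definition _ (S : choiceType) (m : coxeter_matrix S)
    (alpha : diagram_hom m) (alphaA : associative (circ alpha)) :=
  isLeftOrdered.Build artin_display (twisted alphaA)
    (@twisted_le_mulg2l S m alpha alphaA).

Definition twisted_formation (S : choiceType) (m : coxeter_matrix S)
    (alpha : diagram_hom m) (alphaA : associative (circ alpha)) :
  formation (artin m) :=
  @Formation artin_display (artin m) artin_display (twisted alphaA) id
    (Bijective (fun=> erefl) (fun=> erefl)) (fun _ _ => erefl) erefl.

(* Labels are the natural numbers [1, ..., n]; the values of the matrices and
   of the permutations below at other arguments are irrelevant. *)

Definition consecutive (i j : nat) : bool := (j == i.+1) || (i == j.+1).

Definition joins (a b i j : nat) : bool :=
  ((i == a) && (j == b)) || ((i == b) && (j == a)).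

Definition matA (i j : nat) : nat :=
  if i == j then 1%N else if consecutive i j then 3 else 2.

Definition matD (n i j : nat) : nat :=
  if i == j then 1%N else
  if [|| joins 1 n i j, joins 2 n i j, joins 3 n i j
       | [&& consecutive i j, 3 <= minn i j & minn i j <= n - 2]]
  then 3 else 2.

Definition matE6 (i j : nat) : nat :=
  if i == j then 1%N else
  if [|| joins 1 2 i j, joins 2 3 i j, joins 3 4 i j, joins 4 5 i j
       | joins 3 6 i j]
  then 3 else 2.

Definition matF4 (i j : nat) : nat :=
  if i == j then 1%N else
  if joins 1 2 i j || joins 3 4 i j then 3 else
  if joins 2 3 i j then 4 else 2.

Definition matI (n i j : nat) : nat := if i == j then 1%N else n.

(* [table n M p]: for the type of rank [n] with matrix [M] there is an entry
   sending each [sigma_i] to the diagram automorphism of the permutation [p i].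
   [next [:: a; b; c]] is the cycle (a b c). *)
Inductive table : nat -> (nat -> nat -> nat) -> (nat -> nat -> nat) -> Prop :=
| TableA n : 2 <= n -> table n matA (fun _ j => (n.+1 - j)%N)
| TableD n : 4 <= n -> table n (matD n) (fun _ => next [:: 1; 2]%N)
| TableD4_transposition (a : nat) : a \in [:: 1; 2]%N ->
    table 4 (matD 4) (fun _ => next [:: a; 3])
| TableD4_cycle (a b : nat) : perm_eq [:: a; b] [:: 2; 3] ->
    table 4 (matD 4) (fun _ => next [:: 1%N; a; b])
| TableD4_mixed (a b c : nat) : perm_eq [:: a; b; c] [:: 1%N; 2; 3] ->
    table 4 (matD 4) (fun i => if i <= 3 then next [:: a; b] else next [:: b; c])
| TableE6 : table 6 matE6 (fun _ => next [:: 1%N; 5] \o next [:: 2; 4])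
| TableF4 : table 4 matF4 (fun _ => next [:: 1%N; 4] \o next [:: 2; 3])
| TableI n : 4 <= n -> table 2 (matI n) (fun _ => next [:: 1; 2]%N).

Definition labels (n : nat) : set nat := [set i | 1 <= i <= n].

(* [nu] numbers the generators by [1, ..., n] so that [m] becomes [M]. *)
Definition numbering (S : Type) (m : coxeter_matrix S) (n : nat)
    (M : nat -> nat -> nat) (nu : nat -> S) : Prop :=
  set_bij (labels n) [set: S] nu /\
  forall i j, labels n i -> labels n j -> m (nu i) (nu j) = M i j.

(* A numbering is unique up to a diagram automorphism, which permutes the
   entries of the table for the given type: the choice of [nu] is immaterial. *)
Definition listed (S : choiceType) (m : coxeter_matrix S)
    (alpha : diagram_hom m) : Prop :=
  exists n M p nu, [/\ table n M p, numbering m n M nu &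
    forall i, labels n i -> exists phi : S -> S,
      (forall j, labels n j -> phi (nu j) = nu (p i j)) /\
      alpha (sigma m (nu i)) = delta phi].

(* Main.v *)
Require Import Defs.
From HB Require Import structures.
From mathcomp Require Import all_boot all_order all_algebra.
From mathcomp Require Import all_classical.
From mathcomp Require Import ring lra zify realalg.

(** The group law of a formation, transported to the Artin-Tits group [Gamma]
    by the order isomorphism, is a second law with the same order. Its left
    translation by [g], divided by that of [Gamma], is an order automorphism
    of [Gamma] that fixes 1. The main point is that such an automorphism is a
    diagram automorphism ([order_aut_diagram]). The second law is therefore
    [g * delta (pi g) h], and its associativity makes [pi] a crossed morphism
    ([cocycle]). The rest depends on the diagram only: if [pi] is not trivial,
    then the diagram has a nontrivial symmetry, which leaves the types of the
    table ([symmetric_types]), and for each of them the relations of [Gamma]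
    determine [pi] ([cocycle_two_type], [cocycle_D4]). A formation determines
    its law, hence [alpha] ([twisted_unique]).

    Why are order automorphisms that fix 1 diagram automorphisms? The covers
    of [g] are the [g * sigma i], so an order automorphism permutes the labels
    of covers at each [g]. Two generators span an interval with exactly two
    maximal chains, labelled by the two sides of a braid relation. Its image is
    again an interval with two chains, and their labels are equal positive
    words. Positive words with the same value in [Gamma] are related by braid
    moves ([artin_embedding]), so the image is again a braid relation. Hence
    the label permutations at [g] and at [g * sigma i] agree, and they preserve
    the Coxeter matrix.

    The embedding of the monoid comes from cancellation ([braid_catI]) and
    from a central positive word that all generators divide ([braid_central]).
    Cancellation is proved with Garside's reduction property ([head_uptoP]): if
    words with first letters [i] and [j] are equal in the monoid, then both are
    multiples of the braid word of [i] and [j]. The induction on the length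
    reduces to three letters [i], [k], [j], and this case is settled in the
    Coxeter group: reduced words lift to the monoid by Matsumoto's theorem, and
    two of them that divide a common word have a join that divides it too.

    The facts on the Coxeter group come from its reflection action on linear
    forms, through one statement: if prepending [i] to a reduced word [w]
    leaves it reduced, then [w] moves positive forms to forms that are positive
    at [i] ([act_gt0]). It yields the structure of elements with two descents
    ([reduced_braid]), the longest element ([longest_word]), and a criterion
    that excludes affine diagrams ([no_affine]), on which the classification of
    symmetric diagrams rests. *)

Set Implicit Arguments.
Unset Strict Implicit.
Unset Printing Implicit Defensive.

Import Order.TTheory GRing.Theory Num.Theory.

(** * Chebyshev polynomials *)

Section Chebyshev.
Local Open Scope ring_scope.

(** Two consecutive values, which makes the recursion of order two structural.
    *)
Fixpoint cheb2 (R : pzRingType) (a : R) (k : nat) : R * R :=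
  if k is k'.+1 then let: (p, q) := cheb2 a k' in (q, a * q - p) else (0, 1).

(** With [a = 2 cos t] this is [sin (k t) / sin t]: the coordinates of the
    roots of a dihedral group. *)
Definition cheb (R : pzRingType) (a : R) (k : nat) : R := (cheb2 a k).1.

Lemma cheb0 (R : pzRingType) (a : R) : cheb a 0 = 0. Proof. by []. Qed.

Lemma cheb1 (R : pzRingType) (a : R) : cheb a 1 = 1. Proof. by []. Qed.

Lemma chebSS (R : pzRingType) (a : R) k :
  cheb a k.+2 = a * cheb a k.+1 - cheb a k.
Proof. by rewrite /cheb /=; case: (cheb2 a k). Qed.

Lemma cheb_cassini (R : comPzRingType) (a : R) k :
  cheb a k.+1 ^+ 2 - cheb a k.+2 * cheb a k = 1.
Proof.
elim: k => [|k IHk]; first by rewrite cheb0 cheb1; ring.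
by rewrite -[RHS]IHk (chebSS a k.+1) (chebSS a k); ring.
Qed.

Lemma cheb_two (R : pzRingType) k : cheb (2 : R) k = k%:R.
Proof.
suff: cheb (2 : R) k = k%:R /\ cheb (2 : R) k.+1 = k.+1%:R by case.
elim: k => [//|k [IH IH']]; split=> //.
apply: (addIr (cheb (2 : R) k)); rewrite chebSS subrK IH IH' -natrM -natrD.
by congr _%:R; lia.
Qed.

(** These conditions single out [a = 2 cos (pi / m)]; the signs of [sin (k pi
    / m)] are what the root combinatorics needs of it. *)
Definition cheb_weight (R : numDomainType) (m : nat) (a : R) : Prop :=
  [/\ forall k, (0 < k < m)%N -> 0 < cheb a k, cheb a m = 0 & a < 2].

(** The Christoffel-Darboux identity shows that the ratio of consecutive
    values grows with the argument, so positivity persists beyond [a]. *)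
Lemma cheb_gt (R : realDomainType) (m : nat) (a b : R) :
    cheb_weight m a -> a < b ->
  forall k, (0 < k <= m)%N -> 0 < cheb b k.
Proof.
move=> [a_gt0 am0 _] ab.
have a_ge0 k : (k <= m)%N -> 0 <= cheb a k.
  case: k => // k; rewrite leq_eqVlt => /orP[/eqP->|lt]; first by rewrite am0.
  by apply/ltW/a_gt0.
suff H k : (k.+1 <= m)%N -> 0 < cheb b k.+1 /\
    0 <= cheb b k.+1 * cheb a k - cheb a k.+1 * cheb b k.
  by move=> [//|k] /H[].
elim: k => [|k IHk] lt_km; first by rewrite !cheb0 !cheb1; split=> //; lra.
have [pos1 mon] := IHk (ltnW lt_km).
have pa : 0 < cheb a k.+1 by apply: a_gt0.
pose r := (b - a) * (cheb a k.+1 * cheb b k.+1).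
have r_gt0 : 0 < r by rewrite !mulr_gt0 // subr_gt0.
have CD : cheb b k.+2 * cheb a k.+1 - cheb a k.+2 * cheb b k.+1 =
    r + (cheb b k.+1 * cheb a k - cheb a k.+1 * cheb b k).
  by rewrite /r !chebSS; ring.
split; last by rewrite CD; lra.
rewrite -(pmulr_lgt0 _ pa).
have : 0 <= cheb a k.+2 * cheb b k.+1 by apply: mulr_ge0 (a_ge0 _ _) (ltW pos1).
lra.
Qed.

Lemma horner_cheb (R : comNzRingType) (b : R) k :
  (cheb ('X : {poly R}) k).[b] = cheb b k.
Proof.
suff: (cheb ('X : {poly R}) k).[b] = cheb b k /\
      (cheb ('X : {poly R}) k.+1).[b] = cheb b k.+1 by case.
elim: k => [|k [IH IH']]; first by rewrite !cheb0 !cheb1 hornerE hornerC.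
by split=> //; rewrite !chebSS hornerD hornerN hornerM hornerX IH IH'.
Qed.

(** At a weight [a] for [m] the value of index [m.+1] is [- cheb a m.-1 < 0],
    and at 2 it is [m.+1]; a root in between is a weight for [m.+1] by
    [cheb_gt]. *)
Lemma cheb_weight_exists (R : rcfType) (m : nat) :
  (2 <= m)%N -> exists a : R, cheb_weight m a /\ 0 <= a.
Proof.
case: m => [//|[//|m _]]; elim: m => [|m [a [aw a_ge0]]].
  exists 0; split=> //; split=> //; last by rewrite chebSS mul0r sub0r cheb0 oppr0.
  by case=> [|[]].
have [a_gt0 am0 a_lt2] := aw.
pose p := cheb ('X : {poly R}) m.+3.
have pa : p.[a] < 0.
  by rewrite horner_cheb chebSS am0 mulr0 sub0r oppr_lt0 a_gt0 //=.
have p2 : 0 < p.[2] by rewrite horner_cheb cheb_two ltr0n.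
have [|b /andP[ab b2] /eqP pb] := @poly_ivt R p a 2 (ltW a_lt2).
  by rewrite ltW //= ltW.
have lt_ab : a < b.
  by rewrite lt_neqAle ab andbT; apply: contraTneq pa => ->; rewrite pb ltxx.
have lt_b2 : b < 2.
  by rewrite lt_neqAle b2 andbT; apply: contraTneq p2 => <-; rewrite pb ltxx.
exists b; split; last by apply: le_trans ab.
split=> //; last by rewrite -horner_cheb.
by move=> k /andP[k0 km]; apply: (cheb_gt aw lt_ab); rewrite k0.
Qed.

Lemma cheb_weight_pred (R : realDomainType) (m : nat) (a : R) :
  (2 <= m)%N -> cheb_weight m a -> cheb a m.-1 = 1.
Proof.
case: m => [//|[//|m _]] [a_gt0 am0 _] /=.
have := cheb_cassini a m; rewrite am0 mul0r subr0 => /eqP.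
have p0 : 0 < cheb a m.+1 by apply: a_gt0; rewrite ltnSn.
by rewrite sqrf_eq1 => /orP[/eqP//|/eqP e]; move: p0; rewrite e ltr0N1.
Qed.

Lemma cheb_weight_succ (R : realDomainType) (m : nat) (a : R) :
  (2 <= m)%N -> cheb_weight m a -> cheb a m.+1 = - 1.
Proof.
move=> m2 aw; rewrite -(cheb_weight_pred m2 aw); case: aw => _ + _.
by case: m m2 => [//|m] _ /= am0; rewrite chebSS am0 mulr0 sub0r.
Qed.

Lemma cheb_weight_ge0 (R : realDomainType) (m k : nat) (a : R) :
  cheb_weight m a -> (k <= m)%N -> 0 <= cheb a k.
Proof.
move=> [a_gt0 am0 _]; case: k => // k; rewrite leq_eqVlt => /orP[/eqP->|lt].
  by rewrite am0.
by apply/ltW/a_gt0.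
Qed.

Lemma cheb_weight_ge1 (R : realDomainType) (m : nat) (a : R) :
  (3 <= m)%N -> cheb_weight m a -> 1 <= a.
Proof.
move=> m3 aw; have [a_gt0 _ _] := aw.
have := a_gt0 2 m3; have := cheb_weight_ge0 aw m3.
by rewrite !chebSS cheb1 cheb0; nra.
Qed.

Lemma cheb_weight_sqr (R : realDomainType) (m : nat) (a : R) :
  (4 <= m)%N -> cheb_weight m a -> 2 <= a ^+ 2.
Proof.
move=> m4 aw; have a1 : 1 <= a by apply: cheb_weight_ge1 aw; lia.
by have := cheb_weight_ge0 aw m4; rewrite !chebSS cheb1 cheb0; nra.
Qed.

Lemma cheb_weight_5 (R : realFieldType) (m : nat) (a : R) :
  (5 <= m)%N -> cheb_weight m a -> 3 / 2 <= a.
Proof.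
move=> m5 aw; have a2 : 2 <= a ^+ 2 by apply: cheb_weight_sqr aw; lia.
have a1 : 1 <= a by apply: cheb_weight_ge1 aw; lia.
have h : 0 <= a ^+ 2 * a ^+ 2 - 3 * a ^+ 2 + 1.
  have := cheb_weight_ge0 aw m5; rewrite !chebSS cheb1 cheb0; congr (_ <= _); ring.
move: a2 h; set s := a ^+ 2 => a2 h.
(* indeed [s] is at least [(3 + sqrt 5) / 2], which exceeds [9 / 4] *)
have s9 : 9 / 4 <= s by nra.
by move: s9; rewrite /s; nra.
Qed.

End Chebyshev.

(** * Words in a Coxeter group *)

Arguments alt_word : simpl never.

Section AltWord.
Variable S : Type.
Implicit Types (x y : S) (k : nat).

Lemma size_alt k x y : size (alt_word k x y) = k.
Proof. exact: size_mkseq. Qed.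

Lemma alt_cons k x y : alt_word k.+1 x y = x :: alt_word k y x.
Proof.
rewrite /alt_word /mkseq /=; congr cons.
rewrite (iotaDl 1 0) -map_comp; apply: eq_map => t /=.
by case: (odd t).
Qed.

Lemma alt_rcons k x y :
  alt_word k.+1 x y = rcons (alt_word k x y) (if odd k then y else x).
Proof. by rewrite /alt_word mkseqS. Qed.

Lemma rev_alt k x y :
  rev (alt_word k x y) = if odd k then alt_word k x y else alt_word k y x.
Proof.
elim: k x y => [//|k IHk] x y.
rewrite [in LHS]alt_rcons rev_rcons IHk !alt_cons oddS.
by case: (odd k).
Qed.

Lemma alt_split k n x y : (n <= k)%N ->
  alt_word k x y = alt_word n x y ++
    (if odd n then alt_word (k - n) y x else alt_word (k - n) x y).
Proof.
elim: n k x y => [|n IHn] [|k] x y // nk; rewrite ?subn0 //.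
rewrite subSS (alt_cons k) (alt_cons n) (IHn k y x nk) cat_cons oddS.
by case: (odd n).
Qed.

End AltWord.

Section CoxeterWords.
Variables (S : choiceType) (m : coxeter_matrix S).
Implicit Types (u v w : seq S) (i j : S).
Local Open Scope group_scope.

Definition cword w : coxeter m := \prod_(i <- w) ggen (coxeter_rel m) i.

Lemma cword_cat u v : cword (u ++ v) = cword u * cword v.
Proof. exact: big_cat. Qed.

Lemma cword_cons i w : cword (i :: w) = cword [:: i] * cword w.
Proof. by rewrite -cat1s cword_cat. Qed.

Lemma cword_nil : cword [::] = 1. Proof. exact: big_nil. Qed.

Lemma cword_ii i : cword [:: i] * cword [:: i] = 1.
Proof.
rewrite -cword_cat -cword_nil.
exact: (gprod_rel (CoxeterSquare m i)).
Qed.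

Lemma cword_iiK i w : cword [:: i, i & w] = cword w.
Proof. by rewrite cword_cons (cword_cons i w) mulgA cword_ii mul1g. Qed.

Lemma cword_alt i j : cword (alt_word (m i j) i j) = cword (alt_word (m i j) j i).
Proof. exact: (gprod_rel (CoxeterBraid (ArtinBraid m i j))). Qed.

Lemma cword_rev w : cword (rev w) = (cword w)^-1.
Proof.
elim: w => [|i w IHw]; first by rewrite cword_nil invg1.
rewrite rev_cons -cats1 cword_cat IHw (cword_cons i w) invgM.
congr (_ * _); apply: (mulgI (cword [:: i])).
by rewrite cword_ii mulgV.
Qed.

Lemma cword_catI u v w : cword (u ++ v) = cword (u ++ w) -> cword v = cword w.
Proof. by rewrite !cword_cat => /mulgI. Qed.

Lemma cword_consI i v w : cword (i :: v) = cword (i :: w) -> cword v = cword w.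
Proof. exact: (@cword_catI [:: i]). Qed.

Lemma cword_catl u v w : cword v = cword w -> cword (u ++ v) = cword (u ++ w).
Proof. by rewrite !cword_cat => ->. Qed.

Lemma cword_catr u v w : cword u = cword v -> cword (u ++ w) = cword (v ++ w).
Proof. by rewrite !cword_cat => ->. Qed.

Lemma cword_gclass w : cword w = gclass (coxeter_rel m) (gpos w).
Proof. by rewrite gclass_pos. Qed.

Lemma cword_congr u v : cword u = cword v <->
  gcongr (coxeter_rel m) (gpos u) (gpos v).
Proof. by rewrite !cword_gclass; apply: gclassP. Qed.

Lemma cword_surj (g : coxeter m) : exists w, cword w = g.
Proof.
rewrite -(greprK g); elim: (grepr g) => [|[i b] w [v wv]].
  by exists [::]; rewrite cword_gclass.
exists (i :: v); rewrite cword_cons wv.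
have -> : cword [:: i] = gclass (coxeter_rel m) [:: (i, b)].
  case: b; last by rewrite cword_gclass.
  rewrite -[[:: (i, true)]]/(ginv (gpos [:: i])) -ginvg_class -cword_gclass.
  by rewrite -[ginvg _]/((cword [:: i])^-1) -cword_rev.
exact: gmul_class.
Qed.

Lemma cword_odd u v : cword u = cword v -> odd (size u) = odd (size v).
Proof.
move=> /cword_congr; suff H a b : gcongr (coxeter_rel m) a b ->
    odd (size a) = odd (size b) by move=> /H; rewrite !size_map.
elim=> {a b} //.
- by move=> a b c _ -> _ ->.
- by move=> a b c c' _ e; rewrite !size_cat !oddD e.
- move=> a b [{}a {}b [i j]|i]; last by [].
  by rewrite !size_map.
Qed.

Definition reduced w := forall v, cword v = cword w -> (size w <= size v)%N.

Lemma reduced_exists w : exists2 v, reduced v & cword v = cword w.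
Proof.
have ex : exists n, `[< exists2 v, size v = n & cword v = cword w >].
  by exists (size w); apply/asboolP; exists w.
case: (ex_minnP ex) => n /asboolP[v vn vw] nmin.
by exists v => // u uv; rewrite vn; apply: nmin; apply/asboolP; exists u; rewrite ?uv.
Qed.

Lemma reduced_catr u v : reduced (u ++ v) -> reduced v.
Proof.
move=> uv w wv; have := uv (u ++ w) (cword_catl u wv).
by rewrite !size_cat leq_add2l.
Qed.

Lemma reduced_catl u v : reduced (u ++ v) -> reduced u.
Proof.
move=> uv w wu; have := uv (w ++ v) (cword_catr v wu).
by rewrite !size_cat leq_add2r.
Qed.

Lemma reduced_eq u v :
  reduced u -> cword u = cword v -> (size v <= size u)%N -> reduced v.
Proof.
by move=> ru uv sz w wv; apply: leq_trans sz (ru _ _); rewrite uv.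
Qed.

Lemma reduced_size u v :
  reduced u -> reduced v -> cword u = cword v -> size u = size v.
Proof. by move=> ru rv uv; apply/eqP; rewrite eqn_leq ru ?rv. Qed.

Lemma reduced_rev u : reduced u -> reduced (rev u).
Proof.
move=> ru w; rewrite cword_rev => /(congr1 (fun x => x^-1)).
by rewrite invgK -cword_rev => /ru; rewrite !size_rev.
Qed.

(** The relations preserve the parity of the length, so prepending a letter to
    a word changes the length of its element by exactly one. *)
Lemma not_reduced_cons i v : reduced v -> ~ reduced (i :: v) ->
  exists v', [/\ cword v = cword (i :: v'), size v = (size v').+1 & reduced v'].
Proof.
move=> rv nr; have [w rw wE] := reduced_exists (i :: v).
have e : cword v = cword (i :: w).
  by rewrite cword_cons wE -cword_cons cword_iiK.
exists w; split=> //.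
have le1 : (size w < (size v).+1)%N.
  rewrite ltnNge; apply/negP => sz; apply: nr.
  exact: (reduced_eq rw).
have le2 := rv _ (esym e); have := cword_odd wE.
by move: le1 le2; rewrite /=; lia.
Qed.

End CoxeterWords.

(** * The reflection action *)

Section Geometric.
Variables (S : choiceType) (m : coxeter_matrix S) (R : rcfType).
Implicit Types (u v w : seq S) (i j : S) (f g : S -> R).
Local Open Scope ring_scope.

Definition cox_weight (n : nat) : R :=
  xget 0 [set a : R | cheb_weight n a /\ 0 <= a]%classic.

Lemma cox_weightP n : (2 <= n)%N ->
  cheb_weight n (cox_weight n) /\ 0 <= cox_weight n.
Proof. by move=> /(@cheb_weight_exists R) ex; apply: (xgetPex 0 ex). Qed.

(** The bilinear form on simple roots times [-2]: off the diagonal it is the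
    weight [2 cos (pi / m i j)], hence nonnegative. *)
Definition gram i j : R := if i == j then - 2 else cox_weight (m i j).

Lemma gramC i j : gram i j = gram j i.
Proof. by rewrite /gram eq_sym cox_sym. Qed.

Lemma gramii i : gram i i = - 2. Proof. by rewrite /gram eqxx. Qed.

Lemma cox_ge2 i j : i != j -> (2 <= m i j)%N.
Proof.
move=> /eqP ij; have := cox_gt0 m i j.
by case: (m i j) (@cox_eq1 _ m i j) => [//|[[/(_ erefl)//]|//]].
Qed.

Lemma gramP i j : i != j -> cheb_weight (m i j) (gram i j).
Proof. by move=> ij; rewrite /gram (negPf ij); case: (cox_weightP (cox_ge2 ij)). Qed.

Lemma gram_ge0 i j : i != j -> 0 <= gram i j.
Proof. by move=> ij; rewrite /gram (negPf ij); case: (cox_weightP (cox_ge2 ij)). Qed.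

(** The contragredient reflection: [f] stands for the linear form with value
    [f j] on the simple root [j], so that [S] may be infinite. *)
Definition refl i f : S -> R := fun j => f j + gram i j * f i.

Definition act w f : S -> R := foldr refl f w.

Lemma act_cat u v f : act (u ++ v) f = act u (act v f).
Proof. exact: foldr_cat. Qed.

Lemma act_cons i w f : act (i :: w) f = refl i (act w f).
Proof. by []. Qed.

Lemma refl_i i f : refl i f i = - f i.
Proof. by rewrite /refl gramii; lra. Qed.

Lemma reflK i f : refl i (refl i f) = f.
Proof. by apply/funext => j; rewrite {1}/refl refl_i /refl; ring. Qed.

(** The inverse of the alternating word sends the simple root [i] to a
    combination of the roots [i] and [j] with these coefficients. *)
Lemma act_alt k i j f : i != j ->
  act (alt_word k j i) f i =
    cheb (gram i j) k.+1 * f (if odd k then j else i) +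
    cheb (gram i j) k * f (if odd k then i else j).
Proof.
move=> ij; elim: k f => [|k IHk] f.
  by rewrite cheb0 cheb1 mul0r mul1r addr0.
rewrite alt_rcons -cats1 act_cat IHk /= /refl (chebSS _ k).
have ji : gram j i = gram i j by rewrite gramC.
by case: (odd k) => /=; rewrite ?gramii ?ji; ring.
Qed.

(** A word in two letters moves [f] along the rows of these letters only. As
    the form of rank two is nondegenerate, its effect is then determined by
    the values at [i] and [j], which reduces [act_braid] to [act_braid_at]. *)
Lemma act_plane k i j x y f : x \in [:: i; j] -> y \in [:: i; j] ->
  exists c d : R, forall l,
    act (alt_word k x y) f l = f l + c * gram i l + d * gram j l.
Proof.
elim: k x y f => [|k IHk] x y f xP yP.
  by exists 0, 0 => l; rewrite !mul0r !addr0.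
have [c [d h]] := IHk y x f yP xP.
set g := act _ f in h.
move: xP; rewrite !inE => /orP[]/eqP xE; rewrite {}xE in g h *.
  by exists (c + g i), d => l; rewrite alt_cons act_cons -/g /refl (h l); ring.
by exists c, (d + g j) => l; rewrite alt_cons act_cons -/g /refl (h l); ring.
Qed.

Lemma act_braid_at i j f : i != j ->
  act (alt_word (m i j) j i) f i = act (alt_word (m i j) i j) f i.
Proof.
move=> ij; have m2 := cox_ge2 ij; have aw := gramP ij.
rewrite act_alt //.
case E : (m i j) m2 => [//|n] m2; rewrite alt_cons act_cons refl_i act_alt // -E.
rewrite (cheb_weight_succ _ aw) ?E //; have /= -> := cheb_weight_pred m2 (eq_rect _ (fun n => cheb_weight n _) aw _ E).
rewrite E in aw; have [_ -> _] := aw.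
by case: (odd n) => /=; ring.
Qed.

Lemma act_braid i j f : act (alt_word (m i j) i j) f = act (alt_word (m i j) j i) f.
Proof.
have [->//|ij] := eqVneq i j.
have ji : j != i by rewrite eq_sym.
have [||c [d h]] := @act_plane (m i j) i j i j f; rewrite ?inE ?eqxx ?orbT //.
have [||c' [d' h']] := @act_plane (m i j) i j j i f; rewrite ?inE ?eqxx ?orbT //.
have := act_braid_at f ij; have := act_braid_at f ji.
rewrite !(cox_sym m j i) !h !h' !gramii (gramC j i) => e1 e2.
have [_ _ a2] := gramP ij; have a0 := gram_ge0 ij.
set a := gram i j in e1 e2 a2 a0.
have eC : (c - c') * a = 2 * (d - d') by lra.
have eD : (d - d') * a = 2 * (c - c') by lra.
have c0 : (c - c') * (4 - a ^+ 2) = 0.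
  transitivity (4 * (c - c') - (c - c') * a * a); first by ring.
  by rewrite eC -mulrA eD; ring.
have d0 : (d - d') * (4 - a ^+ 2) = 0.
  transitivity (4 * (d - d') - (d - d') * a * a); first by ring.
  by rewrite eD -mulrA eC; ring.
have nz : 4 - a ^+ 2 != 0 by apply: lt0r_neq0; nra.
move/eqP: c0; rewrite mulf_eq0 (negPf nz) orbF subr_eq0 => /eqP cc.
move/eqP: d0; rewrite mulf_eq0 (negPf nz) orbF subr_eq0 => /eqP dd.
by apply/funext => l; rewrite h h' cc dd.
Qed.

Lemma act_cword u v f : cword m u = cword m v -> act u f = act v f.
Proof.
move=> /cword_congr.
pose gact (w : gword S) := act (map fst w).
suff H a b : gcongr (coxeter_rel m) a b -> forall f, gact a f = gact b f.
  move=> /H/(_ f); rewrite /gact /gpos -!map_comp.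
  by rewrite !(eq_map (_ : _ =1 id)) ?map_id.
elim=> {a b} //.
- by move=> a b c _ e _ e' g; rewrite e.
- by move=> a b c c' _ e g; rewrite /gact !map_cat !act_cat; congr act; apply: e.
- by move=> s b g; rewrite /gact /= reflK.
- move=> a b; rewrite /gact /gpos -!map_comp => ab g.
  rewrite !(eq_map (_ : _ =1 id)) ?map_id //.
  by case: ab => [{}a {}b [i j]|i] /=; rewrite ?reflK ?act_braid.
Qed.

End Geometric.

(** * Descents and the longest element *)

Section Positivity.
Variables (S : choiceType) (m : coxeter_matrix S) (R : rcfType).
Implicit Types (u v w : seq S) (i j : S) (f g : S -> R).
Local Open Scope ring_scope.
Local Notation reduced := (reduced m).
Local Notation cword := (cword m).
Local Notation act := (@act S m R).

Lemma reduced_neq i j w : reduced (i :: j :: w) -> i != j.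
Proof.
move=> r; apply: contraPneq r => -> r.
by have := r w; rewrite cword_iiK => /(_ erefl) /=; lia.
Qed.

(** The inverse of [w] makes the simple root [i] positive. Write [w] as an
    alternating word in [j] and [i], as long as possible, followed by [v]:
    then the inverse of [v] makes both roots [i] and [j] positive by
    induction, and the coefficients of [act_alt] are nonnegative because the
    alternating word has fewer than [m i j] letters. *)
Lemma act_gt0 w i f : (forall j, 0 < f j) -> reduced (i :: w) -> 0 < act w f i.
Proof.
move=> f_gt0; move: {-1}(size w) (leqnn (size w)) => n.
elim: n w i => [|n IHn] [|j w'] i // sz riw.
set w := j :: w' in riw sz *.
have ij : i != j by apply: reduced_neq riw.
have rw : reduced w := @reduced_catr _ _ [:: i] w riw.
pose P k := `[< exists v, cword (alt_word k j i ++ v) = cword w /\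
                          (k + size v = size w)%N >].
have P1 : P 1%N by apply/asboolP; exists w'.
have Pub k : P k -> (k <= size w)%N by move=> /asboolP[v [_ <-]]; apply: leq_addr.
case: (ex_maxnP (ex_intro P 1%N P1) Pub) => k /asboolP[v [vE sv]] kmax.
have k1 : (0 < k)%N := kmax _ P1.
(* otherwise a braid relation brings a second [i] to the front of [i :: w] *)
have km : (k < m i j)%N.
  rewrite ltnNge; apply/negP => mk.
  have m0 := cox_gt0 m i j.
  have sp := alt_split j i mk.
  set rest := if _ then _ else _ in sp.
  have sr : size rest = (k - m i j)%N by rewrite /rest; case: ifP; rewrite size_alt.
  have e : cword (i :: w) = cword (alt_word (m i j).-1 j i ++ rest ++ v).
    rewrite cword_cons -vE sp -catA cword_cat (cox_sym m i j) cword_alt.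
    rewrite (cox_sym m j i) -cword_cat -cword_cons -(prednK m0) alt_cons.
    exact: cword_iiK.
  have := riw _ (esym e); rewrite /= !size_cat size_alt sr; move: sv mk m0 => /=; lia.
have ralt : reduced (alt_word k j i ++ v).
  by apply: reduced_eq rw (esym vE) _; rewrite size_cat size_alt sv.
have rv : reduced v := reduced_catr ralt.
have szv : (size v <= n)%N by move: sz sv k1 => /=; lia.
have ga : 0 < act v f (if odd k then j else i).
  apply: IHn => //; case: k k1 ralt {vE sv kmax km Pub P1} => // k _.
  rewrite alt_rcons oddS -cats1 -catA; case: (odd k) => /= r; exact: reduced_catr r.
(* if this letter could be split off from [v], then [k] would not be maximal *)
have gc : 0 < act v f (if odd k then i else j).
  apply: IHn => //; apply: contrapT => nr.
  have [v' [e1 e2 _]] := not_reduced_cons rv nr.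
  suff : P k.+1 by move=> /kmax; rewrite ltnn.
  apply/asboolP; exists v'; rewrite alt_rcons cat_rcons -vE; split.
    by apply: cword_catl; rewrite e1.
  by rewrite -sv e2 addSnnS.
rewrite -(act_cword f vE) act_cat act_alt //.
have aw := gramP m R ij.
have pk : 0 < cheb (gram m R i j) k by case: aw => aw _ _; apply: aw; rewrite k1.
have pk1 : 0 <= cheb (gram m R i j) k.+1 by apply: cheb_weight_ge0 aw _.
by rewrite ltr_wpDl // ?mulr_ge0 ?mulr_gt0 // ltW.
Qed.

Lemma act_opp w f : act w (fun j => - f j) = (fun j => - act w f j).
Proof.
elim: w => [//|i w IHw]; rewrite !act_cons IHw; apply/funext => j.
by rewrite /refl; ring.
Qed.

Lemma act_lt0 w i f : (forall j, f j < 0) -> reduced (i :: w) -> act w f i < 0.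
Proof.
move=> f_lt0 r; rewrite -oppr_gt0 -[- _]/((fun j => - act w f j) i) -act_opp.
by apply: act_gt0 r => j; rewrite oppr_gt0.
Qed.

Lemma act_descent w i f : (forall j, 0 < f j) -> reduced (i :: w) ->
  act (i :: w) f i < 0.
Proof. by move=> f_gt0 /(act_gt0 f_gt0); rewrite act_cons refl_i oppr_lt0. Qed.

Lemma act_revK w f : act (rev w) (act w f) = f.
Proof.
elim: w f => [//|i w IHw] f.
by rewrite rev_cons -cats1 act_cat !act_cons reflK IHw.
Qed.

End Positivity.

Section Descents.
Variables (S : choiceType) (m : coxeter_matrix S).
Implicit Types (u v w : seq S) (i j : S).
Local Notation reduced := (reduced m).
Local Notation cword := (cword m).
Local Notation act := (@act S m realalg).
Local Notation one := (fun=> 1%R : realalg).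

(** The letters [i] and [j] can be stripped off alternately: the sign that
    decides the next step is that of a nonnegative combination of the signs at
    [i] and [j], both negative. *)
Lemma reduced_braid i j u v : i != j ->
    reduced (i :: u) -> reduced (j :: v) -> cword (i :: u) = cword (j :: v) ->
  exists2 c, cword (alt_word (m i j) i j ++ c) = cword (i :: u) &
             (m i j + size c = (size u).+1)%N.
Proof.
move=> ij ru rv uv.
suff H k : (k <= m i j)%N ->
    exists2 c, cword (alt_word k i j ++ c) = cword (i :: u) &
             (k + size c = (size u).+1)%N by exact: H.
elim: k => [|k IHk] km; first by exists (i :: u).
have [c cE sc] := IHk (ltnW km).
pose d := if odd k then j else i; pose d' := if odd k then i else j.
have rac : reduced (alt_word k i j ++ c).
  by apply: reduced_eq ru (esym cE) _; rewrite size_cat size_alt sc.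
have rc : reduced c := reduced_catr rac.
suff nr : ~ reduced (d :: c).
  have [c' [e1 e2 _]] := not_reduced_cons rc nr.
  exists c'; last by rewrite -sc e2 addSnnS.
  by rewrite alt_rcons cat_rcons -cE; apply: cword_catl; rewrite e1.
move=> r; have := @act_gt0 _ m realalg _ _ one (fun=> ltr01) r.
set h := act (i :: u) one.
have hi : (h i < 0)%R by apply: act_descent ru => ?; apply: ltr01.
have hj : (h j < 0)%R.
  by rewrite /h (act_cword _ uv); apply: act_descent rv => ?; apply: ltr01.
(* [c] represents the element of [i :: u] with the first [k] letters undone *)
have -> : act c one = act (alt_word k d' d) h.
  rewrite /h -(act_cword _ cE) act_cat.
  have -> : alt_word k d' d = rev (alt_word k i j).
    by rewrite rev_alt /d /d'; case: (odd k).
  by rewrite act_revK.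
have dd' : d != d' by rewrite /d /d'; case: (odd k); rewrite // eq_sym.
have mdd' : m d d' = m i j by rewrite /d /d'; case: (odd k); rewrite // cox_sym.
have h_lt0 x : x \in [:: d; d'] -> (h x < 0)%R.
  by rewrite !inE => /orP[]/eqP->; rewrite /d /d'; case: (odd k).
rewrite act_alt //.
have aw := gramP m realalg dd'; have pk := cheb_weight_ge0 aw.
rewrite mdd' in pk.
set x := if _ then _ else _; set y := if _ then _ else _.
have hx : (h x < 0)%R by apply: h_lt0; rewrite /x !inE; case: ifP; rewrite eqxx ?orbT.
have hy : (h y < 0)%R by apply: h_lt0; rewrite /y !inE; case: ifP; rewrite eqxx ?orbT.
apply/negP; rewrite -leNgt.
by rewrite -[leRHS]addr0; apply: lerD; apply: mulr_ge0_le0; rewrite ?pk ?ltW // ltnW.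
Qed.

(** The weak order of the Coxeter group. *)
Definition prefix_of u t := exists2 v, reduced (u ++ v) & cword (u ++ v) = cword t.

Hypothesis m_sph : spherical m.

Lemma longest_exists : exists2 w0, reduced w0 &
  forall w, reduced w -> (size w <= size w0)%N.
Proof.
have /finite_seqP[s sE] := m_sph.
have nf_ex (g : coxeter m) : exists w, reduced w /\ cword w = g.
  by have [w <-] := cword_surj g; have [v rv vE] := reduced_exists m w; exists v.
have [nf nfP] := choice nf_ex.
pose L g := size (nf g).
have sz w : reduced w -> size w = L (cword w).
  by move=> rw; have [r e] := nfP (cword w); apply: reduced_size rw r (esym e).
have [g gmax] : exists g, forall g', (L g' <= L g)%N.
  have s1 : 1%g \in s by have : setT (1 : coxeter m)%g by []; rewrite sE.
  have [g gs gmax] : exists2 g, g \in s & forall g', g' \in s -> (L g' <= L g)%N.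
    elim: s {sE s1} (ex_intro (fun x => x \in s) _ s1) => [[//]|x s IHs _].
    case: (pselect (exists y, y \in s)) => [/IHs[g gs gmax]|no].
      have [le|/ltnW le] := leqP (L x) (L g).
        by exists g => [|g']; rewrite inE ?gs ?orbT // => /orP[/eqP->//|/gmax].
      exists x => [|g']; rewrite inE ?eqxx // => /orP[/eqP->//|/gmax/leq_trans]; exact.
    exists x => [|g']; rewrite inE ?eqxx // => /orP[/eqP->//|g's].
    by case: no; exists g'.
  by exists g => g'; apply: gmax; have : setT g' by []; rewrite sE.
by have [r _] := nfP g; exists (nf g) => // w /sz ->; apply: gmax.
Qed.

(** An element of maximal length makes every simple root negative, hence every
    positive root; so after any reduced prefix of it, any letter that
    lengthens the prefix can still be stripped off. *)
Lemma longest_word : exists2 w0, reduced w0 & forall u, reduced u -> prefix_of u w0.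
Proof.
have [w0 r0 max0] := longest_exists.
exists w0 => //.
have h_lt0 i : (act w0 one i < 0)%R.
  have nr : ~ reduced (i :: w0) by move=> /max0; rewrite /= ltnn.
  have [w1 [e1 e2 r1]] := not_reduced_cons r0 nr.
  rewrite (act_cword _ e1); apply: act_descent; first by move=> ?; apply: ltr01.
  by apply: reduced_eq r0 e1 _; rewrite e2.
elim/last_ind => [|u c IHu] ruc; first by exists w0.
have ru : reduced u by apply: (@reduced_catl _ m _ [:: c]); rewrite cats1.
have [v ruv uvE] := IHu ru.
have rv := reduced_catr ruv.
suff nr : ~ reduced (c :: v).
  have [v' [e1 e2 r']] := not_reduced_cons rv nr.
  have e : cword (u ++ v) = cword (rcons u c ++ v').
    by rewrite cat_rcons; apply: cword_catl; rewrite e1.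
  exists v'; last by rewrite -e.
  by apply: reduced_eq ruv e _; rewrite !size_cat size_rcons e2 addSnnS.
move=> r; have := @act_gt0 _ m realalg _ _ one (fun=> ltr01) r.
have -> : act v one = act (rev u) (act w0 one).
  by rewrite -(act_cword _ uvE) act_cat act_revK.
rewrite lt_gtF //; apply: act_lt0 => //.
by rewrite -rev_rcons; apply: reduced_rev.
Qed.

End Descents.

Section NoAffine.
Variables (S : choiceType) (m : coxeter_matrix S) (R : rcfType).
Hypothesis m_sph : spherical m.
Local Open Scope ring_scope.
Local Notation act := (@act S m R).
Local Notation one := (fun=> 1 : R).

(** The family [l] is a nonnegative combination of simple roots on which the
    bilinear form with every simple root is nonpositive. Along a reduced word
    the value of the moved linear form on it can only grow, as each reflection
    adds a positive multiple of a nonnegative number; but the longest element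
    makes the form negative on all simple roots. This replaces positive
    definiteness in the classification of diagrams. *)
Lemma no_affine (l : seq (S * R)) :
    all (fun x => 0 <= x.2) l -> 0 < \sum_(x <- l) x.2 ->
  ~ forall i, 0 <= \sum_(x <- l) x.2 * gram m R x.1 i.
Proof.
move=> /allP l_ge0 l_gt0 K_ge0.
pose val (f : S -> R) := \sum_(x <- l) x.2 * f x.1.
have [w0 r0 max0] := longest_exists m_sph.
have mono w : reduced m w -> val one <= val (act w one).
  elim: w => [//|i w IHw] r; apply: le_trans (IHw (reduced_catr (u := [:: i]) r)) _.
  rewrite act_cons.
  have -> : val (refl m i (act w one)) = val (act w one) +
      act w one i * \sum_(x <- l) x.2 * gram m R x.1 i.
    rewrite /val mulr_sumr -big_split /=; apply: eq_bigr => x _.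
    by rewrite /refl (gramC m R i); ring.
  by rewrite lerDl mulr_ge0 // ltW // (act_gt0 (fun=> ltr01) r).
have val1 : 0 < val one.
  by rewrite /val (eq_bigr (fun x => x.2)) // => x _; rewrite mulr1.
have h_lt0 i : act w0 one i < 0.
  have nr : ~ reduced m (i :: w0) by move=> /max0; rewrite /= ltnn.
  have [w1 [e1 e2 r1]] := not_reduced_cons r0 nr.
  rewrite (act_cword _ e1); apply: act_descent; first by move=> ?; apply: ltr01.
  by apply: reduced_eq r0 e1 _; rewrite e2.
have : val (act w0 one) <= 0.
  rewrite /val big_seq; apply: sumr_le0 => x xl.
  by rewrite mulr_ge0_le0 ?l_ge0 ?ltW.
by move: (mono _ r0) val1; lra.
Qed.

End NoAffine.

(** * The braid monoid is cancellative *)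

Section Braid.
Variables (S : choiceType) (m : coxeter_matrix S).
Implicit Types (a b c d p q u v w x z : seq S) (i j k : S).
Local Notation reduced := (reduced m).
Local Notation cword := (cword m).
Local Notation prefix_of := (prefix_of m).

(** Equality in the Artin-Tits monoid, as a chain of elementary moves. *)
Inductive braid : seq S -> seq S -> Prop :=
| BraidRefl w : braid w w
| BraidStep p q i j v : braid (p ++ alt_word (m i j) j i ++ q) v ->
    braid (p ++ alt_word (m i j) i j ++ q) v.

Lemma braid_trans v u w : braid u v -> braid v w -> braid u w.
Proof. by elim=> // p q i j {}v _ IH /IH; apply: BraidStep. Qed.

Lemma braid_sym u v : braid u v -> braid v u.
Proof.
elim=> [w|p q i j w _ IH]; first exact: BraidRefl.
apply: (braid_trans IH); rewrite cox_sym; apply: BraidStep; rewrite cox_sym.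
exact: BraidRefl.
Qed.

Lemma braid_catlr p q u v : braid u v -> braid (p ++ u ++ q) (p ++ v ++ q).
Proof.
elim=> [w|p' q' i j w _ IH]; first exact: BraidRefl.
rewrite -!catA [p ++ _]catA; apply: BraidStep.
by rewrite -catA !(catA _ q' q) in IH *; rewrite -!catA in IH *.
Qed.

Lemma braid_catl p u v : braid u v -> braid (p ++ u) (p ++ v).
Proof. by move=> /(braid_catlr p [::]); rewrite !cats0. Qed.

Lemma braid_catr q u v : braid u v -> braid (u ++ q) (v ++ q).
Proof. exact: (braid_catlr [::] q). Qed.

Lemma braid_cons i u v : braid u v -> braid (i :: u) (i :: v).
Proof. exact: (braid_catl [:: i]). Qed.

Lemma braid_alt i j : braid (alt_word (m i j) i j) (alt_word (m i j) j i).
Proof.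
have := @BraidStep [::] [::] i j _ (BraidRefl _).
by rewrite !cats0.
Qed.

Lemma braid_size u v : braid u v -> size u = size v.
Proof. by elim=> // p q i j w _ <-; rewrite !size_cat !size_alt. Qed.

Lemma braid_cword u v : braid u v -> cword u = cword v.
Proof.
elim=> // p q i j w _ <-; apply: cword_catl; apply: cword_catr.
exact: cword_alt.
Qed.

Lemma braid_rev u v : braid u v -> braid (rev u) (rev v).
Proof.
elim=> [w|p q i j w _]; first exact: BraidRefl.
rewrite !rev_cat -!catA => /(braid_trans _); apply.
apply: braid_catlr; rewrite !rev_alt.
case: (odd _); [|rewrite cox_sym]; exact: braid_alt.
Qed.

Lemma reduced_braid_eq u v : braid u v -> reduced u -> reduced v.
Proof.
by move=> uv ru; apply: reduced_eq ru (braid_cword uv) _; rewrite (braid_size uv).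
Qed.

(** The complement of [i] in the braid word of [i] and [j]. *)
Definition compl i j := alt_word (m i j).-1 j i.

Lemma alt_compl i j : alt_word (m i j) i j = i :: compl i j.
Proof. by rewrite -[in LHS](prednK (cox_gt0 m i j)) alt_cons. Qed.

Lemma braid_compl i j : braid (i :: compl i j) (j :: compl j i).
Proof. by rewrite -!alt_compl (cox_sym m j i); apply: braid_alt. Qed.

(** By [reduced_braid] two reduced words with distinct first letters [i] and
    [j] are both equivalent to words that start with the braid word of [i] and
    [j]. *)
Lemma matsumoto u v : reduced u -> reduced v -> cword u = cword v -> braid u v.
Proof.
move: {-1}(size u) (leqnn (size u)) => n.
elim: n u v => [|n IHn] [|i u] v // sz ru rv uv.
- by have := rv _ uv; case: v {rv uv} => // _; apply: BraidRefl.
- by have := rv _ uv; case: v {rv uv} => // _; apply: BraidRefl.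
case: v rv uv => [_ /esym/ru//|j v] rv uv.
have [eij|ij] := eqVneq i j.
  subst j; apply/braid_cons/IHn => //; first exact: (@reduced_catr _ _ [:: i]).
    exact: (@reduced_catr _ _ [:: i]).
  exact: cword_consI uv.
have [c cE sc] := reduced_braid ij ru rv uv.
have suv := reduced_size ru rv uv.
have red_c : reduced (alt_word (m i j) i j ++ c).
  by apply: reduced_eq ru (esym cE) _; rewrite size_cat size_alt sc.
have red_c' : reduced (alt_word (m i j) j i ++ c).
  by apply: (reduced_braid_eq _ red_c); apply: braid_catr; apply: braid_alt.
rewrite alt_compl in red_c cE; rewrite cox_sym alt_compl in red_c'.
have e1 : braid u (compl i j ++ c).
  apply: IHn => //; first exact: (@reduced_catr _ _ [:: i]).
    exact: (@reduced_catr _ _ [:: i]).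
  by apply: (@cword_consI _ _ i).
have e2 : braid v (compl j i ++ c).
  apply: IHn => //; first by move: sz suv => /=; lia.
    exact: (@reduced_catr _ _ [:: j]).
    exact: (@reduced_catr _ _ [:: j]).
  apply: (@cword_consI _ _ j); rewrite -uv -cE.
  by apply: braid_cword; apply: (braid_catr c (braid_compl i j)).
apply: braid_trans (braid_cons i e1) _.
apply: braid_trans (braid_catr c (braid_compl i j)) _.
exact/braid_cons/braid_sym.
Qed.

Lemma prefix_of_eq u t t' : cword t = cword t' -> prefix_of u t -> prefix_of u t'.
Proof. by move=> tt' [v r e]; exists v; rewrite ?e. Qed.

Lemma prefix_of_eql u u' t : reduced u' -> cword u = cword u' ->
  prefix_of u t -> prefix_of u' t.
Proof.
move=> ru' uu' [v r e]; have euv := cword_catr v uu'.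
exists v; last by rewrite -euv.
by apply: reduced_eq r euv _; rewrite !size_cat leq_add2r ru'.
Qed.

Lemma prefix_of_refl u : reduced u -> prefix_of u u.
Proof. by exists [::]; rewrite cats0. Qed.

Lemma prefix_of_nil u : reduced u -> prefix_of [::] u.
Proof. by exists u. Qed.

Lemma prefix_of_trans t u z : prefix_of u t -> prefix_of t z -> prefix_of u z.
Proof.
move=> [v ruv euv] [w rtw etw]; have e := cword_catr w euv.
have rt := reduced_catl rtw.
rewrite -catA in e; exists (v ++ w); last by rewrite e.
apply: reduced_eq rtw (esym e) _; rewrite catA !size_cat leq_add2r -size_cat.
by rewrite (reduced_size ruv rt euv).
Qed.

Lemma prefix_of_cons i u t : reduced (i :: t) ->
  prefix_of (i :: u) (i :: t) <-> prefix_of u t.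
Proof.
move=> rit; split=> -[v ruv e].
  exists v; first exact: (@reduced_catr _ _ [:: i]).
  exact: cword_consI e.
have e' : cword (i :: u ++ v) = cword (i :: t) by apply: (@cword_catl _ _ [:: i]).
exists v => //; have rt : reduced t := @reduced_catr _ _ [:: i] _ rit.
apply: reduced_eq rit (esym e') _ => /=.
by rewrite (reduced_size ruv rt e).
Qed.

Definition lub u w z := [/\ reduced z, prefix_of u z, prefix_of w z &
  forall t, prefix_of u t -> prefix_of w t -> prefix_of z t].

Hypothesis m_sph : spherical m.

(** The longest word bounds [i :: u] and [i :: w], so [z] is a prefix of what
    follows [i] in it, and [i :: z] is reduced. Here the finiteness of the
    Coxeter group enters. *)
Lemma lub_cons i u w z : reduced (i :: u) -> reduced (i :: w) ->
  lub u w z -> lub (i :: u) (i :: w) (i :: z).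
Proof.
move=> ru rw [rz uz wz zmin].
have H t : prefix_of (i :: u) t -> prefix_of (i :: w) t -> exists t',
    [/\ cword (i :: t') = cword t, reduced (i :: t') & prefix_of z t'].
  move=> [v r e] wt; exists (u ++ v); split=> //; apply: zmin.
    by exists v => //; apply: (@reduced_catr _ _ [:: i]).
  by apply/(@prefix_of_cons i) => //; apply: prefix_of_eq wt.
have riz : reduced (i :: z).
  have [w0 r0 max0] := longest_word m_sph.
  have [t [_ rit zt]] := H w0 (max0 _ ru) (max0 _ rw).
  by have [v r _] := (prefix_of_cons z rit).2 zt; apply: (@reduced_catl _ _ _ v).
split=> //; try exact/prefix_of_cons.
move=> t ut wt; have [t' [e rit zt]] := H t ut wt.
by apply: prefix_of_eq e _; apply/prefix_of_cons.
Qed.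

Lemma reduced_compl i j : i != j -> reduced (i :: compl i j).
Proof.
move=> ij; have [w0 r0 max0] := longest_word m_sph.
have r1 k : reduced [:: k].
  by case=> // /cword_odd.
have [v rv ev] := max0 _ (r1 i); have [v' rv' ev'] := max0 _ (r1 j).
have [|c cE sc] := reduced_braid ij rv rv'; first by rewrite /= ev ev'.
rewrite -alt_compl; apply: (@reduced_catl _ _ _ c).
by apply: reduced_eq rv (esym cE) _; rewrite size_cat size_alt sc.
Qed.

(** Garside's reduction property for a pair of equal products with first
    letters [i] and [j]. *)
Definition same_head i a j b := if i == j then braid a b else
  exists c, braid a (compl i j ++ c) /\ braid b (compl j i ++ c).

Definition head_upto n := forall i a j b,
  (size a < n)%N -> braid (i :: a) (j :: b) -> same_head i a j b.

Lemma cancel_upto n p a b : head_upto n ->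
  (size (p ++ a) <= n)%N -> braid (p ++ a) (p ++ b) -> braid a b.
Proof.
move=> Hn; elim: p => [//|i p IHp] /= sz /(Hn _ _ _ _ sz).
by rewrite /same_head eqxx; apply: IHp; apply: ltnW.
Qed.

(** Common multiples of two reduced words are multiples of their join in the
    weak order. *)
Definition joins_upto n := forall x u w c d, (size x <= n)%N ->
  reduced u -> reduced w -> braid x (u ++ c) -> braid x (w ++ d) ->
  exists z e, braid x (z ++ e) /\ lub u w z.

Lemma joins_head n i x u w c d : head_upto n.+1 -> joins_upto n ->
  (size x <= n.+1)%N -> reduced (i :: u) -> reduced (i :: w) ->
  braid x (i :: u ++ c) -> braid x (i :: w ++ d) ->
  exists z e, braid x (i :: z ++ e) /\ lub (i :: u) (i :: w) (i :: z).
Proof.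
move=> Hn Jn sx ru rw xu xw.
have := braid_size xu => /= sxu.
have /Hn : braid (i :: u ++ c) (i :: w ++ d) by apply: braid_trans (braid_sym xu) xw.
rewrite /same_head eqxx -sxu => /(_ sx) uw.
have [|||z [e [ze zl]]] := Jn (u ++ c) u w c d _ _ _ (BraidRefl _) uw.
- by move: sxu sx; lia.
- exact: (@reduced_catr _ _ [:: i]).
- exact: (@reduced_catr _ _ [:: i]).
exists z, e; split; last exact: lub_cons.
by apply: braid_trans xu _; apply: braid_cons.
Qed.

(** The join of [i :: u] with the braid word of [i] and [j] is taken below the
    letter [i]; it is also a multiple of [j], so its join with [j :: w] can be
    taken below the letter [j]. *)
Lemma joins_uptoP n : head_upto n -> joins_upto n.
Proof.
have lub0 u : reduced u -> lub [::] u u.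
  move=> ru; split=> //; [exact: prefix_of_nil | exact: prefix_of_refl].
have lubC u w z : lub u w z -> lub w u z.
  by move=> [rz uz wz zmin]; split=> // t wt ut; apply: zmin.
elim: n => [|n IHn] Hn x [|i u] w c d sx ru rw xu xw.
- by exists w, d; split=> //; apply: lub0.
- by have := braid_size xu; rewrite /= => e; move: sx; rewrite e.
- by exists w, d; split=> //; apply: lub0.
have Jn : joins_upto n by apply: IHn => ? ? ? ? /ltnW; apply: Hn.
case: w rw xw => [_ _|j w rw xw].
  by exists (i :: u), c; split=> //; apply/lubC/lub0.
have [eij|ij] := eqVneq i j.
  subst j; have [z [e [xz zl]]] := joins_head Hn Jn sx ru rw xu xw.
  by exists (i :: z), e.
have := braid_size xu => /= sxu.
have /Hn : braid (i :: u ++ c) (j :: w ++ d).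
  by apply: braid_trans (braid_sym xu) xw.
rewrite -sxu /same_head (negPf ij) => /(_ sx) [c2 [uc2 wc2]].
have xc2 : braid x (i :: compl i j ++ c2).
  by apply: braid_trans xu _; apply: braid_cons.
have [z1 [e1 [xz1 [rz1 uz1 cz1 min1]]]] :=
  joins_head Hn Jn sx ru (reduced_compl ij) xu xc2.
have ji : j != i by rewrite eq_sym.
have cz1' : prefix_of (j :: compl j i) (i :: z1).
  apply: prefix_of_eql (reduced_compl ji) _ cz1.
  by apply: braid_cword; apply: braid_compl.
have [v rv ev] := cz1'.
have z1v : braid (i :: z1) (j :: compl j i ++ v) by apply: matsumoto.
have xv : braid x (j :: (compl j i ++ v) ++ e1).
  by apply: braid_trans xz1 _; apply: (braid_catr e1 z1v).
have [z [e [xz [rz vz wz minz]]]] := joins_head Hn Jn sx rv rw xv xw.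
exists (j :: z), e; split=> //; split=> //.
  apply: prefix_of_trans uz1 _; apply: prefix_of_eql vz => //.
move=> t ut wt; apply: minz => //.
have tij : prefix_of (i :: compl i j) t.
  have [v1 rv1 ev1] := ut; have [v2 rv2 ev2] := wt.
  have [|c3 c3E sc3] := reduced_braid ij rv1 rv2; first by rewrite /= ev1 ev2.
  exists c3; rewrite -alt_compl; last by rewrite c3E.
  by apply: reduced_eq rv1 (esym c3E) _; rewrite size_cat size_alt sc3.
by apply: prefix_of_eql (min1 _ ut tij).
Qed.

(** When [i], [k] and [j] are distinct, [v] is a multiple of the complements
    of [k] for [i] and for [j], hence of their join [z]. The element of [k ::
    z] has descents [i] and [j], so it starts with their braid word, and
    Matsumoto's theorem rewrites [a] and [b] accordingly. *)
Lemma same_head_trans i a k v j b :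
  head_upto (size a) -> braid (i :: a) (k :: v) -> braid (k :: v) (j :: b) ->
  same_head i a k v -> same_head k v j b -> same_head i a j b.
Proof.
move=> Hn iakv kvjb; have sav := braid_size iakv; case: sav => sav.
rewrite /same_head.
have [eik|ik] := eqVneq i k.
  subst k => av; have [eij|ij] := eqVneq i j; first exact: braid_trans av.
  by move=> [c [vc bc]]; exists c; split=> //; apply: braid_trans av vc.
move=> [c [ac vc]].
have [ekj|kj] := eqVneq k j.
  subst j => vb; rewrite (negPf ik); exists c; split=> //.
  exact: braid_trans (braid_sym vb) vc.
move=> [d [vd bd]].
have [eij|ij] := eqVneq i j.
  subst j; apply: braid_trans ac _; apply: braid_trans (braid_sym bd).
  apply: braid_catl; apply: (cancel_upto (p := compl k i) Hn).
    by rewrite -(braid_size vc) sav.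
  exact: braid_trans (braid_sym vc) vd.
have ki : k != i by rewrite eq_sym.
have ji : j != i by rewrite eq_sym.
have jk : j != k by rewrite eq_sym.
have rk := reduced_compl ki; have rk' := reduced_compl kj.
have [|||z [e [ve zl]]] := joins_uptoP Hn _ _ _ vc vd.
- by rewrite sav.
- exact: (@reduced_catr _ _ [:: k]).
- exact: (@reduced_catr _ _ [:: k]).
have [rkz ikz jkz _] := lub_cons rk rk' zl.
have [s rs es] := ikz; have [t rt et] := jkz.
have cs : braid c (s ++ e).
  apply: (cancel_upto (p := compl k i) Hn).
    by rewrite -(braid_size vc) sav.
  apply: braid_trans (braid_sym vc) _; apply: braid_trans ve _.
  rewrite catA; apply: braid_catr; apply: matsumoto.
  - by case: zl.
  - exact: (@reduced_catr _ _ [:: k]).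
  - by apply: (@cword_consI _ _ k); rewrite -es.
have dt : braid d (t ++ e).
  apply: (cancel_upto (p := compl k j) Hn).
    by rewrite -(braid_size vd) sav.
  apply: braid_trans (braid_sym vd) _; apply: braid_trans ve _.
  rewrite catA; apply: braid_catr; apply: matsumoto.
  - by case: zl.
  - exact: (@reduced_catr _ _ [:: k]).
  - by apply: (@cword_consI _ _ k); rewrite -et.
have bs := braid_catr s (braid_compl k i); have bt := braid_catr t (braid_compl k j).
have ris := reduced_braid_eq bs rs; have rjt := reduced_braid_eq bt rt.
have eij : cword (i :: compl i k ++ s) = cword (j :: compl j k ++ t).
  by rewrite -(braid_cword bs) -(braid_cword bt) es et.
have [c4 e4 s4] := reduced_braid ij ris rjt eij.
have r4 : reduced (i :: compl i j ++ c4).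
  by rewrite -cat_cons -alt_compl; apply: reduced_eq ris (esym e4) _; rewrite size_cat size_alt s4.
have b4 := braid_catr c4 (braid_compl i j); have r4' := reduced_braid_eq b4 r4.
rewrite alt_compl in e4.
exists (c4 ++ e); rewrite !catA; split.
  apply: braid_trans ac _; apply: braid_trans (braid_catl _ cs) _.
  rewrite catA; apply: braid_catr; apply: matsumoto.
  - exact: (@reduced_catr _ _ [:: i]).
  - exact: (@reduced_catr _ _ [:: i]).
  - by apply: (@cword_consI _ _ i); rewrite -e4.
apply: braid_trans bd _; apply: braid_trans (braid_catl _ dt) _.
rewrite catA; apply: braid_catr; apply: matsumoto.
- exact: (@reduced_catr _ _ [:: j]).
- exact: (@reduced_catr _ _ [:: j]).
- by apply: (@cword_consI _ _ j); rewrite -eij -e4 (braid_cword b4).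
Qed.

(** The property is plain for an elementary move, and [same_head_trans]
    composes it along a chain. *)
Lemma head_uptoP n : head_upto n.
Proof.
elim: n => [//|n IHn] i a j b; rewrite ltnS leq_eqVlt => /orP[/eqP sa|/IHn]; last exact.
move: {-1}(i :: a) (erefl (i :: a)) {-1}(j :: b) (erefl (j :: b)) => u uE v vE uv.
elim: uv i a sa uE j b vE => {u v} [w|p q k l v kv IH] i a sa uE j b vE.
  by move: uE; rewrite -vE => -[-> ->]; rewrite /same_head eqxx; apply: BraidRefl.
have skv := braid_size kv.
set u' := p ++ alt_word (m k l) l k ++ q in kv IH skv.
have su : size u' = (size a).+1.
  by rewrite -[RHS]/(size (i :: a)) uE !size_cat !size_alt.
have ub : braid (i :: a) u' by rewrite uE; apply: BraidStep; apply: BraidRefl.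
case uE' : u' su => [//|i' a'] [sa'].
rewrite uE' in ub kv; rewrite -vE in kv.
apply: (same_head_trans _ ub kv); first by rewrite sa.
  case: p @u' uE uE' {IH skv} => [|h p] u'; last first.
    rewrite /u' !cat_cons => -[-> ->] [<- <-]; rewrite /same_head eqxx.
    by apply: BraidStep; apply: BraidRefl.
  rewrite /u' !cat0s alt_compl cox_sym alt_compl !cat_cons => -[-> ->] [<- <-].
  have [->|kl] := eqVneq k l; rewrite /same_head ?eqxx; first exact: BraidRefl.
  by rewrite (negPf kl); exists q; split; apply: BraidRefl.
by apply: IH => //; rewrite sa'.
Qed.

Lemma braid_catI p a b : braid (p ++ a) (p ++ b) -> braid a b.
Proof. by apply: (@cancel_upto (size (p ++ a))) => //; apply: head_uptoP. Qed.

Lemma braid_catIr q a b : braid (a ++ q) (b ++ q) -> braid a b.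
Proof.
move=> /braid_rev; rewrite !rev_cat => /braid_catI/braid_rev.
by rewrite !revK.
Qed.

End Braid.

(** * The braid monoid embeds in the Artin-Tits group *)

Section Embedding.
Variables (S : choiceType) (m : coxeter_matrix S).
Hypothesis m_sph : spherical m.
Implicit Types (u v w : seq S) (s i j : S).
Local Notation reduced := (reduced m).
Local Notation cword := (cword m).
Local Notation braid := (braid m).

(** Otherwise the braid word of [i] and [j] would not be reduced. *)
Lemma cword_gen_inj i j : cword [:: i] = cword [:: j] -> i = j.
Proof.
move=> e; apply/eqP; case: (eqVneq i j) => // ij.
have := reduced_compl m_sph ij; rewrite /compl.
case: (m i j) (cox_ge2 m ij) => [//|[//|n _]] /=; rewrite alt_cons.
set r := alt_word _ _ _ => red.
have e' : cword [:: i, j & r] = cword r.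
  by rewrite -(cword_iiK m j r) -![[:: _, _ & r]]/([:: _] ++ j :: r) !cword_cat e.
by have := red _ (esym e') => /=; lia.
Qed.

(** Moving [s] across the longest word [w0] turns it into some [s'], and
    moving it across [w0 ++ w0] gives back [s] because [w0] is an involution
    in the Coxeter group. *)
Lemma braid_central : exists z : seq S,
  (forall s, braid (s :: z) (rcons z s)) /\ forall s, exists c, braid (s :: c) z.
Proof.
have [w0 r0 max0] := longest_word m_sph.
have r1 s : reduced [:: s] by case=> // /cword_odd.
have bar s : exists sb, reduced (s :: sb) /\ braid (s :: sb) w0.
  have [sb rb e] := max0 _ (r1 s); exists sb; split=> //.
  exact: matsumoto.
have twist s : exists s', braid (s :: w0) (rcons w0 s').
  have [sb [rb bb]] := bar s.
  have rb' : reduced sb := @reduced_catr _ _ [:: s] _ rb.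
  have [v rv ev] := max0 _ rb'.
  have bv : braid (sb ++ v) w0 by apply: matsumoto.
  have := braid_size bv; rewrite -(braid_size bb) size_cat /= => sz.
  case: v rv ev bv sz => [|s' [|s'' v]] rv ev bv; rewrite /= ?cats0; try lia.
  move=> _; exists s'; apply: braid_trans (braid_cons s (braid_sym bv)) _.
  by rewrite -cats1; apply: (braid_catr [:: s'] bb).
have w0K : cword (w0 ++ w0) = 1%g.
  have [v rv ev] := max0 _ (reduced_rev r0).
  have := reduced_size rv r0 ev; rewrite size_cat size_rev => sz.
  have v0 : v = [::] by apply: size0nil; lia.
  by rewrite cword_cat -{1}ev v0 cats0 cword_rev mulVg.
exists (w0 ++ w0); split=> s; last first.
  have [sb [rb bb]] := bar s; exists (sb ++ w0); exact: (braid_catr w0 bb).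
have [s' b1] := twist s; have [s'' b2] := twist s'.
have b3 : braid (s :: w0 ++ w0) (rcons (w0 ++ w0) s'').
  apply: braid_trans (braid_catr w0 b1) _; rewrite cat_rcons rcons_cat.
  exact: braid_catl.
suff e : s = s'' by rewrite -e in b3.
apply: cword_gen_inj; have := braid_cword b3.
by rewrite -cats1 cword_cons !(cword_cat m (w0 ++ w0)) w0K mulg1 mul1g.
Qed.

(** Replacing each inverse of [s] by the complement of [s] in the central word
    [z] turns a group word into a positive word over a power of [z]. By
    cancellation the equality of such fractions is a congruence, and it
    contains the defining relations of the group. *)
Lemma artin_embedding u v :
  gclass (artin_rel m) (gpos u) = gclass (artin_rel m) (gpos v) -> braid u v.
Proof.
have [z [zC zdiv]] := braid_central.
have [c cP] := choice zdiv.
have zCw w : braid (w ++ z) (z ++ w).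
  elim: w => [|s w IHw]; first by rewrite cats0; apply: BraidRefl.
  apply: braid_trans (braid_cons s IHw) _.
  by rewrite -cat_rcons; apply: (braid_catr w (zC s)).
have cP' s : braid (rcons (c s) s) z.
  apply: (braid_catI m_sph (p := [:: s])); rewrite /= -rcons_cons.
  apply: braid_trans (braid_sym (zC s)).
  by rewrite -!cats1; apply: braid_catr.
pose zp n := flatten (nseq n z).
have zpD a b : zp (a + b) = zp a ++ zp b by rewrite /zp nseqD flatten_cat.
have zpC n w : braid (w ++ zp n) (zp n ++ w).
  elim: n => [|n IHn]; first by rewrite cats0; apply: BraidRefl.
  rewrite -[zp n.+1]/(z ++ zp n) [w ++ _]catA.
  apply: braid_trans (braid_catr _ (zCw w)) _.
  by rewrite -!catA; apply: braid_catl.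
pose num (a : gword S) := flatten [seq if x.2 then c x.1 else [:: x.1] | x <- a].
pose den (a : gword S) := count (fun x => x.2) a.
have numD a b : num (a ++ b) = num a ++ num b by rewrite /num map_cat flatten_cat.
have denD a b : den (a ++ b) = (den a + den b)%N by rewrite /den count_cat.
have num_pos w : num (gpos w) = w.
  by elim: w => [//|s w IHw]; rewrite -[LHS]/(s :: num (gpos w)) IHw.
suff H a b : gcongr (artin_rel m) a b ->
    braid (num a ++ zp (den b)) (num b ++ zp (den a)).
  by move=> /gclassP/H; rewrite /den !count_gposV !cats0 !num_pos.
elim=> {a b}.
- by move=> a; apply: BraidRefl.
- by move=> a b _; apply: braid_sym.
- move=> a b d _ ab _ bd; apply: (braid_catIr m_sph (q := zp (den b))).
  rewrite -!catA -!zpD (addnC (den d)) (addnC (den a)) !zpD.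
  apply: braid_trans (_ : braid _ ((num b ++ zp (den a)) ++ zp (den d))) _.
    by rewrite catA; apply: braid_catr.
  rewrite -catA -zpD addnC zpD catA; apply: braid_trans (braid_catr _ bd) _.
  by rewrite -!catA -!zpD addnC; apply: BraidRefl.
- move=> a b d d' _ IH; rewrite !numD !denD -!catA; apply: braid_catl.
  have swap e n : braid (e ++ num b ++ zp (den a + (n + den b)))
      ((e ++ zp n) ++ num b ++ zp (den a + den b)).
    rewrite addnCA zpD -catA; apply: braid_catl; rewrite !catA.
    by apply: braid_catr; apply: zpC.
  apply: braid_trans (swap _ _) _; apply: braid_trans (braid_sym (swap _ _)).
  exact: braid_catr.
- move=> s []; rewrite /num /den /zp /= !cats0.
    by rewrite cats1; apply: cP'.
  exact: cP.
- move=> _ _ [i j]; rewrite /den !count_gposV !cats0 !num_pos; apply: braid_alt.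
Qed.

End Embedding.

(** * Order automorphisms are diagram automorphisms *)

Section BraidClasses.
Variables (S : choiceType) (m : coxeter_matrix S).
Implicit Types (p q u v w : seq S) (a b i j : S).
Local Notation braid := (braid m).

Lemma nth_alt x0 n i j t : t < n ->
  nth x0 (alt_word n i j) t = if odd t then j else i.
Proof. exact: nth_mkseq. Qed.

(** Two consecutive letters determine the pair [i, j], and then the length
    leaves no room around the factor. *)
Lemma alt_factor p q a b n i j : n <= m i j -> a != b ->
  p ++ alt_word (m a b) a b ++ q = alt_word n i j ->
  [/\ p = [::], q = [::], n = m i j, a = i & b = j].
Proof.
move=> nm ab e; have m2 := cox_ge2 m ab.
have := congr1 size e; rewrite !size_cat !size_alt => sz.
have at_ t : t < m a b -> (if odd t then b else a) =
    if odd (size p + t) then j else i.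
  move=> tm; rewrite -(nth_alt i a b tm) -(nth_alt i (n := n)); last by lia.
  rewrite -e nth_cat ltnNge leq_addr /= addKn nth_cat size_alt tm //.
have := at_ 0 (ltnW m2); have := at_ 1 m2; rewrite addn0 addn1 /= => eb ea.
have mab : m a b = m i j by rewrite ea eb; case: (odd _); rewrite //= cox_sym.
have p0 : size p = 0 by lia.
have q0 : size q = 0 by lia.
by move: ea eb; rewrite p0 /=; split=> //; [exact: size0nil|exact: size0nil|lia].
Qed.

Lemma braid_alt_short n i j w : n < m i j ->
  braid (alt_word n i j) w -> w = alt_word n i j.
Proof.
move=> nm; suff H u : braid u w -> u = alt_word n i j -> w = alt_word n i j.
  by move=> /H; apply.
elim=> {u w} // p q a b w _ IH e.
have [ab|ab] := eqVneq a b; first by apply: IH; rewrite -e ab.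
by have [_ _ nE] := alt_factor (ltnW nm) ab e; rewrite nE ltnn in nm.
Qed.

(** This is how the order of the group sees a braid relation: an interval with
    exactly two maximal chains. *)
Lemma braid_alt_class i j w : braid (alt_word (m i j) i j) w ->
  w = alt_word (m i j) i j \/ w = alt_word (m i j) j i.
Proof.
suff H u : braid u w -> u = alt_word (m i j) i j \/ u = alt_word (m i j) j i ->
    w = alt_word (m i j) i j \/ w = alt_word (m i j) j i.
  by move=> /H; apply; left.
elim=> {u w} // p q a b w _ IH e; apply: IH.
have [ab|ab] := eqVneq a b; first by rewrite -ab in e *.
case: e => e.
  have [-> -> _ -> ->] := alt_factor (leqnn _) ab e.
  by right; rewrite cat0s cats0.
rewrite (cox_sym m i j) in e *.
have [-> -> _ -> ->] := alt_factor (leqnn _) ab e.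
by left; rewrite cat0s cats0.
Qed.

Lemma braid_first_step u v : braid u v -> u <> v ->
  exists p q a b, [/\ u = p ++ alt_word (m a b) a b ++ q,
    braid u (p ++ alt_word (m a b) b a ++ q) & u <> p ++ alt_word (m a b) b a ++ q].
Proof.
elim=> {u v} // p q a b w bw IH ne.
case: (pselect (p ++ alt_word (m a b) a b ++ q = p ++ alt_word (m a b) b a ++ q)).
  by move=> e; rewrite e in ne *; apply: IH.
by move=> ne'; exists p, q, a, b; split=> //; apply: BraidStep; apply: BraidRefl.
Qed.

End BraidClasses.

Section ArtinElements.
Variables (S : choiceType) (m : coxeter_matrix S).
Implicit Types (g h : artin m) (u v w : seq S) (i j : S).
Local Open Scope group_scope.

Definition aword w : artin m := \prod_(i <- w) sigma m i.

Lemma aword_cat u v : aword (u ++ v) = aword u * aword v.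
Proof. exact: big_cat. Qed.

Lemma aword_cons i w : aword (i :: w) = sigma m i * aword w.
Proof. exact: big_cons. Qed.

Lemma aword1 i : aword [:: i] = sigma m i. Proof. exact: big_seq1. Qed.

Lemma aword_nil : aword [::] = 1. Proof. exact: big_nil. Qed.

Lemma aword_braid u v : braid m u v -> aword u = aword v.
Proof.
elim=> // p q i j w _ <-; rewrite !aword_cat; congr (_ * (_ * _)).
exact: (gprod_rel (ArtinBraid m i j)).
Qed.

Lemma le_aword g h : (g <= h)%O <-> exists w, h = g * aword w.
Proof.
rewrite artin_leE; split=> -[w e]; exists w.
  by rewrite -[aword w]e mulgA mulgV mul1g.
by rewrite e mulgA mulVg mul1g.
Qed.

Lemma artin_ind (P : artin m -> Prop) : P 1 ->
    (forall g i, P g -> P (g * sigma m i)) ->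
    (forall g i, P g -> P (g * (sigma m i)^-1)) ->
  forall g, P g.
Proof.
move=> P1 PM PV g; rewrite -(greprK g).
elim/last_ind: (grepr g) => [//|w [i b] IHw].
have -> : gclass (artin_rel m) (rcons w (i, b)) =
    (gclass (artin_rel m) w : artin m) * gclass (artin_rel m) [:: (i, b)].
  by rewrite -cats1 -[RHS]/(gmul _ _) gmul_class.
case: b; last exact: PM.
have -> : gclass (artin_rel m) [:: (i, true)] = (sigma m i)^-1.
  by rewrite -[RHS]/(ginvg _) ginvg_class.
exact: PV.
Qed.

Hypothesis m_sph : spherical m.

Lemma aword_inj u v : aword u = aword v -> braid m u v.
Proof. by move=> e; apply: artin_embedding => //; rewrite !gclass_pos. Qed.

Lemma aword_size u v : aword u = aword v -> size u = size v.
Proof. by move=> /aword_inj; apply: braid_size. Qed.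

Lemma sigma_inj i j : sigma m i = sigma m j -> i = j.
Proof.
rewrite -!aword1 => /aword_inj/braid_cword; exact: cword_gen_inj.
Qed.

End ArtinElements.

Section OrderAutomorphisms.
Variables (S : choiceType) (m : coxeter_matrix S).
Hypothesis m_sph : spherical m.
Implicit Types (g h : artin m) (u v w : seq S) (i j : S).
Local Open Scope group_scope.

(** The covers of [g] are the products [g * sigma m i], because the length of
    positive words is additive. *)
Lemma cover_image (phi psi : artin m -> artin m) :
    cancel psi phi -> {mono phi : g h / (g <= h)%O} ->
  forall g i, exists j, phi (g * sigma m i) = phi g * sigma m j.
Proof.
move=> psiK phi_mono g i.
have : (phi g <= phi (g * sigma m i))%O.
  by rewrite phi_mono; apply/le_aword; exists [:: i]; rewrite aword1.
move=> /le_aword[[|j w] e].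
  have e' : phi (g * sigma m i) = phi g by rewrite e aword_nil mulg1.
  have : (g * sigma m i <= g)%O by rewrite -phi_mono e' lexx.
  move=> /le_aword[w e2]; have : aword m (i :: w) = aword m [::].
    by apply: (mulgI g); rewrite aword_cons mulgA -e2 aword_nil mulg1.
  by move=> /aword_size-/(_ m_sph).
exists j; set h := phi g * sigma m j.
have gh : (g <= psi h)%O.
  by rewrite -phi_mono psiK; apply/le_aword; exists [:: j]; rewrite aword1.
have hgi : (psi h <= g * sigma m i)%O.
  rewrite -phi_mono psiK e; apply/le_aword; exists w.
  by rewrite aword_cons mulgA.
have [u uE] := (le_aword _ _).1 gh; have [v vE] := (le_aword _ _).1 hgi.
have : aword m [:: i] = aword m (u ++ v).
  by apply: (mulgI g); rewrite aword1 vE uE -mulgA -aword_cat.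
move=> /aword_size-/(_ m_sph); rewrite size_cat.
case: u uE => [|s u] uE.
  have : aword m [:: j] = aword m [::].
    by apply: (mulgI (phi g)); rewrite aword1 -/h -(psiK h) uE !aword_nil !mulg1.
  by move=> /aword_size-/(_ m_sph).
case: v vE => [|s' v] vE; last by rewrite /=; lia.
by move=> _; rewrite vE aword_nil mulg1 psiK.
Qed.

Variables (phi psi : artin m -> artin m).
Hypotheses (phiK : cancel phi psi) (psiK : cancel psi phi).
Hypothesis phi_mono : {mono phi : g h / (g <= h)%O}.

Variable p : artin m -> S -> S.
Hypothesis pP : forall g i, phi (g * sigma m i) = phi g * sigma m (p g i).

Let p_inj g : injective (p g).
Proof.
move=> i j e; apply: (sigma_inj m_sph); apply: (mulgI g).
by apply: (can_inj phiK); rewrite !pP e.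
Qed.

Let p_surj g j : exists i, p g i = j.
Proof.
have psi_mono : {mono psi : g h / (g <= h)%O}.
  by move=> x y; rewrite -phi_mono !psiK.
have [i e] := cover_image phiK psi_mono (phi g) j.
exists i; apply: (sigma_inj m_sph); apply: (mulgI (phi g)).
by rewrite -pP -[g in LHS]phiK -e psiK.
Qed.

(** The labels of the image under [phi] of the chain that starts at [g] and
    has labels [w]. *)
Fixpoint transport g w : seq S :=
  if w is i :: w' then p g i :: transport (g * sigma m i) w' else [::].

Let transportP g w : phi (g * aword m w) = phi g * aword m (transport g w).
Proof.
elim: w g => [|i w IHw] g /=; first by rewrite !aword_nil !mulg1.
by rewrite !aword_cons mulgA IHw pP mulgA.
Qed.

Let transport_rcons g w i :
  exists j, transport g (rcons w i) = rcons (transport g w) j.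
Proof.
elim: w g => [|k w IHw] g /=; first by exists (p g i).
by have [j ->] := IHw (g * sigma m k); exists j.
Qed.

Let size_transport g w : size (transport g w) = size w.
Proof. by elim: w g => [//|i w IHw] g /=; rewrite IHw. Qed.

Let transport_surj g v : exists w, transport g w = v.
Proof.
elim: v g => [|j v IHv] g; first by exists [::].
have [i <-] := p_surj g j; have [w <-] := IHv (g * sigma m i).
by exists (i :: w).
Qed.

Let transport_braid g u v : braid m u v <-> braid m (transport g u) (transport g v).
Proof.
split=> [/aword_braid e|/aword_braid e]; apply: (aword_inj m_sph).
  by apply: (mulgI (phi g)); rewrite -!transportP e.
by apply: (mulgI g); apply: (can_inj phiK); rewrite !transportP e.
Qed.

(** The images of the two words of the braid relation form a whole braid
    class, so they differ by one elementary move. It starts at the first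
    letter, where they differ; and it ends at the last one, since otherwise
    their proper prefixes, images of shorter alternating words, would give
    equivalent words too. *)
Let local_step g i j : i != j ->
  m (p g i) (p g j) = m i j /\ p (g * sigma m i) j = p g j.
Proof.
move=> ij; have m2 := cox_ge2 m ij.
set U := transport g (alt_word (m i j) i j).
set V := transport g (alt_word (m i j) j i).
have bUV : braid m U V by apply: (transport_braid g _ _).1; apply: braid_alt.
have pij : p g i <> p g j by move=> /p_inj/eqP; rewrite (negPf ij).
have UE : exists n, m i j = n.+2 /\ 
    U = [:: p g i, p (g * sigma m i) j & transport (g * sigma m i * sigma m j) (alt_word n i j)].
  rewrite /U; case: (m i j) m2 => [|[|n]] // _; exists n; split=> //.
  by rewrite !alt_cons.
have VE : exists V', V = p g j :: V'.
  rewrite /V; case: (m i j) m2 => [|[|n]] // _; rewrite !alt_cons /=.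
  by eexists.
have [n [mn {}UE]] := UE; have [V' {}VE] := VE.
have UV : U <> V by rewrite UE VE => -[].
have [x [q [a [b [e1 e2 e3]]]]] := braid_first_step bUV UV.
have e4 : V = x ++ alt_word (m a b) b a ++ q.
  have [w wE] := transport_surj g (x ++ alt_word (m a b) b a ++ q).
  rewrite -wE in e2 e3 *; have /braid_alt_class := (transport_braid g _ _).2 e2.
  by case=> ww; rewrite ww // in e3 *.
have ab : a != b by apply/eqP => ab; apply: e3; rewrite e1 ab.
have x0 : x = [::].
  case: x e1 e4 {e2 e3} => [//|y x]; rewrite UE VE !cat_cons => -[y1 _] [y2 _].
  by case: pij; rewrite y1 y2.
subst x; rewrite !cat0s in e1 e2 e3 e4.
have m2' := cox_ge2 m ab.
have [aE bE] : a = p g i /\ b = p g j.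
  move: e1 e4; rewrite UE VE; case: (m a b) m2' => [|k] // _.
  by rewrite !alt_cons !cat_cons => -[-> _] [->].
have q0 : q = [::].
  case/lastP: q e1 e2 e3 e4 => [//|q c] e1 _ _ e4.
  have [k mk] : exists k, m i j = k.+1 by exists n.+1.
  have [c1] := transport_rcons g (alt_word k i j) (if odd k then j else i).
  have [c2] := transport_rcons g (alt_word k j i) (if odd k then i else j).
  rewrite -!alt_rcons -mk -/U -/V e1 e4 -!rcons_cat => /rcons_inj[e5 _] /rcons_inj[e6 _].
  have : braid m (alt_word k i j) (alt_word k j i).
    apply: (transport_braid g _ _).2; rewrite -e5 -e6.
    by apply: braid_catr; apply: braid_alt.
  move=> /(@braid_alt_short _ m); rewrite mk ltnSn => /(_ isT).
  have -> : k = k.-1.+1 by move: mk; rewrite mn => -[<-].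
  by rewrite !alt_cons => -[/esym/eqP]; rewrite (negPf ij).
have sz : m i j = m a b.
  by have := congr1 size e1; rewrite q0 cats0 size_alt /U size_transport size_alt.
split; first by rewrite -aE -bE sz.
move: e1; rewrite UE q0 cats0 -sz mn !alt_cons => -[_ -> _].
by rewrite bE.
Qed.

Let p_step g i : p (g * sigma m i) = p g.
Proof.
apply/funext => j; have [<-{j}|ij] := eqVneq i j; last by case: (local_step g ij).
have [k kE] := p_surj g (p (g * sigma m i) i).
have [ki|ik] := eqVneq i k; first by rewrite -kE -ki.
by move: kE; have [_ <-] := local_step g ik => /p_inj e; rewrite e eqxx in ik.
Qed.

Let p_const g : p g = p 1.
Proof.
elim/artin_ind: g => [//|g i <-|g i <-]; first exact: p_step.
by rewrite -(p_step _ i) -mulgA mulVg mulg1.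
Qed.

Lemma order_aut_delta : phi 1 = 1 ->
  diagram_perm m (p 1) /\ phi = delta (p 1).
Proof.
move=> phi1.
have diag : diagram_perm m (p 1).
  split.
    have [q qP] := choice (p_surj 1).
    by exists q => // i; apply: (p_inj (g := 1)); rewrite qP.
  move=> i j; have [->|ij] := eqVneq i j; last by case: (local_step 1 ij).
  by rewrite !(cox_eq1 m _ _).2.
split=> //; apply/funext; elim/artin_ind => [|g i IHg|g i IHg].
- by rewrite phi1 delta1.
- by rewrite pP p_const IHg deltaM // delta_sigma.
have := pP (g * (sigma m i)^-1) i; rewrite -mulgA mulVg mulg1 p_const IHg => e.
rewrite deltaM // deltaV // delta_sigma // e.
by rewrite -mulgA mulgV mulg1.
Qed.

End OrderAutomorphisms.

Section OrderAut.
Variables (S : choiceType) (m : coxeter_matrix S).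
Hypothesis m_sph : spherical m.
Local Open Scope group_scope.

Theorem order_aut_diagram (phi : artin m -> artin m) :
    bijective phi -> {mono phi : g h / (g <= h)%O} -> phi 1 = 1 ->
  exists p, diagram_perm m p /\ phi = delta p.
Proof.
move=> [psi phiK psiK] phi_mono phi1.
have H := cover_image m_sph psiK phi_mono.
have [p pP] : exists p : artin m -> S -> S,
    forall g i, phi (g * sigma m i) = phi g * sigma m (p g i).
  by exists (fun g => projT1 (choice (H g))) => g; exact: projT2 (choice (H g)).
by exists (p 1); apply: (order_aut_delta m_sph phiK psiK phi_mono pP).
Qed.

End OrderAut.

(** * Formations as crossed morphisms *)

Section Diagram.
Variables (S : choiceType) (m : coxeter_matrix S).
Implicit Types (g h : artin m) (p q : S -> S).
Local Open Scope group_scope.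

Lemma diagram_perm_id : diagram_perm m id.
Proof. by split=> //; exists id. Qed.

Lemma diagram_perm_comp p q :
  diagram_perm m p -> diagram_perm m q -> diagram_perm m (p \o q).
Proof.
move=> [pb pm] [qb qm]; split; first exact: bij_comp.
by move=> i j /=; rewrite pm qm.
Qed.

Lemma diagram_perm_inverse p : diagram_perm m p ->
  exists q, [/\ diagram_perm m q, cancel p q & cancel q p].
Proof.
move=> pm; have [[q pK qK] _] := pm.
by exists q; split=> //; apply: diagram_perm_inv pK qK.
Qed.

Lemma diagram_perm_idem p : diagram_perm m p -> p \o p = p -> p = id.
Proof.
move=> [[q pK _] _] e; apply/funext => i; apply: (can_inj pK).
exact: (congr1 (fun f => f i) e).
Qed.

Lemma delta_id g : delta id g = g.
Proof.
have H := diagram_perm_id; elim/artin_ind: g => [|g i IH|g i IH].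
- exact: delta1.
- by rewrite deltaM // IH delta_sigma.
- by rewrite deltaM // IH deltaV // delta_sigma.
Qed.

Lemma delta_comp p q : diagram_perm m p -> diagram_perm m q ->
  forall g, delta (p \o q) g = delta p (delta q g).
Proof.
move=> pm qm; have H := diagram_perm_comp pm qm; elim/artin_ind=> [|g i IH|g i IH].
- by rewrite !delta1.
- by rewrite !(deltaM _ g) // deltaM // IH !delta_sigma.
- by rewrite !(deltaM _ g) // deltaM // IH !deltaV // !delta_sigma.
Qed.

Lemma delta_inj (m_sph : spherical m) p q : diagram_perm m p -> diagram_perm m q ->
  (forall g, delta p g = delta q g) -> p = q.
Proof.
move=> pm qm e; apply/funext => i; apply: (sigma_inj m_sph).
by rewrite -!delta_sigma.
Qed.

End Diagram.

Section Cocycle.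
Variables (S : choiceType) (m : coxeter_matrix S).
Implicit Types (g h : artin m) (p q : S -> S) (i j : S).
Local Open Scope group_scope.

(** The associativity of the law [g * delta (pi g) h]. *)
Definition cocycle (pi : artin m -> S -> S) :=
  (forall g, diagram_perm m (pi g)) /\
  forall g h, pi (g * delta (pi g) h) = pi g \o pi h.

Variable pi : artin m -> S -> S.
Hypothesis piP : cocycle pi.

Let pi_diag g : diagram_perm m (pi g). Proof. by case: piP. Qed.

Lemma cocycle1 : pi 1 = id.
Proof.
apply/funext => i; have [[q _ pK] _] := pi_diag 1.
have [_ /(_ 1 1)] := piP; rewrite mul1g delta1 // => /(congr1 (fun f => f i)) /= e.
have [[r rK _] _] := pi_diag 1.
by apply: (can_inj rK); rewrite -e.
Qed.

Lemma cocycle_next g i : pi (g * sigma m (pi g i)) = pi g \o pi (sigma m i).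
Proof. by rewrite -delta_sigma //; case: piP. Qed.

(** Write [h] as [delta (pi g) h'] where [h'] depends on [pi g] only. *)
Lemma cocycle_eqr g g' h : pi g = pi g' -> pi (g * h) = pi (g' * h).
Proof.
move=> e; have [q [qm pK qK]] := diagram_perm_inverse (pi_diag g).
have hE : h = delta (pi g) (delta q h) by rewrite (deltaK qm (pi_diag g) qK).
by rewrite {1}hE {2}hE {2}e !piP.2 e.
Qed.

Lemma cocycle_eqr_inv g g' h : pi (g * h) = pi (g' * h) -> pi g = pi g'.
Proof. by move=> /(cocycle_eqr h^-1); rewrite -!mulgA !mulgV !mulg1. Qed.

(** On generators, invariance turns the crossed rule into the multiplicative
    one. *)
Lemma cocycle_hom : (forall g i, pi (sigma m (pi g i)) = pi (sigma m i)) ->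
  forall g h, pi (g * h) = pi g \o pi h.
Proof.
move=> inv.
have step g i : pi (g * sigma m i) = pi g \o pi (sigma m i).
  have [[q _ pK] _] := pi_diag g.
  by rewrite -(pK i) cocycle_next inv.
have stepV g i : pi (g * (sigma m i)^-1) = pi g \o pi (sigma m i)^-1.
  have e k : pi (k * (sigma m i)^-1) \o pi (sigma m i) = pi k.
    by rewrite -step -mulgA mulVg mulg1.
  have [[q _ qK] _] := pi_diag (sigma m i).
  apply/funext => j; rewrite -(qK j) /=.
  have := congr1 (fun f => f (q j)) (e 1); rewrite /= mul1g cocycle1 => ->.
  by have := congr1 (fun f => f (q j)) (e g); rewrite /= => ->.
move=> g h; elim/artin_ind: h => [|h i IH|h i IH].
- by rewrite mulg1 cocycle1.
- by rewrite mulgA !step IH.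
- by rewrite mulgA !stepV IH.
Qed.

Lemma cocycle_trivial : (forall i, pi (sigma m i) = id) -> forall g, pi g = id.
Proof.
move=> triv; elim/artin_ind=> [|g i IH|g i IH]; first exact: cocycle1.
  by have := cocycle_next g i; rewrite IH triv.
rewrite -IH; apply: (@cocycle_eqr_inv _ _ (sigma m i)).
by rewrite -mulgA mulVg mulg1 IH; have := cocycle_next g i; rewrite IH triv.
Qed.

(** If [pi] were [tau] at the generator [i] and the identity at [tau i], then
    it would be [tau] both at the generator [i] and at its square, hence the
    identity at the generator [i] by [cocycle_eqr_inv]. *)
Lemma cocycle_involution tau : tau <> id ->
    (forall p, diagram_perm m p -> p = id \/ p = tau) ->
  forall i, pi (sigma m (tau i)) = pi (sigma m i).
Proof.
move=> tau1 two.
have tt i j : pi (sigma m i) = tau -> tau (tau j) = j.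
  move=> ei; have td : diagram_perm m tau by rewrite -ei.
  case: (two _ (diagram_perm_comp td td)) => [/(congr1 (fun f => f j))//|].
  by move=> /(diagram_perm_idem td).
have key i : pi (sigma m i) = tau -> pi (sigma m (tau i)) <> id.
  move=> ei e1.
  have e2 : pi (sigma m i * sigma m (tau (tau i))) = tau.
    by rewrite -[in LHS]ei cocycle_next ei e1.
  apply: tau1; rewrite -ei -cocycle1; apply: (@cocycle_eqr_inv _ _ (sigma m i)).
  by rewrite mul1g ei; rewrite (tt i) in e2.
move=> i; case: (two _ (pi_diag (sigma m i))) => ei;
  case: (two _ (pi_diag (sigma m (tau i)))) => eti; rewrite ei eti //.
  by case: (key _ eti); rewrite (tt _ _ eti) ei.
by case: (key _ ei); rewrite eti.
Qed.

(** The two values commute, so the relation [iji = jij] between them is an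
    equality. *)
Lemma hom_label3 tau i j : tau <> id -> (forall p, diagram_perm m p -> p = id \/ p = tau) ->
  (forall g h, pi (g * h) = pi g \o pi h) -> m i j = 3 ->
  pi (sigma m i) = pi (sigma m j).
Proof.
move=> tau1 two hom mij.
have : aword m (alt_word 3 i j) = aword m (alt_word 3 j i).
  by rewrite -mij; apply: aword_braid; apply: braid_alt.
rewrite !alt_cons !aword_cons aword_nil !mulg1 => /(congr1 pi); rewrite !hom.
case: (two _ (pi_diag (sigma m i))) => ei; case: (two _ (pi_diag (sigma m j))) => ej;
  rewrite ei ej // => e; case: tau1.
  by apply: diagram_perm_idem; [rewrite -ej|rewrite -[RHS]/(id \o (tau \o id)) e].
by apply: diagram_perm_idem; [rewrite -ei|rewrite -[LHS]/(tau \o (id \o tau)) e].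
Qed.

End Cocycle.

Section Formations.
Variables (S : choiceType) (m : coxeter_matrix S).
Hypothesis m_sph : spherical m.
Implicit Types (g h : artin m) (p q : S -> S) (i j : S).
Local Open Scope group_scope.

Lemma lo_mono d (G : loGroupType d) (x : G) : {mono (fun y => x * y) : y z / (y <= z)%O}.
Proof.
move=> y z; apply/idP/idP; last exact: le_mulg2l.
by move=> /(le_mulg2l x^-1); rewrite !mulgA mulVg !mul1g.
Qed.

(** The left translation by [x] divided by that of the Artin-Tits group is an
    order automorphism that fixes 1, hence a diagram automorphism. *)
Lemma formation_cocycle (F : formation (artin m)) : exists pi : artin m -> S -> S,
  cocycle pi /\ forall x y : F,
    iota_of (x * y) = iota_of x * delta (pi (iota_of x)) (iota_of y).
Proof.
have [jo ioK joK] := iota_bij F; have io1 := iota1 F; have iom := @iota_mono _ _ F.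
have jom : {mono jo : g h / (g <= h)%O} by move=> g h; rewrite -iom !joK.
have ex g : exists p, diagram_perm m p /\
    (fun h => g^-1 * iota_of (jo g * jo h)) = delta p.
  apply: order_aut_diagram => //.
  - exists (fun h => iota_of ((jo g)^-1 * jo (g * h))) => h.
      by rewrite mulgA mulgV mul1g ioK mulgA mulVg mul1g joK.
    by rewrite ioK mulgA mulgV mul1g joK mulgA mulVg mul1g.
  - by move=> h k; rewrite lo_mono iom lo_mono jom.
  - by rewrite -io1 ioK mulg1 joK mulVg io1.
have [pi piP] := choice ex.
have tw (x y : F) : iota_of (x * y) = iota_of x * delta (pi (iota_of x)) (iota_of y).
  have [_ <-] := piP (iota_of x); by rewrite mulgA mulgV mul1g !ioK.
exists pi; split=> //; split=> [g|g h]; first by case: (piP g).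
have pd k : diagram_perm m (pi k) by case: (piP k).
apply: (delta_inj m_sph) => // [|k]; first exact: diagram_perm_comp.
rewrite delta_comp //; apply: (mulgI (g * delta (pi g) h)).
have e : iota_of (jo g * jo h) = g * delta (pi g) h by rewrite tw !joK.
have := tw (jo g * jo h) (jo k); rewrite e joK => <-.
by rewrite -mulgA tw tw !joK deltaM // mulgA.
Qed.

Lemma formation_trivial (F : formation (artin m)) (pi : artin m -> S -> S) :
    (forall x y : F,
      iota_of (x * y) = iota_of x * delta (pi (iota_of x)) (iota_of y)) ->
    (forall g, pi g = id) -> trivial_formation F.
Proof.
move=> tw pi1; exists (@iota_of _ _ F); split=> //; first exact: (iota_bij F).
  by move=> x y; rewrite tw pi1 delta_id.
exact: (@iota_mono _ _ F).
Qed.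

Lemma formation_twisted (F : formation (artin m)) (pi : artin m -> S -> S) :
    (forall x y : F,
      iota_of (x * y) = iota_of x * delta (pi (iota_of x)) (iota_of y)) ->
    (forall g, diagram_perm m (pi g)) ->
    (forall g h, pi (g * h) = pi g \o pi h) ->
  exists alpha : diagram_hom m, (forall g, alpha g = delta (pi g)) /\
    exists alphaA : associative (circ alpha),
      equiv_formation F (twisted_formation alphaA).
Proof.
move=> tw pd hom.
have aut g : diagram_aut (delta (pi g) : artin m -> artin m) by exists (pi g).
have homd g h : delta (pi (g * h)) = delta (pi g) \o delta (pi h) :> (artin m -> artin m).
  by apply/funext => k; rewrite hom delta_comp.
exists (DiagramHom aut homd); split=> //.
have [jo ioK joK] := iota_bij F.
have circE (x y : F) : circ (DiagramHom aut homd) (iota_of x) (iota_of y) = iota_of (x * y).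
  by rewrite tw.
have assoc : associative (circ (DiagramHom aut homd)).
  by move=> g h k; rewrite -(joK g) -(joK h) -(joK k) !circE mulgA.
exists assoc, (@iota_of _ _ F); split=> //; first exact: (iota_bij F).
exact: (@iota_mono _ _ F).
Qed.

Lemma twisted_unique (F : formation (artin m)) (alpha beta : diagram_hom m)
    (alphaA : associative (circ alpha)) (betaA : associative (circ beta)) :
  equiv_formation F (twisted_formation alphaA) ->
  equiv_formation F (twisted_formation betaA) -> alpha = beta.
Proof.
have circE (gamma : diagram_hom m) (gammaA : associative (circ gamma)) :
    equiv_formation F (twisted_formation gammaA) -> forall x y : F,
    circ gamma (iota_of x) (iota_of y) = iota_of (x * y).
  move=> [f [_ fM _ fi]] x y.
  have fE z : f z = iota_of z :> artin m := fi z.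
  by rewrite -!fE; exact: esym (fM x y).
move=> /circE ca /circE cb.
have e : dhom alpha = dhom beta.
  have [jo _ joK] := iota_bij F.
  apply/funext => g; apply/funext => h; apply: (mulgI g).
  by have := ca (jo g) (jo h); rewrite -cb !joK.
case: alpha beta e {alphaA betaA ca cb} => a a1 a2 [b b1 b2] /= ab.
by subst b; congr DiagramHom; apply: Prop_irrelevance.
Qed.

End Formations.

(** * Diagrams excluded by finiteness *)

Definition adj (S : Type) (m : coxeter_matrix S) : rel S := fun x y => 3 <= m x y.

(** The squares of the weights [2 cos (pi / m x y)] for [y] in [N] have sum at
    least 2, which is what an end of an affine diagram of type B, C or D has.
    *)
Definition heavy (S : eqType) (m : coxeter_matrix S) (x : S) (N : seq S) :=
  [&& uniq N, all (adj m x) N & (2 <= size N) || has (fun y => 4 <= m x y) N].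

Section Obstructions.
Variables (S : choiceType) (m : coxeter_matrix S) (R : rcfType).
Hypothesis m_sph : spherical m.
Implicit Types (x y z i : S) (p N : seq S).
Local Open Scope ring_scope.
Local Notation adj := (adj m).
Local Notation gram := (gram m R).
Local Notation ind i y := ((i == y)%:R : R).

Lemma adjC x y : adj x y = adj y x. Proof. by rewrite /adj cox_sym. Qed.

Lemma adj_neq x y : adj x y -> x != y.
Proof. by apply: contraTneq => ->; rewrite /adj (cox_eq1 m y y).2. Qed.

Lemma gram_adj x y : adj x y -> 1 <= gram x y.
Proof. by move=> xy; apply: cheb_weight_ge1 xy (gramP _ _ (adj_neq xy)). Qed.

Lemma gram_sqr x y : adj x y -> (4 <= m x y)%N -> 2 <= gram x y ^+ 2.
Proof. by move=> xy h; apply: cheb_weight_sqr h (gramP _ _ (adj_neq xy)). Qed.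

Lemma gram_5 x y : adj x y -> (5 <= m x y)%N -> 3 / 2 <= gram x y.
Proof. by move=> xy h; apply: cheb_weight_5 h (gramP _ _ (adj_neq xy)). Qed.

(** Each row of the form dominates the indicator functions of the neighbours
    of its vertex. With these bounds [no_affine] becomes a linear inequality
    between indicators, and only the neighbours of one vertex have to be
    distinct: a diagram need not be embedded, an immersion is enough. *)
Lemma local_ineq (b : S -> R) x N i : uniq N -> x \notin N ->
    (forall y, y \in N -> b y <= gram x y) ->
  \sum_(y <- N) b y * ind i y - 2 * ind i x <= gram x i.
Proof.
move=> uN xN bN; have [iN|iN] := boolP (i \in N); last first.
  rewrite big1_seq => [|y /andP[_ yN]]; last first.
    by rewrite (_ : i == y = false) ?mulr0 //; apply: contraNF iN => /eqP->.
  have [->|ix] := eqVneq i x; first by rewrite gramii /=; lra.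
  by have := @gram_ge0 _ m R x i; rewrite eq_sym => /(_ ix) /=; lra.
have ix : (i == x) = false by apply: contraNF xN => /eqP<-.
rewrite ix mulr0 subr0 (bigD1_seq i) //= eqxx mulr1 big1 ?addr0 ?bN // => y.
by rewrite eq_sym => /negPf->; rewrite mulr0.
Qed.

Lemma adj_notin x N : all (adj x) N -> x \notin N.
Proof. by move=> /allP aN; apply/negP => /aN/adj_neq; rewrite eqxx. Qed.

Lemma local_gram x N i : uniq N -> all (adj x) N ->
  \sum_(y <- N) gram x y * ind i y - 2 * ind i x <= gram x i.
Proof. by move=> uN aN; apply: local_ineq => //; apply: adj_notin. Qed.

Lemma local_one x N i : uniq N -> all (adj x) N ->
  \sum_(y <- N) ind i y - 2 * ind i x <= gram x i.
Proof.
move=> uN aN; have := @local_ineq (fun=> 1) x N i uN (adj_notin aN).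
under eq_bigr do rewrite mul1r.
by apply=> y /(allP aN)/gram_adj.
Qed.

Lemma local_neighbor x y i : adj x y -> gram x y * ind i x - 2 * ind i y <= gram y i.
Proof.
move=> xy; have := @local_gram y [:: x] i; rewrite big_seq1 (gramC m R y x).
by apply => //; rewrite /= adjC xy.
Qed.

Lemma heavy_sum x N : heavy m x N -> 2 <= \sum_(y <- N) gram x y ^+ 2.
Proof.
move=> /and3P[uN aN /orP[sz|/hasP[y yN my]]].
  have : (size N)%:R <= \sum_(y <- N) gram x y ^+ 2.
    rewrite -sum1_size natr_sum big_seq [leRHS]big_seq; apply: ler_sum => y yN.
    by rewrite exprn_ege1 // gram_adj ?(allP aN).
  by apply: le_trans; rewrite (ler_nat _ 2).
rewrite (bigD1_seq y) //=; have := gram_sqr (allP aN _ yN) my.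
have : 0 <= \sum_(z <- N | z != y) gram x z ^+ 2 by apply: sumr_ge0 => z _; apply: sqr_ge0.
lra.
Qed.

Lemma end_bound x N i : all (adj x) N -> 
  (\sum_(y <- N) gram x y ^+ 2) * ind i x - 2 * (\sum_(y <- N) gram x y * ind i y) <=
  \sum_(y <- N) gram x y * gram y i.
Proof.
move=> aN; rewrite mulr_suml mulr_sumr -sumrB big_seq [leRHS]big_seq.
apply: ler_sum => y /(allP aN) xy.
have := local_neighbor i xy; have := gram_adj xy; set a := gram x y => a1 h.
have : a * (a * ind i x - 2 * ind i y) <= a * gram y i by rewrite ler_pM2l //; lra.
by apply: le_trans; rewrite le_eqVlt; apply/orP; left; apply/eqP; ring.
Qed.

Lemma ind_ge0 i y : 0 <= ind i y. Proof. exact: ler0n. Qed.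

(** Affine [D4], [B3] and [C2]. *)
Lemma no_star x N N' : heavy m x N -> heavy m x N' -> ~~ uniq (N ++ N').
Proof.
move=> hN hN'; apply/negP => uNN; have aN : all (adj x) (N ++ N').
  by move: hN hN' => /and3P[_ a _] /and3P[_ a' _]; rewrite all_cat a.
pose l := (x, 2) :: [seq (y, gram x y) | y <- N ++ N'].
apply: (@no_affine _ m R m_sph l).
- rewrite /= ler0n all_map; apply/allP => y /(allP aN)/gram_adj /=; lra.
- rewrite big_cons /= big_map /=; apply: ltr_wpDr => //; rewrite big_seq.
  by apply: sumr_ge0 => y /(allP aN)/gram_adj; lra.
move=> i; rewrite big_cons big_map /=.
have s4 : 4 <= \sum_(y <- N ++ N') gram x y ^+ 2.
  by rewrite big_cat /=; have := heavy_sum hN; have := heavy_sum hN'; lra.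
have := local_gram i uNN aN; have := end_bound i aN.
move: s4 (ind_ge0 i x); nra.
Qed.

(** The bounds telescope along the walk. *)
Lemma walk_bound prev x p N i : path adj prev (x :: p) -> uniq [:: prev, x & p] ->
    heavy m (last x p) N -> last prev (belast x p) \notin N ->
  2 * ind i prev - 2 * ind i x <= 2 * (\sum_(z <- x :: p) gram z i) +
    \sum_(y <- N) gram (last x p) y * gram y i.
Proof.
elim: p prev x => [|x' p IHp] prev x.
  move=> /andP[px _] /=; rewrite inE => /andP[pnx _] hN pN.
  have /and3P[uN aN _] := hN.
  have u' : uniq (prev :: N) by rewrite /= pN.
  have a' : all (adj x) (prev :: N) by rewrite /= adjC px.
  have := local_gram i u' a'; have := end_bound i aN; have := heavy_sum hN.
  rewrite big_seq1 big_cons; have := gram_adj px; rewrite gramC.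
  by move: (ind_ge0 i x) (ind_ge0 i prev); nra.
move=> /andP[px pp] /andP[pn u] hN pN.
have := IHp _ _ pp u hN pN.
have xx' : adj x x' by case/andP: pp.
have := @local_one x [:: prev; x'] i.
rewrite /= !andbT adjC px xx' inE => /(_ _ isT).
have -> : prev != x' by apply: contraNneq pn => ->; rewrite !inE eqxx orbT.
move=> /(_ isT); rewrite !big_cons big_nil.
lra.
Qed.

(** Affine [Dn], [Bn] and [Cn]. *)
Lemma no_two_ends x0 x1 p N0 N : path adj x0 (x1 :: p) -> uniq [:: x0, x1 & p] ->
  heavy m x0 N0 -> x1 \notin N0 ->
  heavy m (last x1 p) N -> last x0 (belast x1 p) \notin N -> False.
Proof.
move=> pp u h0 n0 h1 n1.
have /and3P[u0 a0 _] := h0; have /and3P[uN aN _] := h1.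
have x01 : adj x0 x1 by case/andP: pp.
pose l := [seq (z, 2) | z <- [:: x0, x1 & p]] ++
   [seq (y, gram x0 y) | y <- N0] ++ [seq (y, gram (last x1 p) y) | y <- N].
have pos x M : all (adj x) M -> 0 <= \sum_(y <- M) gram x y.
  by move=> aM; rewrite big_seq; apply: sumr_ge0 => y /(allP aM)/gram_adj; lra.
apply: (@no_affine _ m R m_sph l).
- rewrite !all_cat !all_map; apply/and3P; split; apply/allP => y.
  + by rewrite /= ler0n.
  + by move=> /(allP a0)/gram_adj /=; lra.
  + by move=> /(allP aN)/gram_adj /=; lra.
- rewrite !big_cat !big_map /=; have := pos _ _ a0; have := pos _ _ aN.
  rewrite big_cons.
  have : 0 <= \sum_(y <- x1 :: p) (2 : R) by apply: sumr_ge0.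
  lra.
move=> i; rewrite !big_cat !big_map /=.
have := walk_bound i pp u h1 n1.
have u0' : uniq (x1 :: N0) by rewrite /= n0.
have a0' : all (adj x0) (x1 :: N0) by rewrite /= x01.
have := local_gram i u0' a0'; have := end_bound i a0; have := heavy_sum h0.
rewrite -mulr_sumr !big_cons; have := gram_adj x01.
move: (ind_ge0 i x0) (ind_ge0 i x1); nra.
Qed.

Lemma cycle_bound prev x p nxt i : path adj prev (x :: p) -> uniq [:: prev, x & p] ->
    adj (last x p) nxt -> nxt \notin x :: p -> last prev (belast x p) != nxt ->
  ind i prev + ind i nxt - ind i x - ind i (last x p) <= \sum_(z <- x :: p) gram z i.
Proof.
elim: p prev x => [|x' p IHp] prev x.
  move=> /andP[px _] _ /= xn _ pn; rewrite big_seq1.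
  have := @local_one x [:: prev; nxt] i; rewrite /= !andbT adjC px xn inE pn.
  by rewrite !big_cons big_nil => /(_ isT isT); lra.
move=> /andP[px pp] /andP[pn u] ln nn pnn.
have := IHp x x' pp u ln _ pnn.
have -> : nxt \notin x' :: p by move: nn; rewrite inE negb_or => /andP[].
move=> /(_ isT).
have xx' : adj x x' by case/andP: pp.
have := @local_one x [:: prev; x'] i; rewrite /= !andbT adjC px xx' inE.
have -> : prev != x' by apply: contraNneq pn => ->; rewrite !inE eqxx orbT.
move=> /(_ isT isT); rewrite !big_cons big_nil.
lra.
Qed.

(** Affine [An]. *)
Lemma no_cycle x p : path adj x p -> uniq (x :: p) -> (2 <= size p)%N ->
  ~~ adj (last x p) x.
Proof.
case: p => [//|y [//|z p]] pp u _; apply/negP => lx.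
pose l := [seq (z, 1 : R) | z <- [:: x, y, z & p]].
apply: (@no_affine _ m R m_sph l).
- by rewrite all_map; apply/allP => t _ /=.
- rewrite big_map big_cons /=.
  have : 0 <= \sum_(j <- [:: y, z & p]) (1 : R) by apply: sumr_ge0.
  lra.
move=> i; rewrite big_map /=.
under eq_bigr do rewrite mul1r.
have xny : x \notin [:: y, z & p] by case/andP: u.
have := @cycle_bound x y (z :: p) x i pp u lx xny.
have -> : last x (belast y (z :: p)) != x.
  apply: contraNneq xny => {1}<- /=; have := mem_last y (belast z p).
  by rewrite !inE => /orP[->//|/mem_belast]; rewrite inE => ->; rewrite orbT.
move=> /(_ isT); rewrite [X in _ <= X]big_cons.
have xy : adj x y by case/andP: pp.
have := @local_one x [:: y; last z p] i; rewrite /= !andbT xy adjC lx inE.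
have -> : y != last z p.
  by case/and3P: u => _ yn _; apply: contraNneq yn => ->; apply: mem_last.
by move=> /(_ isT isT); rewrite !big_cons big_nil; lra.
Qed.

Definition arm3 x a b c := [/\ adj x a, adj a b, adj b c, x != b & a != c].

(** Affine [E7]. *)
Lemma no_E7 x a b c a' b' c' d : arm3 x a b c -> arm3 x a' b' c' ->
  adj x d -> ~~ uniq [:: a; a'; d].
Proof.
move=> [xa ab bc xb ac] [xa' ab' bc' xb' ac'] xd; apply/negP => u.
(* the marks of the affine diagram *)
apply: (@no_affine _ m R m_sph [:: (x, 4); (a, 3); (b, 2); (c, 1); (a', 3);
   (b', 2); (c', 1); (d, 2)]).
- by rewrite /= !(ler0n, ler01).
- by rewrite !big_cons big_nil /=; lra.
move=> i; rewrite !big_cons big_nil /=.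
have := @local_one x _ i u; rewrite /= xa xa' xd => /(_ isT).
have := @local_one a [:: x; b] i; rewrite /= adjC xa ab inE xb => /(_ isT isT).
have := @local_one b [:: a; c] i; rewrite /= adjC ab bc inE ac => /(_ isT isT).
have := @local_one c [:: b] i; rewrite /= adjC bc => /(_ isT isT).
have := @local_one a' [:: x; b'] i; rewrite /= adjC xa' ab' inE xb' => /(_ isT isT).
have := @local_one b' [:: a'; c'] i; rewrite /= adjC ab' bc' inE ac' => /(_ isT isT).
have := @local_one c' [:: b'] i; rewrite /= adjC bc' => /(_ isT isT).
have := @local_one d [:: x] i; rewrite /= adjC xd => /(_ isT isT).
by rewrite !big_cons !big_nil; lra.
Qed.

Definition arm2 x a b := [/\ adj x a, adj a b & x != b].

(** Affine [E6]. *)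
Lemma no_E6 x a b a' b' a'' b'' : arm2 x a b -> arm2 x a' b' -> arm2 x a'' b'' ->
  ~~ uniq [:: a; a'; a''].
Proof.
move=> [xa ab xb] [xa' ab' xb'] [xa'' ab'' xb'']; apply/negP => u.
apply: (@no_affine _ m R m_sph [:: (x, 3); (a, 2); (b, 1); (a', 2); (b', 1);
   (a'', 2); (b'', 1)]).
- by rewrite /= !(ler0n, ler01).
- by rewrite !big_cons big_nil /=; lra.
move=> i; rewrite !big_cons big_nil /=.
have := @local_one x _ i u; rewrite /= xa xa' xa'' => /(_ isT).
have := @local_one a [:: x; b] i; rewrite /= adjC xa ab inE xb => /(_ isT isT).
have := @local_one b [:: a] i; rewrite /= adjC ab => /(_ isT isT).
have := @local_one a' [:: x; b'] i; rewrite /= adjC xa' ab' inE xb' => /(_ isT isT).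
have := @local_one b' [:: a'] i; rewrite /= adjC ab' => /(_ isT isT).
have := @local_one a'' [:: x; b''] i; rewrite /= adjC xa'' ab'' inE xb'' => /(_ isT isT).
have := @local_one b'' [:: a''] i; rewrite /= adjC ab'' => /(_ isT isT).
by rewrite !big_cons !big_nil; lra.
Qed.

Lemma local_two c x y z i : adj x y -> adj x z -> y != z -> c <= gram x y ->
  c * ind i y + ind i z - 2 * ind i x <= gram x i.
Proof.
move=> xy xz yz cg.
have := @local_ineq (fun t => if t == y then c else 1) x [:: y; z] i.
rewrite !big_cons big_nil eqxx (eq_sym z) (negPf yz) mul1r addr0; apply.
- by rewrite /= inE yz.
- by rewrite !inE negb_or !adj_neq.
by move=> t; rewrite !inE => /orP[]/eqP->; rewrite ?eqxx // eq_sym (negPf yz) gram_adj.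
Qed.

(** This path contains affine [F4]; being symmetric, it also allows the
    symmetric coefficients 1, 2, 3, 3, 2, 1, as [sqrt 2] exceeds [4 / 3]. *)
Lemma no_long4 x a b x' a' b' : adj x x' -> (4 <= m x x')%N ->
  arm2 x a b -> arm2 x' a' b' -> x' != a -> x != a' -> False.
Proof.
move=> xx mxx [xa ab xb] [xa' ab' xb'] na na'.
have g : 4 / 3 <= gram x x'.
  by have := gram_sqr xx mxx; have := gram_adj xx; nra.
apply: (@no_affine _ m R m_sph [:: (x, 3); (a, 2); (b, 1); (x', 3); (a', 2); (b', 1)]).
- by rewrite /= !(ler0n, ler01).
- by rewrite !big_cons big_nil /=; lra.
move=> i; rewrite !big_cons big_nil /=.
have := local_two i xx xa na g.
have xx' : adj x' x by rewrite adjC.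
have g' : 4 / 3 <= gram x' x by rewrite gramC.
have := local_two i xx' xa' na' g'.
have := @local_one a [:: x; b] i; rewrite /= adjC xa ab inE xb => /(_ isT isT).
have := @local_one b [:: a] i; rewrite /= adjC ab => /(_ isT isT).
have := @local_one a' [:: x'; b'] i; rewrite /= adjC xa' ab' inE xb' => /(_ isT isT).
have := @local_one b' [:: a'] i; rewrite /= adjC ab' => /(_ isT isT).
by rewrite !big_cons !big_nil; lra.
Qed.

(** The path with labels 3, 5, 3: the golden ratio exceeds [3 / 2]. *)
Lemma no_long5 x a x' a' : adj x x' -> (5 <= m x x')%N ->
  adj x a -> adj x' a' -> x' != a -> x != a' -> False.
Proof.
move=> xx mxx xa xa' na na'; have g := gram_5 xx mxx.
apply: (@no_affine _ m R m_sph [:: (x, 2); (a, 1); (x', 2); (a', 1)]).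
- by rewrite /= !(ler0n, ler01).
- by rewrite !big_cons big_nil /=; lra.
move=> i; rewrite !big_cons big_nil /=.
have := local_two i xx xa na g.
have xx' : adj x' x by rewrite adjC.
have g' : 3 / 2 <= gram x' x by rewrite gramC.
have := local_two i xx' xa' na' g'.
have := @local_one a [:: x] i; rewrite /= adjC xa => /(_ isT isT).
have := @local_one a' [:: x'] i; rewrite /= adjC xa' => /(_ isT isT).
by rewrite !big_cons !big_nil; lra.
Qed.

End Obstructions.

(** * Paths in the diagram *)

Section IotaPaths.
Variables (T : eqType) (f : nat -> T).

Lemma last_map_iota a k : last (f a) (map f (iota a.+1 k)) = f (a + k).
Proof. by elim: k a => [|k IHk] a /=; rewrite ?addn0 // IHk addnS. Qed.

Lemma belast_map_iota a k : belast (f a) (map f (iota a.+1 k)) = map f (iota a k).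
Proof. by elim: k a => [//|k IHk] a /=; rewrite IHk. Qed.

Lemma path_map_iota (e : rel T) a k : (forall i, a <= i < a + k -> e (f i) (f i.+1)) ->
  path e (f a) (map f (iota a.+1 k)).
Proof.
elim: k a => [//|k IHk] a H /=; rewrite H ?IHk //; last by lia.
by move=> i ia; apply: H; lia.
Qed.

End IotaPaths.

Section Tree.
Variables (S : choiceType) (m : coxeter_matrix S).
Hypotheses (m_sph : spherical m) (m_irr : irreducible m).
Implicit Types (x y z u v a b c : S) (p q A B N : seq S).
Local Notation adj := (adj m).

Lemma uniq_size_bound : exists n, forall s : seq S, uniq s -> size s <= n.
Proof.
have /finite_seqP[w wE] := m_sph.
exists (size w) => s us; rewrite -(size_map (fun i => cword m [:: i])).
apply: uniq_leq_size.
  by rewrite map_inj_uniq // => i j; apply: cword_gen_inj.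
move=> g _; have : [set: coxeter m]%classic g by [].
by rewrite wE.
Qed.

Lemma max_uniq (P : seq S -> Prop) : (forall s, P s -> uniq s) -> (exists s, P s) ->
  exists2 s, P s & forall t, P t -> size t <= size s.
Proof.
move=> Pu [s0 Ps0]; have [n nP] := uniq_size_bound.
have ex : exists k, `[< exists2 s, P s & size s = k >].
  by exists (size s0); apply/asboolP; exists s0.
have ub k : `[< exists2 s, P s & size s = k >] -> k <= n.
  by move=> /asboolP[s /Pu/nP + <-].
case: (ex_maxnP ex ub) => k /asboolP[s Ps <-] kmax.
by exists s => // t Pt; apply: kmax; apply/asboolP; exists t.
Qed.

Lemma connected_closed (P : S -> Prop) : (exists x, P x) ->
  (forall x y, P x -> adj x y -> P y) -> forall y, P y.
Proof.
move=> [x Px] Pc y; have [p [pp <-]] := m_irr x y.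
elim: p x Px pp => [//|z p IHp] x Px /= /andP[xz pz].
by apply: IHp pz; apply: Pc xz.
Qed.

(** Any other edge from [x] to the path closes a cycle. *)
Lemma nochord x p y : path adj x p -> uniq (x :: p) -> y \in p -> adj x y ->
  y = head x p.
Proof.
move=> pp u yp xy; case/splitPr: p / yp pp u => p1 p2 pp u.
case: p1 pp u => [//|z p1] pp u.
have pp' : path adj x (rcons (z :: p1) y).
  by move: pp; rewrite -cat_rcons cat_path => /andP[].
have u' : uniq (x :: rcons (z :: p1) y).
  by move: u; rewrite -cat_rcons -cat_cons cat_uniq => /and3P[].
have := no_cycle realalg m_sph pp' u'; rewrite last_rcons adjC xy.
by rewrite size_rcons /= => /(_ isT).
Qed.

Lemma path_adjE x0 x p i j : path adj x p -> uniq (x :: p) ->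
  i < j < (size p).+1 -> adj (nth x0 (x :: p) i) (nth x0 (x :: p) j) = (j == i.+1).
Proof.
elim: p x i j => [|y p IHp] x i j pp u ij; first by move: ij => /=; lia.
have /andP[xy pp'] := pp; have /andP[xn u'] := u.
case: i j ij => [|i] [|j] // ij; last by rewrite eqSS -(IHp y).
apply/idP/eqP => [|[-> //]].
rewrite [nth x0 (x :: _) 0]/= [nth x0 (x :: _) j.+1]/= => xj.
have jp : nth x0 (y :: p) j \in y :: p by apply: mem_nth; move: ij => /=; lia.
have /eqP := nochord pp u jp xj.
by rewrite -[head x _]/(nth x0 (y :: p) 0) nth_uniq //= => /eqP ->.
Qed.

Definition branch v := exists a b c, uniq [:: a; b; c] && all (adj v) [:: a; b; c].

(** An arm hanging at [x]. *)
Definition chain x A := [/\ path adj x A, uniq (x :: A) &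
  forall u v, u \in A -> adj u v -> v \in x :: A].

(** An inner vertex of the path has two neighbours on it, so a third one would
    make it a branch vertex. *)
Lemma chain_intro x p : path adj x p -> uniq (x :: p) ->
    (forall v, adj (last x p) v -> v \in x :: p) ->
    (forall v, v \in p -> ~ branch v) -> chain x p.
Proof.
move=> pp up pl nb; split=> // u v uA uv; apply: contrapT => /negP vA.
have [q1 [q2 e]] : exists q1 q2, p = q1 ++ u :: q2.
  by case/splitPr: uA => q1 q2; exists q1, q2.
case: q2 e => [|w q2] e.
  by move: (pl v); rewrite e last_cat /= uv -e (negPf vA) => /(_ isT).
apply: (nb u uA); exists (last x q1), w, v.
have lq : last x q1 \in x :: q1 := mem_last x q1.
have sub t : t \in x :: q1 -> t \in x :: p.
  by rewrite !(inE, e, mem_cat) => /orP[->//|->]; rewrite orbT.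
have wA : w \in x :: p by rewrite !(inE, e, mem_cat) eqxx !orbT.
have lv : last x q1 != v by apply: contraNneq vA => <-; apply: sub.
have wv : w != v by apply: contraNneq vA => <-.
have lw : last x q1 != w.
  apply: contraTneq up => lw; apply/negP.
  rewrite e -cat_cons cat_uniq => /and3P[_ /hasPn h _].
  have : w \notin x :: q1 by apply: h; rewrite !inE eqxx orbT.
  by rewrite -lw lq.
rewrite /= !inE uv !andbT negb_or lv wv lw /=.
move: pp; rewrite e cat_path /= => /and3P[_ lu /andP[uw _]].
by rewrite adjC lu uw.
Qed.

Lemma chain_exists x y : adj x y -> (forall v, v != x -> ~ branch v) ->
  exists p, chain x (y :: p).
Proof.
move=> xy nb.
pose P s := exists p, [/\ s = [:: x, y & p], path adj x (y :: p) & uniq [:: x, y & p]].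
have [||s [p [-> pp up]] pmax] := @max_uniq P.
- by move=> s [p [-> _ ->]].
- exists [:: x; y], [::]; split; rewrite //= ?xy // inE andbT.
  exact: adj_neq xy.
exists p; apply: chain_intro => // v.
  move=> uv; apply: contrapT => /negP vA.
  have : P (rcons [:: x, y & p] v).
    exists (rcons p v); split=> //; last by rewrite -!rcons_cons rcons_uniq vA.
    by rewrite -rcons_cons rcons_path pp.
  by move=> /pmax; rewrite size_rcons ltnn.
move=> vp; apply: nb; apply: contraTneq up => <-.
by rewrite cons_uniq vp.
Qed.

(** A path that enters the chain cannot leave it, and without chords it can
    only follow it. *)
Lemma chain_prefix x A q : chain x A -> path adj x q -> uniq (x :: q) ->
  head x q = head x A -> q = take (size q) A.
Proof.
move=> [pA uA cA]; elim/last_ind: q => [|q v IHq]; first by rewrite take0.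
rewrite rcons_path => /andP[pq qv]; rewrite -rcons_cons rcons_uniq => /andP[vn uq].
move=> hq; have {}IHq : q = take (size q) A.
  by case: q IHq pq uq hq {qv vn} => [|w q] IHq pq uq hq; [rewrite take0|apply: IHq].
have [r AE] : exists r, A = q ++ r.
  by exists (drop (size q) A); rewrite {1}IHq cat_take_drop.
have vA : v \in x :: A.
  case/lastP: q IHq AE qv vn pq hq {uq} => [|q w] IHq AE qv vn pq hq.
    move: hq qv => /= ->; case: A {pA uA cA AE IHq vn} => [|y A] /=.
      by move=> /adj_neq; rewrite eqxx.
    by rewrite !inE eqxx orbT.
  rewrite last_rcons in qv; apply: cA qv.
  by rewrite AE mem_cat mem_rcons inE eqxx.
have vr : v \in r by move: vA; rewrite AE -cat_cons mem_cat (negPf vn).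
have pr : path adj (last x q) r by move: pA; rewrite AE cat_path => /andP[].
have ur : uniq (last x q :: r).
  move: uA; rewrite AE -cat_cons lastI cat_rcons cat_uniq => /and3P[_ _].
  by [].
have hv := nochord pr ur vr qv.
rewrite size_rcons -addn1 takeD -IHq -cats1; congr (_ ++ _).
by rewrite AE drop_size_cat //; case: r vr hv {AE pr ur} => [//|w r] _ /= ->; rewrite take0.
Qed.

(** Walking back along the second chain from a common vertex stays in the
    first one, so [y] would be the end of a chord. *)
Lemma chain_disjoint x y A B : chain x A -> chain x (y :: B) -> y != head x A ->
  forall u, u \in A -> u \notin y :: B.
Proof.
move=> [pA uA cA] [pB uB cB] yA u uIA; apply/negP => /(nthP x)[k ks ku].
suff yIA : y \in A.
  have xy : adj x y by case/andP: pB.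
  by move: yA; rewrite (nochord pA uA yIA xy) eqxx.
elim: k u uIA ks ku => [|k IHk] u uIA ks ku; first by rewrite -[y]/(nth x (y :: B) 0) ku.
have e := @path_adjE x _ _ k.+1 k.+2 pB uB.
have adjk : adj u (nth x (y :: B) k).
  by rewrite -ku adjC; have /= := e; rewrite eqxx => ->; move: ks => /=; lia.
have := cA _ _ uIA adjk; rewrite inE => /orP[/eqP xk|kA].
  have kB : nth x (y :: B) k \in y :: B by apply: mem_nth; apply: ltnW.
  by move: uB; rewrite cons_uniq -{1}xk kB.
by apply: IHk kA _ _; first exact: ltnW.
Qed.


Lemma diag_adj phi a b : diagram_perm m phi -> adj (phi a) (phi b) = adj a b.
Proof. by move=> [_ H]; rewrite /adj H. Qed.

Lemma diag_path phi x p : diagram_perm m phi ->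
  path adj (phi x) (map phi p) = path adj x p.
Proof.
move=> d; rewrite path_map; apply: eq_path => a b /=; exact: diag_adj.
Qed.

Lemma diag_uniq phi s : diagram_perm m phi -> uniq (map phi s) = uniq s.
Proof. by move=> [/bij_inj d _]; rewrite map_inj_uniq. Qed.

(** The image of [A] is a prefix of [B], and the preimage of [B] is a prefix
    of [A]. *)
Lemma chain_map phi x A B : diagram_perm m phi -> chain x A -> chain (phi x) B ->
  phi (head x A) = head (phi x) B -> map phi A = B.
Proof.
move=> d cA cB hAB; have [psi [d' phiK psiK]] := diagram_perm_inverse d.
have [pA uA _] := cA; have [pB uB _] := cB.
have e1 : map phi A = take (size A) B.
  rewrite -(size_map phi); apply: chain_prefix cB _ _ _.
  - by rewrite diag_path.
  - by rewrite -map_cons diag_uniq.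
  - by rewrite -hAB; case: (A).
have e2 : map psi B = take (size B) A.
  rewrite -(size_map psi); apply: chain_prefix cA _ _ _.
  - by rewrite -(phiK x) diag_path.
  - by rewrite -[x]phiK -map_cons diag_uniq.
  - by rewrite -[RHS]phiK hAB; case: (B) => //=; rewrite phiK.
have := congr1 size e1; have := congr1 size e2.
rewrite !size_map !size_take; case: ltnP => h; case: ltnP => h'; move=> h1 h2; try lia.
by rewrite e1 take_oversize.
Qed.

Definition line x p := [/\ path adj x p, uniq (x :: p) & forall v, v \in x :: p].

Lemma line_chain x p : line x p -> chain x p.
Proof. by move=> [pp up all]; split=> // u v _ _; apply: all. Qed.

Lemma line_end x p y : line x p -> adj x y -> y = head x p.
Proof.
move=> [pp up all] xy; apply: nochord => //.
by have := all y; rewrite inE eq_sym (negPf (adj_neq xy)).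
Qed.

Lemma line_map phi x p q : diagram_perm m phi -> line x p -> line (phi x) q ->
  map phi p = q.
Proof.
move=> d lp lq; apply: chain_map (line_chain lp) (line_chain lq) _ => //.
have [pp up allp] := lp; have [pq uq allq] := lq.
case: p pp up allp {lp} => [|y p] pp up allp /=.
  case: q pq uq allq {lq} => [//|z q] pq uq allq /=.
  have [psi [_ _ psiK]] := diagram_perm_inverse d.
  by have := allp (psi z); rewrite inE => /eqP e; rewrite -e psiK.
by apply: line_end lq _; rewrite diag_adj //; case/andP: pp.
Qed.

Lemma line_rev x p : line x p -> line (last x p) (rev (belast x p)).
Proof.
move=> [pp up all]; have e : last x p :: rev (belast x p) = rev (x :: p).
  by rewrite [in RHS]lastI rev_rcons ?e.
split.
- by rewrite rev_path; under eq_path do rewrite adjC.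
- by rewrite e rev_uniq.
by move=> v; rewrite e mem_rev.
Qed.

(** An inner vertex has two neighbours and an end has one. *)
Lemma line_image phi x p : diagram_perm m phi -> line x p ->
  phi x = x \/ phi x = last x p.
Proof.
move=> d lp; have [pp up all] := lp.
have [psi [d' phiK psiK]] := diagram_perm_inverse d.
have /(nthP x)[t ts te] := all (phi x).
case: t ts te => [|t] ts te; first by left; rewrite -te.
have [tp|tp] := ltnP t.+1 (size p); last first.
  right; rewrite -te (last_nth x); congr nth; move: ts => /=; lia.
have e1 := @path_adjE x x p t t.+1 pp up; have e2 := @path_adjE x x p t.+1 t.+2 pp up.
rewrite eqxx in e1; rewrite eqxx in e2.
have a1 : adj (phi x) (nth x (x :: p) t) by rewrite -te adjC e1; lia.
have a2 : adj (phi x) (nth x (x :: p) t.+2) by rewrite -te e2; lia.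
rewrite -(diag_adj _ _ d') phiK in a1; rewrite -(diag_adj _ _ d') phiK in a2.
have : psi (nth x (x :: p) t) = psi (nth x (x :: p) t.+2).
  by rewrite (line_end lp a1) (line_end lp a2).
move=> /(congr1 phi); rewrite !psiK => /eqP; rewrite nth_uniq //=; lia.
Qed.

Lemma line_aut phi x p : diagram_perm m phi -> line x p ->
  map phi (x :: p) = x :: p \/ map phi (x :: p) = rev (x :: p).
Proof.
move=> d lp; case: (line_image d lp) => e.
  left; rewrite map_cons e; congr (_ :: _).
  by apply: (line_map d lp); rewrite e.
right; rewrite map_cons e (line_map d lp (q := rev (belast x p))).
  by rewrite [in RHS]lastI rev_rcons ?e.
by rewrite e; apply: line_rev.
Qed.

Lemma line_exists : (exists x : S, True) -> (forall v, ~ branch v) ->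
  exists x p, line x p.
Proof.
move=> [s0 _] nb.
pose P s := exists x p, [/\ s = x :: p, path adj x p & uniq (x :: p)].
have [||s [x [p [-> pp up]]] pmax] := @max_uniq P.
- by move=> s [x [p [-> _ ->]]].
- by exists [:: s0], s0, [::].
exists x, p; split=> //.
have cp : chain x p.
  apply: chain_intro => // v uv; apply: contrapT => /negP vA.
  have : P (rcons (x :: p) v).
    exists x, (rcons p v); split=> //; last by rewrite -rcons_cons rcons_uniq vA.
    by rewrite rcons_path pp.
  by move=> /pmax; rewrite size_rcons ltnn.
have [_ _ cl] := cp.
apply: connected_closed; first by exists x; rewrite inE eqxx.
move=> u v; rewrite inE => /orP[/eqP->{u} xv|up']; last exact: cl.
apply: contrapT => /negP vA.
have : P [:: v, x & p].
  exists v, (x :: p); split=> //; first by rewrite /= adjC xv.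
  by rewrite cons_uniq vA.
by move=> /pmax; rewrite ltnn.
Qed.

End Tree.

(** * Diagrams without branch vertex *)

Lemma joinsC a b i j : joins a b i j = joins a b j i.
Proof. by rewrite /joins; do 4! case: (_ == _). Qed.

Section Types.
Variables (S : choiceType) (m : coxeter_matrix S).
Hypotheses (m_sph : spherical m) (m_irr : irreducible m).
Implicit Types (x y z u v a b c : S) (p q A B N : seq S).
Local Notation adj := (adj m).

Lemma numbering_list x0 L M : uniq L -> (forall v : S, v \in L) ->
    (forall i, M i i = 1) -> (forall i j, M i j = M j i) ->
    (forall i j, i < j < size L -> m (nth x0 L i) (nth x0 L j) = M i.+1 j.+1) ->
  numbering m (size L) M (fun i => nth x0 L i.-1).
Proof.
move=> uL allL M1 MC ML; split.
  split=> //.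
    move=> [|i] [|j] /set_mem /andP[//= _ i1] /set_mem /andP[//= _ j1] /eqP.
    by rewrite nth_uniq // => /eqP->.
  move=> v _; have /(nthP x0)[i si vi] := allL v.
  by exists i.+1.
move=> [|i] [|j] // /andP[_ i1] /andP[_ j1] /=.
case: (ltngtP i j) => [ij|ji|<-]; last by rewrite M1 (cox_eq1 m _ _).2.
  by rewrite ML // ij.
by rewrite cox_sym MC ML // ji.
Qed.

(** [no_two_ends] for an enumerated walk. *)
Lemma two_ends_fun (f : nat -> S) k N0 N :
    (forall i, i <= k -> adj (f i) (f i.+1)) ->
    (forall i j, i <= k.+1 -> j <= k.+1 -> f i = f j -> i = j) ->
    heavy m (f 0) N0 -> f 1 \notin N0 -> heavy m (f k.+1) N -> f k \notin N -> False.
Proof.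
move=> fa fi h0 n0 h1 n1.
have pp : path adj (f 0) (f 1 :: map f (iota 2 k)).
  by apply: (@path_map_iota _ f adj 0 k.+1) => i /= ik; apply: fa.
have u : uniq [:: f 0, f 1 & map f (iota 2 k)].
  rewrite -[[:: f 0, f 1 & _]]/(map f (iota 0 k.+2)) map_inj_in_uniq ?iota_uniq //.
  by move=> i j; rewrite !mem_iota !add0n !ltnS /= => ik jk; apply: fi.
apply: (no_two_ends realalg m_sph pp u h0 n0 (N := N)).
  by rewrite last_map_iota.
by rewrite belast_map_iota last_map_iota.
Qed.

Lemma heavy1 x y : adj x y -> 4 <= m x y -> heavy m x [:: y].
Proof. by rewrite /heavy /= => -> ->. Qed.

Lemma not_adj x y : x != y -> ~~ adj x y -> m x y = 2.
Proof. by move=> /(cox_ge2 m); rewrite /adj; lia. Qed.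

(** The type has a constant entry in the table, and its automorphism [tau] is
    the only nontrivial one. The edges that carry no braid relation of length
    3 are flipped, so that a crossed morphism still has the same value at both
    ends. *)
Definition two_type (tau : S -> S) := exists n M pi nu,
  [/\ table n M (fun=> pi), numbering m n M nu,
      forall j, labels n j -> tau (nu j) = nu (pi j),
      forall phi, diagram_perm m phi -> phi = id \/ phi = tau &
      forall i j, adj i j -> m i j = 3 \/ tau i = j].

Section Line.
Variables (x : S) (p : seq S) (tau : S -> S).
Hypotheses (lxp : line m x p) (tau_diag : diagram_perm m tau) (tau1 : tau <> id).
Let L := x :: p.
Let n := size L.
Let f i := nth x L i.

Let uL : uniq L. Proof. by case: lxp. Qed.

Let f_inj i j : i < n -> j < n -> f i = f j -> i = j.
Proof. by move=> i1 j1 /eqP; rewrite nth_uniq // => /eqP. Qed.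

Let allL v : exists2 i, i < n & v = f i.
Proof. by have [_ _ /(_ v)/(nthP x)[i i1 <-]] := lxp; exists i. Qed.

Let f_adj i j : i < j < n -> adj (f i) (f j) = (j == i.+1).
Proof. by case: lxp => pp up _; apply: path_adjE. Qed.

Let map_id phi : map phi L = L -> phi = id.
Proof.
move=> e; apply/funext => v; have [i i1 ->] := allL v.
by rewrite -[RHS]/(nth x L i) -[in RHS]e (nth_map x).
Qed.

Let tau_rev : map tau L = rev L.
Proof. by case: (line_aut m_sph tau_diag lxp) => // /map_id. Qed.

Let tau_f i : i < n -> tau (f i) = f (n.-1 - i).
Proof.
by move=> i1; rewrite -(nth_map x x tau (s := L)) // tau_rev nth_rev.
Qed.

Let two phi : diagram_perm m phi -> phi = id \/ phi = tau.
Proof.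
move=> d; case: (line_aut m_sph d lxp) => [/map_id e|]; first by left.
rewrite -/L -tau_rev => /eq_in_map e; right; apply/funext => v; apply: e.
by case: lxp.
Qed.

Let label_sym i : i.+1 < n -> m (f i) (f i.+1) = m (f (n - i.+2)) (f (n - i.+1)).
Proof.
move=> i1; have [_ <-] := tau_diag; rewrite !tau_f ?(ltnW i1) // cox_sym.
by congr (m (f _) (f _)); lia.
Qed.

(** Two edges with labels at least 4 are the ends of an affine [Cn]. *)
Let one_label i j : i.+1 < n -> j.+1 < n ->
  4 <= m (f i) (f i.+1) -> 4 <= m (f j) (f j.+1) -> i = j.
Proof.
wlog ij : i j / i <= j => [H|] i1 j1 mi mj.
  by case: (leqP i j) => [|/ltnW] ij; [|apply/esym]; apply: H.
move: ij; rewrite leq_eqVlt => /orP[/eqP//|ij]; exfalso.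
have ai : adj (f i.+1) (f i) by rewrite adjC f_adj ?eqxx // ltnSn.
have aj : adj (f j) (f j.+1) by rewrite f_adj ?eqxx // ltnSn.
have hi : heavy m (f i.+1) [:: f i] by apply: heavy1; rewrite // cox_sym.
have hj : heavy m (f j) [:: f j.+1] by apply: heavy1.
move: ij; rewrite leq_eqVlt => /orP[/eqP ij|ij].
  rewrite ij in hi; have := no_star realalg m_sph hi hj.
  rewrite /= inE andbT => /negPn/eqP/f_inj; lia.
have [k jE] : exists k, j = i.+1 + k.+1 by exists (j - i.+2); lia.
apply: (@two_ends_fun (fun t => f (i.+1 + t)) k [:: f i] [:: f j.+1]).
- by move=> t tk; rewrite f_adj; lia.
- by move=> s t sk tk /f_inj; lia.
- by rewrite addn0.
- by rewrite inE; apply/eqP => /f_inj; lia.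
- by rewrite -jE.
by rewrite inE; apply/eqP => /f_inj; lia.
Qed.

Let numb M : (forall i, M i i = 1) -> (forall i j, M i j = M j i) ->
    (forall i j, i.+1 < j < n -> M i.+1 j.+1 = 2) ->
    (forall i, i.+1 < n -> M i.+1 i.+2 = m (f i) (f i.+1)) ->
  numbering m n M (fun i => f i.-1).
Proof.
move=> M1 MC M2 M3; apply: numbering_list => // [|i j ij].
  by case: lxp.
case: (eqVneq j i.+1) ij => [->|ji] ij; first by rewrite M3 //; case/andP: ij.
rewrite -/n in ij; rewrite M2; last by move: ij ji; lia.
apply: not_adj; last by rewrite -/(f i) -/(f j) f_adj // ji.
by apply/eqP => /f_inj; lia.
Qed.

(** The reversal moves an edge with label at least 4 to another one unless it
    is the middle edge; and then [no_long4] and [no_long5] leave two vertices,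
    or four with label 4. *)
Lemma line_type : two_type tau.
Proof.
have n2 : 2 <= n.
  rewrite /n /L; case: (p) lxp => [|//] [_ _ allx]; case: tau1; apply/funext => v.
  by have := allx v; have := allx (tau v); rewrite !inE => /eqP-> /eqP->.
have e3 i j : adj i j -> exists k, k.+1 < n /\ ((i = f k /\ j = f k.+1) \/ (i = f k.+1 /\ j = f k)).
  have [s s1 ->] := allL i; have [t t1 ->] := allL j.
  case: (ltngtP s t) => [st|ts|->].
  - by rewrite f_adj ?st // => /eqP e; exists s; rewrite -e; split; [|left].
  - by rewrite adjC f_adj ?ts // => /eqP e; exists t; rewrite -e; split; [|right].
  - by move=> /adj_neq; rewrite eqxx.
case: (pselect (exists2 t, t.+1 < n & 4 <= m (f t) (f t.+1))); last first.
  move=> no4.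
  have m3 i : i.+1 < n -> m (f i) (f i.+1) = 3.
    move=> i1; have : adj (f i) (f i.+1) by rewrite f_adj ?eqxx // ltnSn.
    rewrite /adj leq_eqVlt => /orP[/eqP//|h4]; case: no4; by exists i.
  exists n, matA, (fun j => n.+1 - j), (fun i => f i.-1); split=> //.
  - exact: TableA.
  - apply: numb.
    + by move=> i; rewrite /matA eqxx.
    + by move=> i j; rewrite /matA /consecutive eq_sym orbC.
    + by move=> i j ij; rewrite /matA /consecutive !ifF //; lia.
    + by move=> i i1; rewrite m3 // /matA /consecutive ifF ?eqxx //; lia.
  - move=> [//|j] /andP[_ jn]; rewrite tau_f //.
    by congr f; lia.
  - move=> i j /e3[k [k1 []]] [-> ->]; left; first exact: m3.
    by rewrite cox_sym m3.
move=> [t t1 mt].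
have nE : n = t.*2.+2.
  have := one_label (i := n - t.+2) _ t1 _ mt.
  have -> : (n - t.+2).+1 = n - t.+1 by lia.
  by rewrite -label_sym // => /(_ _ mt); lia.
have m3 i : i.+1 < n -> i <> t -> m (f i) (f i.+1) = 3.
  move=> i1 it; have : adj (f i) (f i.+1) by rewrite f_adj ?eqxx // ltnSn.
  rewrite /adj leq_eqVlt => /orP[/eqP//|h4]; case: it; exact: one_label.
have edges i j : adj i j -> m i j = 3 \/ tau i = j.
  move=> /e3[k [k1 ij]]; have [kt|/eqP kt] := eqVneq k t; last first.
    by left; case: ij => -[-> ->]; [|rewrite cox_sym]; apply: m3.
  subst k; right; case: ij => -[-> ->]; rewrite tau_f; try lia; congr f; lia.
have adjS i : i.+1 < n -> adj (f i) (f i.+1) by move=> i1; rewrite f_adj ?eqxx // ltnSn.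
have neq i j : i < n -> j < n -> i != j -> f i != f j.
  by move=> i1 j1; apply: contraNneq => /f_inj ->.
case: t t1 mt nE m3 edges => [|[|t]] t1 mt nE m3 edges.
- exists 2, (matI (m (f 0) (f 1))), (next [:: 1; 2]), (fun i => f i.-1); split=> //.
  + exact: TableI.
  + rewrite -[2]nE; apply: numb.
    * by move=> i; rewrite /matI eqxx.
    * by move=> i j; rewrite /matI eq_sym.
    * by move=> i j; lia.
    * by move=> [|i] i1; rewrite /matI; last lia.
  + move=> [|[|[|j]]] // _; rewrite tau_f ?nE //.
- exists 4, matF4, (next [:: 1; 4] \o next [:: 2; 3]), (fun i => f i.-1); split=> //.
  + exact: TableF4.
  + rewrite -[4]nE; apply: numb.
    * by move=> i; rewrite /matF4 eqxx.
    * by move=> i j; rewrite /matF4 eq_sym !(joinsC _ _ i j).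
    * by rewrite nE => -[|[|i]] [|[|[|[|j]]]] // h; exfalso; move: h; lia.
    * rewrite nE => -[|[|[|i]]] // i1; [by rewrite m3 ?nE| |by rewrite m3 ?nE].
      apply/eqP; rewrite -[matF4 _ _]/4 eqn_leq mt leqNgt; apply/negP => m5.
      apply: (@no_long5 _ m realalg m_sph (f 1) (f 0) (f 2) (f 3)) => //.
      - by apply: adjS; rewrite nE.
      - by rewrite adjC; apply: adjS; rewrite nE.
      - by apply: adjS; rewrite nE.
      - by apply: neq; rewrite ?nE.
      - by apply: neq; rewrite ?nE.
  + move=> [|[|[|[|[|j]]]]] // _; rewrite tau_f ?nE //.
exfalso.
have adjV i : i.+1 < n -> adj (f i.+1) (f i) by move=> i1; rewrite adjC adjS.
apply: (@no_long4 _ m realalg m_sph (f t.+2) (f t.+1) (f t) (f t.+3) (f t.+4) (f t.+4.+1)) => //.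
- by apply: adjS; lia.
- by split; [apply: adjV|apply: adjV|apply: neq]; lia.
- by split; [apply: adjS|apply: adjS|apply: neq]; lia.
- by apply: neq; lia.
- by apply: neq; lia.
Qed.

End Line.

End Types.

(** * Diagrams with a branch vertex *)

Section Branch.
Variables (S : choiceType) (m : coxeter_matrix S).
Hypotheses (m_sph : spherical m) (m_irr : irreducible m).
Implicit Types (x y z u v a b c d : S) (p q A B N : seq S).
Local Notation adj := (adj m).
Local Notation branch := (branch m).

Lemma size_filter_neq z (s : seq S) : uniq s -> (size s).-1 <= size ([seq t <- s | t != z]).
Proof.
move=> us; rewrite size_filter -[count _ s]/(count (predC (pred1 z)) s).
have := count_predC (pred1 z) s.
by rewrite (count_uniq_mem z us); case: (z \in s) => /=; lia.
Qed.

Lemma branch_heavy x z : branch x -> exists N, heavy m x N /\ z \notin N.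
Proof.
move=> [a [b [c /andP[u al]]]]; exists ([seq t <- [:: a; b; c] | t != z]); split.
  apply/and3P; split; first exact: filter_uniq.
    by apply/allP => t; rewrite mem_filter => /andP[_]; apply: (allP al).
  by have := size_filter_neq z u => /= ->.
by rewrite mem_filter /= eqxx.
Qed.

Lemma branch_neighbors x a b c d : uniq [:: a; b; c] -> all (adj x) [:: a; b; c] ->
  adj x d -> d \in [:: a; b; c].
Proof.
move=> u /and4P[xa xb xc _] xd; apply: contrapT => /negP dn.
have [ab ac bc] : [/\ a != b, a != c & b != c].
  by move: u; rewrite /= !inE negb_or !andbT => /andP[/andP[]].
have [da db dc] : [/\ d != a, d != b & d != c].
  by move: dn; rewrite !inE !negb_or => /and3P[].
have h1 : heavy m x [:: a; b] by rewrite /heavy /= xa xb inE ab.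
have h2 : heavy m x [:: c; d] by rewrite /heavy /= xc xd inE eq_sym dc.
have := no_star realalg m_sph h1 h2.
by rewrite /= !inE !negb_or !(eq_sym _ d) ab ac bc da db dc.
Qed.

Lemma uniq_path_to x v : exists p, [/\ path adj x p, uniq (x :: p) & last x p = v].
Proof.
have [p [pp <-]] := m_irr x v.
by case/shortenP: pp => p' pp' up' _; exists p'.
Qed.

Lemma no_branch_end x y p N : branch x -> path adj x (y :: p) -> uniq [:: x, y & p] ->
  heavy m (last y p) N -> last x (belast y p) \notin N -> False.
Proof.
move=> bx pp up hN nN; have [N0 [h0 n0]] := branch_heavy y bx.
exact: (no_two_ends realalg m_sph pp up h0 n0 hN nN).
Qed.

(** Two branch vertices are the ends of an affine [Dn]. *)
Lemma branch_unique x v : branch x -> branch v -> v = x.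
Proof.
move=> bx bv; have [[|y p] [pp up lv]] := uniq_path_to x v; first by rewrite -lv.
have [N [hN nN]] := branch_heavy (last x (belast y p)) bv.
by exfalso; apply: no_branch_end bx pp up _ nN; rewrite -[last y p]/(last x (y :: p)) lv.
Qed.

(** A branch vertex and an edge with label at least 4 are the ends of an
    affine [Bn]. *)
Lemma branch_label3 x u v : branch x -> adj u v -> m u v = 3.
Proof.
move=> bx uv; apply/eqP; rewrite eqn_leq [2 < _]uv andbT leqNgt; apply/negP => m4.
have H w w' p : path adj x p -> uniq (x :: p) -> last x p = w -> adj w w' ->
    4 <= m w w' -> (if p is y :: p' then last x (belast y p') else w) != w' -> False.
  case: p => [|y p] pp up <- ww m4' /=.
    have [N [hN nN]] := branch_heavy w' bx.
    have := no_star realalg m_sph (heavy1 ww m4') hN; rewrite /= nN.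
    by case/and3P: hN => ->.
  move=> lw; apply: no_branch_end bx pp up (heavy1 ww m4') _.
  by rewrite inE.
have [p [pp up lu]] := uniq_path_to x u.
case: (eqVneq (if p is y :: p' then last x (belast y p') else u) v) => [e|]; last first.
  exact: H pp up lu uv m4.
case/lastP: p pp up lu e => [|p w] pp up lu e.
  by move: uv; rewrite -e => /adj_neq; rewrite eqxx.
rewrite last_rcons in lu; subst w.
have lp : last x p = v.
  case: p e {pp up} => [//|y p] /=.
  by rewrite belast_rcons.
apply: (H v u p); rewrite 1?adjC 1?cox_sym //.
- by move: pp; rewrite rcons_path => /andP[].
- by move: up; rewrite -rcons_cons rcons_uniq => /andP[].
have up' : uniq (x :: p) by move: up; rewrite -rcons_cons rcons_uniq => /andP[].
have un : u \notin x :: p by move: up; rewrite -rcons_cons rcons_uniq => /andP[].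
case: p lp un {e up pp up'} => [|y p] lp un; first by rewrite eq_sym; apply: adj_neq uv.
apply: contraNneq un => <-.
have := mem_last x (belast y p); rewrite !inE => /orP[->//|/mem_belast].
by rewrite inE => ->; rewrite orbT.
Qed.

End Branch.

(** For increasing labels one orientation of each edge is left. *)
Lemma matDE n a b : 4 <= n -> 0 < a < b -> b <= n -> matD n a b =
  if (a <= 3) && (b == n) || (3 <= a) && (b == a.+1) && (b < n) then 3 else 2.
Proof.
move=> n4 /andP[a0 ab] bn; rewrite /matD (ltn_eqF ab); congr (if _ then _ else _).
have jE k : joins k n a b = (a == k) && (b == n).
  by rewrite /joins (_ : a == n = false) ?orbF //; apply/negbTE; lia.
have cE : consecutive a b = (b == a.+1).
  by rewrite /consecutive (_ : a == b.+1 = false) ?orbF //; apply/negbTE; lia.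
rewrite !jE cE (minn_idPl (ltnW ab)).
case: (eqVneq b n) => [->|bn']; rewrite ?andbT ?andbF ?ltnn ?orbF /=.
  by case: (eqVneq n a.+1) => [e|_]; [apply/idP/idP; lia|lia].
case: (eqVneq b a.+1) => [e|_]; rewrite ?andbT ?andbF //=.
by congr (_ && _); lia.
Qed.

Lemma matD_leaf n a b : 4 <= n -> 0 < a <= 2 -> a < b < n -> matD n a b = 2.
Proof. by move=> n4 a2 b3; rewrite matDE ?ifF //; lia. Qed.

Lemma matD_center n a : 4 <= n -> 0 < a <= 3 -> matD n a n = 3.
Proof. by move=> n4 a3; rewrite matDE ?ifT //; lia. Qed.

Lemma matD_far n a : 4 <= a < n -> matD n a n = 2.
Proof. by move=> a4; rewrite matDE ?ifF //; lia. Qed.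

Lemma matD_path n a b : 3 <= a < b -> b < n ->
  matD n a b = if b == a.+1 then 3 else 2.
Proof.
move=> a3 bn; rewrite matDE; try lia.
by congr (if _ then _ else _); lia.
Qed.

Section Tripod.
Variables (S : choiceType) (m : coxeter_matrix S).
Hypotheses (m_sph : spherical m) (m_irr : irreducible m).
Local Notation adj := (adj m).
Variables (x y1 y2 y3 : S) (q1 q2 q3 : seq S) (tau : S -> S).
Hypotheses (c1 : chain m x (y1 :: q1)) (c2 : chain m x (y2 :: q2))
  (c3 : chain m x (y3 :: q3)).
Hypotheses (y_uniq : uniq [:: y1; y2; y3])
  (x_adj : forall d, adj x d -> d \in [:: y1; y2; y3]).
Hypotheses (x_fix : forall phi, diagram_perm m phi -> phi x = x)
  (label3 : forall u v, adj u v -> m u v = 3).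
Hypotheses (tau_diag : diagram_perm m tau) (tau_y : tau y1 = y2).

Let y12 : y1 != y2. Proof. by move: y_uniq; rewrite /= !inE negb_or => /andP[/andP[]]. Qed.
Let y13 : y1 != y3. Proof. by move: y_uniq; rewrite /= !inE negb_or => /andP[/andP[]]. Qed.
Let y23 : y2 != y3. Proof. by move: y_uniq; rewrite /= !inE negb_or => /and3P[]. Qed.

Let xy q y : chain m x (y :: q) -> adj x y. Proof. by case=> /andP[]. Qed.

Let all_in v : v \in [:: x, y1 & q1] ++ (y2 :: q2) ++ (y3 :: q3).
Proof.
have [_ _ l1] := c1; have [_ _ l2] := c2; have [_ _ l3] := c3.
apply: (connected_closed m_irr (P := fun v => v \in _)); first by exists x; rewrite inE eqxx.
move=> u w uL uw; move: uL; rewrite cat_cons inE => /orP[/eqP ux|].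
  by have := x_adj (etrans (congr1 (adj ^~ w) (esym ux)) uw);
    rewrite !(inE, mem_cat) => /or3P[]/eqP->; rewrite eqxx ?orbT.
rewrite !mem_cat => /or3P[] uA.
- by have := l1 _ _ uA uw; rewrite !(inE, mem_cat) => /or3P[]->; rewrite ?orbT.
- by have := l2 _ _ uA uw; rewrite !(inE, mem_cat) => /or3P[]->; rewrite ?orbT.
- by have := l3 _ _ uA uw; rewrite !(inE, mem_cat) => /or3P[]->; rewrite ?orbT.
Qed.

Let cross y q y' q' u v : chain m x (y :: q) -> chain m x (y' :: q') -> y != y' ->
  u \in y :: q -> v \in y' :: q' -> u != v /\ m u v = 2.
Proof.
move=> c c' yy uA vB.
have yy' : y' != head x (y :: q) by rewrite eq_sym.
have disj := chain_disjoint m_sph c c' yy'.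
have uv : u != v by apply: contraTneq vB => <-; apply: disj.
split=> //; apply: not_adj => //; apply/negP => au.
have [_ _ cl] := c; have := cl _ _ uA au; rewrite inE => /orP[/eqP vx|vA].
  by have [_ up _] := c'; move: up; rewrite cons_uniq -vx vB.
by have := disj _ vA; rewrite vB.
Qed.

Let image_in phi y : diagram_perm m phi -> y \in [:: y1; y2; y3] ->
  phi y \in [:: y1; y2; y3].
Proof.
move=> d yy; apply: x_adj; rewrite -[x](x_fix d) diag_adj //.
by move: yy; rewrite !inE => /or3P[]/eqP->; [apply: xy c1|apply: xy c2|apply: xy c3].
Qed.

Let image_chain phi y q y' q' : diagram_perm m phi -> chain m x (y :: q) ->
  chain m x (y' :: q') -> phi y = y' -> map phi (y :: q) = y' :: q'.
Proof. by move=> d c c' e; apply: (chain_map m_sph d c); rewrite x_fix. Qed.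

Let perm_ext phi chi : diagram_perm m phi -> diagram_perm m chi ->
  map phi (y1 :: q1) = map chi (y1 :: q1) -> map phi (y2 :: q2) = map chi (y2 :: q2) ->
  map phi (y3 :: q3) = map chi (y3 :: q3) -> phi = chi.
Proof.
move=> d d' /eq_in_map e1 /eq_in_map e2 /eq_in_map e3; apply/funext => v.
have := all_in v; rewrite cat_cons inE => /orP[/eqP->|]; first by rewrite !x_fix.
by rewrite !mem_cat => /or3P[/e1|/e2|/e3].
Qed.

Let tau_q1 : map tau (y1 :: q1) = y2 :: q2.
Proof. exact: image_chain. Qed.

Let size12 : size q1 = size q2.
Proof. by have := congr1 size tau_q1; rewrite size_map => -[]. Qed.

Section TwoArms.
Hypothesis size13 : size q1 <> size q3.

Let fix_y3 phi : diagram_perm m phi -> phi y3 = y3.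
Proof.
move=> d; have := @image_in phi y3 d; rewrite !inE eqxx !orbT => /(_ isT).
case/or3P=> /eqP // e; case: size13.
  by have := congr1 size (image_chain d c3 c1 e); rewrite size_map => -[].
by have := congr1 size (image_chain d c3 c2 e); rewrite size_map size12 => -[].
Qed.

Let dinj phi : diagram_perm m phi -> injective phi.
Proof. by case=> /bij_inj. Qed.

Let swap_y phi : diagram_perm m phi -> phi y1 = y2 -> phi y2 = y1.
Proof.
move=> d e; have := @image_in phi y2 d; rewrite !inE eqxx !orbT => /(_ isT).
case/or3P=> /eqP // e'.
  by move: y12; rewrite -(inj_eq (dinj d)) e e' eqxx.
by move: y23; rewrite -(inj_eq (dinj d)) e' fix_y3 // eqxx.
Qed.

Lemma two_arms_tau2 : map tau (y2 :: q2) = y1 :: q1.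
Proof. by apply: image_chain => //; apply: swap_y. Qed.

Lemma two_arms_tau3 : map tau (y3 :: q3) = y3 :: q3.
Proof. by apply: image_chain => //; apply: fix_y3. Qed.

(** The third arm differs in length from the two others, so it is fixed. *)
Lemma two_arms phi : diagram_perm m phi -> phi = id \/ phi = tau.
Proof.
move=> d; have := @image_in phi y1 d; rewrite !inE eqxx => /(_ isT).
case/or3P=> /eqP e; [left|right|].
- have e2 : phi y2 = y2.
    have := @image_in phi y2 d; rewrite !inE eqxx orbT => /(_ isT).
    case/or3P=> /eqP // e'.
      by move: y12; rewrite -(inj_eq (dinj d)) e e' eqxx.
    by move: y23; rewrite -(inj_eq (dinj d)) e' fix_y3 // eqxx.
  apply: perm_ext => //; first exact: diagram_perm_id.
  + by rewrite map_id; apply: image_chain.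
  + by rewrite map_id; apply: image_chain.
  + by rewrite map_id; apply: image_chain => //; apply: fix_y3.
- apply: perm_ext => //.
  + by rewrite tau_q1; apply: image_chain.
  + by rewrite two_arms_tau2; apply: image_chain => //; apply: swap_y.
  + by rewrite two_arms_tau3; apply: image_chain => //; apply: fix_y3.
by move: y13; rewrite -(inj_eq (dinj d)) e fix_y3 // eqxx.
Qed.

End TwoArms.

(** Two arms of three vertices, with the start of the third arm, form an
    affine [E7]. *)
Let short : size q1 <= 1.
Proof.
case: q1 c1 c2 tau_q1 => [//|b [//|c q]] ca1 ca2 e.
have A y b' c' q' : chain m x [:: y, b', c' & q'] -> arm3 m x y b' c'.
  case=> /and4P[xy' yb bc _] /= u _; split=> //.
    by apply: contraTneq u => ->; rewrite !inE eqxx !orbT.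
  by apply: contraTneq u => ->; rewrite !inE eqxx !orbT andbF.
move: ca2; rewrite -e => ca2.
have := no_E7 realalg m_sph (A _ _ _ _ ca1) (A _ _ _ _ ca2) (xy c3).
by rewrite tau_y y_uniq.
Qed.

Let arm2E y b q : chain m x [:: y, b & q] -> arm2 m x y b.
Proof.
case=> /and3P[xy' yb _] /= u _; split=> //.
by apply: contraTneq u => ->; rewrite !inE eqxx !orbT.
Qed.

Lemma tripod_E6 b1 : q1 = [:: b1] -> two_type m tau.
Proof.
move=> e1; have := tau_q1; rewrite e1 /= => -[_ e2].
have e3 : q3 = [::].
  move: c1 c2 c3; rewrite e1 -e2; case: q3 => [//|b3 q] ca1 ca2 ca3.
  have := no_E6 realalg m_sph (arm2E ca1) (arm2E ca2) (arm2E ca3).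
  by rewrite y_uniq.
have s13 : size q1 <> size q3 by rewrite e1 e3.
have := two_arms_tau2 s13; have := two_arms_tau3 s13.
rewrite e1 -e2 e3 /= => -[t3] [t2 t2'].
set b2 := tau b1 in e2 t2'.
have [a12 a21] := (arm2E (eq_ind _ (fun q => chain m x (y1 :: q)) c1 _ e1),
                   arm2E (eq_ind_r (fun q => chain m x (y2 :: q)) c2 e2)).
have [xy1 yb1 xb1] := a12; have [xy2 yb2 xb2] := a21; have xy3 := xy c3.
have in1 : b1 \in y1 :: q1 by rewrite e1 !inE eqxx orbT.
have in2 : b2 \in y2 :: q2 by rewrite -e2 !inE eqxx orbT.
have in1' : y1 \in y1 :: q1 by rewrite inE eqxx.
have in2' : y2 \in y2 :: q2 by rewrite inE eqxx.
have in3 : y3 \in y3 :: q3 by rewrite inE eqxx.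
have [p12 l12] := cross c1 c2 y12 in1' in2'.
have [p1b2 l1b2] := cross c1 c2 y12 in1' in2.
have [pb12 lb12] := cross c1 c2 y12 in1 in2'.
have [pb1b2 lb1b2] := cross c1 c2 y12 in1 in2.
have [p13 l13] := cross c1 c3 y13 in1' in3.
have [pb13 lb13] := cross c1 c3 y13 in1 in3.
have [p23 l23] := cross c2 c3 y23 in2' in3.
have [pb23 lb23] := cross c2 c3 y23 in2 in3.
have xnb b : x != b -> b \notin [:: y1; y2; y3] -> m b x = 2.
  move=> xb bn; rewrite cox_sym; apply: not_adj => //.
  by apply: contraNN bn; apply: x_adj.
have lb1 : m b1 x = 2.
  by apply: xnb xb1 _; rewrite !inE (negPf pb12) (negPf pb13) (eq_sym b1) (negPf (adj_neq yb1)).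
have lb2 : m b2 x = 2.
  by apply: xnb xb2 _; rewrite !inE (negPf pb23) (eq_sym b2) (negPf p1b2) (eq_sym b2) (negPf (adj_neq yb2)).
exists 6, matE6, (next [:: 1; 5] \o next [:: 2; 4]),
  (fun i => nth x [:: b1; y1; x; y2; b2; y3] i.-1); split.
- exact: TableE6.
- apply: (@numbering_list _ m x [:: b1; y1; x; y2; b2; y3]).
  + rewrite /= !inE !negb_or (eq_sym b1 y1) (adj_neq yb1) (eq_sym b1 x) xb1 pb12 pb1b2 pb13.
    rewrite (eq_sym y1 x) (adj_neq xy1) p12 p1b2 p13 (adj_neq xy2) xb2 (adj_neq xy3).
    by rewrite (adj_neq yb2) p23 pb23.
  + by move=> v; have := all_in v; rewrite e1 -e2 e3 /= !inE; do ![case: (v == _) => //=].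
  + by move=> i; rewrite /matE6 eqxx.
  + by move=> i j; rewrite /matE6 eq_sym !(joinsC _ _ i j).
  move=> [|[|[|[|[|[|i]]]]]] [|[|[|[|[|[|j]]]]]] // ij /=;
    rewrite ?l12 ?l1b2 ?lb12 ?lb1b2 ?l13 ?lb13 ?l23 ?lb23 ?lb1 ?lb2 //;
    first [by apply: label3 | by apply: label3; rewrite adjC
          | by rewrite cox_sym ?lb1 ?lb2 | by exfalso; case/andP: ij].
- by move=> [|[|[|[|[|[|[|j]]]]]]] // _ /=; rewrite ?x_fix.
- exact: two_arms.
by move=> i j /label3; left.
Qed.

Lemma tripod_D_numbering : q1 = [::] ->
  numbering m (size q3).+4 (matD (size q3).+4)
    (fun i => nth x [:: y1, y2 & y3 :: q3 ++ [:: x]] i.-1).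
Proof.
move=> e1; have e2 : q2 = [::] by apply: size0nil; rewrite -size12 e1.
have [p3 u3 cl3] := c3; have xy1 := xy c1; have xy2 := xy c2; have xy3 := xy c3.
have x1 := adj_neq xy1; have x2 := adj_neq xy2.
have in1 : y1 \in y1 :: q1 by rewrite inE eqxx.
have in2 : y2 \in y2 :: q2 by rewrite inE eqxx.
have n1 v : v \in y3 :: q3 -> y1 != v /\ m y1 v = 2 by apply: cross c1 c3 y13 in1.
have n2 v : v \in y3 :: q3 -> y2 != v /\ m y2 v = 2 by apply: cross c2 c3 y23 in2.
have [_ l12] := cross c1 c2 y12 in1 in2.
have sL : size [:: y1, y2 & y3 :: q3 ++ [:: x]] = (size q3).+4.
  by rewrite /= size_cat addn1.
have -> : (size q3).+4 = size [:: y1, y2 & y3 :: q3 ++ [:: x]] by [].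
set n := size _; have nE : n = (size q3).+4 by [].
apply: numbering_list.
- have -> : [:: y1, y2 & y3 :: q3 ++ [:: x]] = [:: y1, y2 & rcons (y3 :: q3) x].
    by rewrite -cats1.
  have uA : uniq (rcons (y3 :: q3) x) by rewrite rcons_uniq; exact: u3.
  have m1 : y1 \notin y3 :: q3 by apply/negP => /n1[/eqP].
  have m2 : y2 \notin y3 :: q3 by apply/negP => /n2[/eqP].
  have m1' : y1 \notin rcons (y3 :: q3) x by rewrite mem_rcons in_cons negb_or m1 eq_sym x1.
  have m2' : y2 \notin rcons (y3 :: q3) x by rewrite mem_rcons in_cons negb_or m2 eq_sym x2.
  by rewrite 2!cons_uniq uA m2' in_cons negb_or y12 m1'.
- move=> v; have := all_in v; rewrite e1 e2 !(inE, mem_cat) -?orbA.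
  by case/or4P=> [->|->|->|/orP[->|->]]; rewrite ?orbT.
- by move=> i; rewrite /matD eqxx.
- by move=> i j; rewrite /matD (eq_sym i j) !(joinsC _ _ i j) /consecutive minnC (orbC (j == i.+1)).
pose A := y3 :: q3; have sA : size A = (size q3).+1 by [].
have nthA k : nth x (A ++ [:: x]) k = nth x A k.
  rewrite nth_cat; case: ltnP => // kA; rewrite [RHS]nth_default //.
  by case: (k - size A) => [|[|t]].
have mE u v : u != v -> m u v = if adj u v then 3 else 2.
  by move=> uv; case: ifP => [/label3 //|/negbT na]; apply: not_adj uv na.
have inq a b : a <= size A -> b <= size A -> a != b ->
    nth x (x :: A) a != nth x (x :: A) b.
  by move=> aA bA; rewrite nth_uniq.
have n4 : 4 <= n by rewrite nE.
have nA : n = (size A).+3 by rewrite nE.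
move=> i j; rewrite sL => /andP[ij jn].
have jA : j.+1 <= n by rewrite nE.
clear nE; case: i ij => [|[|i]]; case: j jn jA => [|[|j]] // jn jA ij.
- rewrite [nth _ _ j.+2]nthA; have [jA'|jA'] := ltnP j (size A).
    by rewrite (n1 _ (mem_nth x jA')).2 matD_leaf // nA.
  have -> : j = size A by apply/eqP; rewrite eqn_leq jA' andbT.
  by rewrite [nth x A _]nth_default // [LHS]cox_sym (label3 xy1) -nA matD_center.
- rewrite [nth _ _ j.+2]nthA; have [jA'|jA'] := ltnP j (size A).
    by rewrite (n2 _ (mem_nth x jA')).2 matD_leaf // nA.
  have -> : j = size A by apply/eqP; rewrite eqn_leq jA' andbT.
  by rewrite [nth x A _]nth_default // [LHS]cox_sym (label3 xy2) -nA matD_center.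
rewrite [nth _ _ i.+2]nthA [nth _ _ j.+2]nthA.
have jA2 : j <= size A by move: jA; rewrite nA.
have iA : i < size A := leq_trans (ij : i < j) jA2.
have [jA'|jA'] := ltnP j (size A).
  have := inq i.+1 j.+1 iA jA'; rewrite eqSS ltn_eqF // => /(_ isT)/mE -> //.
  have := @path_adjE _ m m_sph x x A i.+1 j.+1 p3 u3; rewrite /= => -> //; last exact/andP.
  by rewrite matD_path // nA.
have jE : j = size A by apply/eqP; rewrite eqn_leq jA' andbT.
rewrite jE -nA [nth _ _ (size A)]nth_default // cox_sym.
have := inq 0 i.+1 isT iA isT => /mE -> //.
have := @path_adjE _ m m_sph x x A 0 i.+1 p3 u3; rewrite /= => -> //.
by case: (i) iA => [|k] kA; [rewrite matD_center|rewrite matD_far // nA].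
Qed.

Lemma tripod_D : q1 = [::] -> q3 <> [::] -> two_type m tau.
Proof.
move=> e1 e3; have s13 : size q1 <> size q3 by rewrite e1 => /esym/size0nil.
exists (size q3).+4, (matD (size q3).+4), (next [:: 1; 2]),
  (fun i => nth x [:: y1, y2 & y3 :: q3 ++ [:: x]] i.-1); split.
- exact: TableD.
- exact: tripod_D_numbering.
- have t2 : tau y2 = y1 by have [] := two_arms_tau2 s13.
  have fixA v : v \in y3 :: q3 -> tau v = v.
    by move=> vA; have := two_arms_tau3 s13; rewrite -[RHS]map_id => /eq_in_map/(_ v vA).
  move=> [|[|[|j]]] // _.
  rewrite -[LHS]/(tau (nth x ((y3 :: q3) ++ [:: x]) j)).
  rewrite -[RHS]/(nth x ((y3 :: q3) ++ [:: x]) j) nth_cat.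
  case: ltnP => jA; first by apply: fixA; apply: mem_nth.
  by case: (j - _) => [|[|k]] /=; apply: x_fix.
- exact: two_arms.
by move=> i j /label3; left.
Qed.

Lemma tripod_type : two_type m tau \/ exists nu, numbering m 4 (matD 4) nu.
Proof.
case q1E : q1 short => [|b [|//]] _; last by left; apply: tripod_E6 q1E.
case: (pselect (q3 = [::])) => [q3E|]; last by left; apply: tripod_D.
right; have := tripod_D_numbering q1E; rewrite q3E /= => ?.
by eexists; eassumption.
Qed.

End Tripod.

Section Classification.
Variables (S : choiceType) (m : coxeter_matrix S).
Hypotheses (m_sph : spherical m) (m_irr : irreducible m).
Local Notation adj := (adj m).

(** A diagram automorphism fixes the branch vertex and permutes the arms, two
    of which thus have the same length; this length is 1 or 2 by [no_E7], and
    in the latter case the third arm is a single vertex by [no_E6]. *)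
Theorem symmetric_types tau : diagram_perm m tau -> tau <> id ->
  two_type m tau \/ exists nu, numbering m 4 (matD 4) nu.
Proof.
move=> d tau1.
case: (pselect (exists x, branch m x)) => [[x bx]|nb]; last first.
  have [x [p lxp]] : exists x p, line m x p.
    apply: line_exists => //; last by move=> v bv; apply: nb; exists v.
    apply: contrapT => noS; apply: tau1; apply/funext => v.
    by case: noS; exists v.
  by left; apply: line_type lxp d tau1.
have x_fix phi : diagram_perm m phi -> phi x = x.
  move=> dphi; apply: (branch_unique m_sph m_irr bx).
  have [a [b [c /andP[u al]]]] := bx; exists (phi a), (phi b), (phi c).
  rewrite -[[:: _; _; _]]/(map phi [:: a; b; c]) (diag_uniq _ dphi) u all_map.
  by apply: sub_all al => t; rewrite /= diag_adj.
have label3 u v : adj u v -> m u v = 3 by apply: branch_label3 bx.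
have arms y : adj x y -> exists q, chain m x (y :: q).
  move=> xy; apply: chain_exists => // v vx bv.
  by move: vx; rewrite (branch_unique m_sph m_irr bx bv) eqxx.
have [y [xy ty]] : exists y, adj x y /\ tau y <> y.
  apply: contrapT => no; apply: tau1; apply/funext => v.
  have fix_y y : adj x y -> tau y = y.
    by move=> xy; apply: contrapT => ty; apply: no; exists y.
  apply: (connected_closed m_irr (P := fun v => tau v = v /\ (v = x \/
    exists y q, [/\ adj x y, chain m x (y :: q) & v \in y :: q])) _ _ v).1.
    by exists x; split; [apply: x_fix|left].
  move=> u w [tu]; have fix_chain y q z : adj x y -> chain m x (y :: q) ->
      z \in y :: q -> tau z = z.
    move=> xy c; have : map tau (y :: q) = map id (y :: q).
      rewrite map_id; apply: (chain_map m_sph d c); rewrite x_fix //=.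
      exact: fix_y.
    by move=> /eq_in_map; apply.
  case=> [->|[y [q [xy c uc]]]] uw.
    have [q c] := arms w uw; split; first by apply: fix_y.
    by right; exists w, q; rewrite inE eqxx.
  have [_ _ cl] := c; have := cl _ _ uc uw; rewrite inE => /orP[/eqP->|wc].
    by split; [apply: x_fix|left].
  by split; [apply: fix_chain c wc|right; exists y, q].
have [a [b [c /andP[u al]]]] := bx.
have nbr t := @branch_neighbors _ m m_sph x a b c t u al.
have xty : adj x (tau y) by rewrite -(x_fix _ d) diag_adj.
have [z [uz zn az]] : exists z, [/\ uniq [:: y; tau y; z], z \in [:: a; b; c] &
    forall t, t \in [:: a; b; c] -> t \in [:: y; tau y; z]].
  have {}ty : y != tau y by rewrite eq_sym; apply/eqP.
  have := nbr _ xy; have := nbr _ xty; move: u ty.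
  rewrite /= !inE !negb_or !andbT => /andP[/andP[ab ac] bc] ty.
  have [ba ca cb] : [/\ b != a, c != a & c != b] by rewrite !(eq_sym c) eq_sym.
  case/or3P=> /eqP e1; case/or3P=> /eqP e2; rewrite e1 e2 ?eqxx // in ty *;
   [exists c|exists b|exists c|exists a|exists b|exists a];
   rewrite /= !inE ?negb_or ?eqxx ?orbT ?ab ?ac ?bc ?ba ?ca ?cb; split=> // t;
   by rewrite !inE => /or3P[]->; rewrite ?orbT.
have xz : adj x z := allP al z zn.
have [q1 c1] := arms _ xy; have [q2 c2] := arms _ xty; have [q3 c3] := arms _ xz.
apply: (tripod_type m_sph m_irr c1 c2 c3 uz _ x_fix label3 d) => // t xt.
exact: az (nbr _ xt).
Qed.

End Classification.

(** * Solving for the crossed morphism *)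

Section TableSolutions.
Variables (S : choiceType) (m : coxeter_matrix S).
Hypotheses (m_sph : spherical m) (m_irr : irreducible m).

Definition tabulated (pi : artin m -> S -> S) := exists n M p nu,
  [/\ table n M p, numbering m n M nu & forall i j, labels n i -> labels n j ->
      pi (sigma m (nu i)) (nu j) = nu (p i j)].

(** The value is the same at adjacent generators: by the braid relation if the
    label is 3, by invariance under [tau] if the edge is flipped. So it is
    constant, and it is [tau]. *)
Lemma cocycle_two_type pi tau : cocycle pi -> tau <> id -> (exists g, pi g <> id) ->
    two_type m tau -> (forall g h, pi (g * h)%g = pi g \o pi h) /\ tabulated pi.
Proof.
move=> piP tau1 [g0 g0P] [n [M [p [nu [tb nb ptau two edges]]]]].
have pd g : diagram_perm m (pi g) by case: piP.
have tinv := cocycle_involution piP tau1 two.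
have hom : forall g h, pi (g * h)%g = pi g \o pi h.
  apply: cocycle_hom => // g i.
  by case: (two _ (pd g)) => ->; rewrite ?tinv.
have const i j : pi (sigma m i) = pi (sigma m j).
  apply/esym; move: j; apply: (connected_closed m_irr); first by exists i.
  move=> u v <- uv; case: (edges _ _ uv) => [m3|<-]; last exact: tinv.
  by apply: hom_label3 tau1 two hom _; rewrite // cox_sym.
have tauE i : pi (sigma m i) = tau.
  case: (two _ (pd (sigma m i))) => // ei; case: g0P.
  by apply: cocycle_trivial => // j; rewrite (const j i).
split=> //; exists n, M, (fun=> p), nu; split=> // i j _ lj.
by rewrite tauE ptau.
Qed.

End TableSolutions.
Arguments tabulated {S} m pi.

Section D4Codes.

(** A diagram automorphism of [D4], given by the labels of the images of 1, 2,
    3 and 4; it permutes the leaves. *)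
Definition codes4 : seq (seq nat) := [seq rcons s 4 | s <- permutations [:: 1; 2; 3]].
Definition id4 := [:: 1; 2; 3; 4].
Definition comp4 (s t : seq nat) := [seq nth 0 s i.-1 | i <- t].
(** By [cocycle_next] this is the code at [g * sigma j] if [s] is the code at
    [g] and [E] lists the codes at the generators. *)
Definition next4 (E : seq (seq nat)) (s : seq nat) j := comp4 s (nth [::] E (index j s)).
Definition run4 E w := foldl (next4 E) id4 w.
Definition relations4 : seq (seq nat * seq nat) :=
  [:: ([:: 1; 2], [:: 2; 1]); ([:: 1; 3], [:: 3; 1]); ([:: 2; 3], [:: 3; 2]);
      ([:: 1; 4; 1], [:: 4; 1; 4]); ([:: 2; 4; 2], [:: 4; 2; 4]);
      ([:: 3; 4; 3], [:: 4; 3; 4])]%N.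
Definition consistent4 E := all (fun r => run4 E r.1 == run4 E r.2) relations4.
Definition entry4 (p : nat -> nat -> nat) := [seq [seq p i j | j <- id4] | i <- id4].
Definition entries4 : seq (nat -> nat -> nat) :=
  [:: fun=> next [:: 1; 2]; fun=> next [:: 1; 3]; fun=> next [:: 2; 3];
      fun=> next [:: 1; 2; 3]; fun=> next [:: 1; 3; 2]] ++
  [seq (fun i => if i <= 3 then next [:: t.1.1; t.1.2] else next [:: t.1.2; t.2])
   | t <- [:: (1, 2, 3); (1, 3, 2); (2, 1, 3); (2, 3, 1); (3, 1, 2); (3, 2, 1)]]%N.

(** Equality on the leaves makes the crossed morphism invariant. *)
Definition solution4 E := [&& nth [::] E 0 == nth [::] E 1, nth [::] E 1 == nth [::] E 2 &
  (E == nseq 4 id4) || has (fun p => E == entry4 p) entries4].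

(** The six defining relations leave the trivial solution and the eleven
    entries of the table. *)
Lemma check4 : all (fun a => all (fun b => all (fun c => all (fun d =>
  consistent4 [:: a; b; c; d] ==> solution4 [:: a; b; c; d]) codes4) codes4) codes4) codes4.
Proof. by vm_compute. Qed.

Lemma comp4_codes s t : s \in codes4 -> t \in codes4 -> comp4 s t \in codes4.
Proof.
move=> sP tP; have : all (fun s => all (fun t => comp4 s t \in codes4) codes4) codes4.
  by vm_compute.
by move=> /allP/(_ s sP)/allP/(_ t tP).
Qed.

Lemma codes4_labels s j : s \in codes4 -> 1 <= j <= 4 ->
  (1 <= nth 0 s j.-1 <= 4) && (j \in s) && (index j s < 4).
Proof.
move=> sP jP; have : all (fun s => all (fun j => (1 <= nth 0 s j.-1 <= 4) && (j \in s) &&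
    (index j s < 4)) id4) codes4 by vm_compute.
by move=> /allP/(_ s sP)/allP; apply; move: j jP => [|[|[|[|[|j]]]]].
Qed.

Lemma diagram4_codes k1 k2 k3 k4 : all (fun k => 1 <= k <= 4) [:: k1; k2; k3; k4] ->
    (forall i j, 1 <= i <= 4 -> 1 <= j <= 4 ->
     matD 4 (nth 0 [:: k1; k2; k3; k4] i.-1) (nth 0 [:: k1; k2; k3; k4] j.-1) = matD 4 i j) ->
  [:: k1; k2; k3; k4] \in codes4.
Proof.
move=> kP mP; have : all (fun a => all (fun b => all (fun c => all (fun d =>
    all (fun i => all (fun j => matD 4 (nth 0 [:: a; b; c; d] i.-1)
      (nth 0 [:: a; b; c; d] j.-1) == matD 4 i j) id4) id4 ==>
    ([:: a; b; c; d] \in codes4)) id4) id4) id4) id4 by vm_compute.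
have id4P k : 1 <= k <= 4 -> k \in id4 by case: k => [|[|[|[|[|k]]]]].
have id4P' k : k \in id4 -> 1 <= k <= 4 by rewrite !inE => /or4P[]/eqP->.
move: (kP) => /and5P[/id4P a1 /id4P a2 /id4P a3 /id4P a4 _].
move=> /allP/(_ _ a1)/allP/(_ _ a2)/allP/(_ _ a3)/allP/(_ _ a4)/implyP; apply.
by apply/allP => i /id4P' i4; apply/allP => j /id4P' j4; apply/eqP; apply: mP.
Qed.

Lemma entries4_table p : List.In p entries4 -> table 4 (matD 4) p.
Proof.
rewrite /entries4 /=; do ![case=> [<-|]] => //.
- exact: TableD.
- exact: TableD4_transposition.
- exact: TableD4_transposition.
- exact: TableD4_cycle.
- exact: TableD4_cycle.
- exact: (TableD4_mixed (a := 1) (b := 2) (c := 3)).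
- exact: (TableD4_mixed (a := 1) (b := 3) (c := 2)).
- exact: (TableD4_mixed (a := 2) (b := 1) (c := 3)).
- exact: (TableD4_mixed (a := 2) (b := 3) (c := 1)).
- exact: (TableD4_mixed (a := 3) (b := 1) (c := 2)).
- exact: (TableD4_mixed (a := 3) (b := 2) (c := 1)).
Qed.

End D4Codes.

Lemma has_In (T : Type) (a : pred T) s : has a s -> exists2 x, List.In x s & a x.
Proof.
elim: s => [//|x s IHs] /= /orP[ax|/IHs[y ys ay]]; first by exists x; [left|].
by exists y; [right|].
Qed.

Section D4.
Variables (S : choiceType) (m : coxeter_matrix S) (nu : nat -> S).
Hypothesis nu_num : numbering m 4 (matD 4) nu.

Definition coded4 (phi : S -> S) s :=
  s \in codes4 /\ forall j, labels 4 j -> phi (nu j) = nu (nth 0 s j.-1).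

Let nu_inj i j : labels 4 i -> labels 4 j -> nu i = nu j -> i = j.
Proof. by case: nu_num => -[_ inj _] _ i4 j4; apply: inj; rewrite inE. Qed.

Let nu_surj v : exists2 j, labels 4 j & nu j = v.
Proof. by case: nu_num => -[_ _ surj] _; have [j j4 <-] := surj v I; exists j. Qed.

Lemma coded4_exists phi : diagram_perm m phi -> exists s, coded4 phi s.
Proof.
move=> [_ pm]; have ex j : exists k, labels 4 k /\ nu k = phi (nu j).
  by have [k k4 e] := nu_surj (phi (nu j)); exists k.
have [k kP] := choice ex.
have k4 j : 1 <= k j <= 4 by case: (kP j).
exists [:: k 1; k 2; k 3; k 4]; split.
  have nthk i : 1 <= i <= 4 -> nth 0 [:: k 1; k 2; k 3; k 4] i.-1 = k i.
    by case: i => [|[|[|[|[|i]]]]].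
  apply: diagram4_codes; first by rewrite /= !k4.
  move=> i j i4 j4; rewrite !nthk //; have [_ mnu] := nu_num.
  by rewrite -(mnu _ _ (k4 i) (k4 j)) (kP i).2 (kP j).2 pm mnu.
by move=> [|[|[|[|[|j]]]]] // _; rewrite -(kP _).2.
Qed.

Lemma coded4_comp phi chi s t : coded4 phi s -> coded4 chi t ->
  coded4 (phi \o chi) (comp4 s t).
Proof.
move=> [s4 sE] [t4 tE]; split=> [|j j4]; first exact: comp4_codes.
have /andP[/andP[tj _] _] := codes4_labels t4 j4.
rewrite /= tE // sE //; congr nu; rewrite (nth_map 0) //.
have : size t = 4 by move: t4; rewrite /codes4 => /mapP[r]; rewrite mem_permutations => /perm_size rs ->; rewrite size_rcons rs.
by case/andP: j4; case: (j) => // k _ k4 ->.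
Qed.

Lemma coded4_inj phi s t : coded4 phi s -> coded4 phi t -> s = t.
Proof.
have sz r : r \in codes4 -> size r = 4.
  by case/mapP=> q; rewrite mem_permutations => /perm_size qs ->; rewrite size_rcons qs.
move=> [s4 sE] [t4 tE]; apply: (@eq_from_nth _ 0); first by rewrite !sz.
move=> i; rewrite sz // => i4.
have l4 : labels 4 i.+1 by rewrite /labels /=.
have /andP[/andP[si _] _] := codes4_labels s4 l4.
have /andP[/andP[ti _] _] := codes4_labels t4 l4.
by apply: nu_inj => //; have := sE _ l4; rewrite tE.
Qed.

Lemma coded4_id : coded4 id id4.
Proof. by split=> // -[|[|[|[|[|j]]]]]. Qed.

Lemma coded4_eq phi chi s : coded4 phi s -> coded4 chi s -> phi = chi.
Proof.
move=> [_ sE] [_ sE']; apply/funext => v; have [j j4 <-] := nu_surj v.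
by rewrite sE // sE'.
Qed.

Variable pi : artin m -> S -> S.
Hypothesis piP : cocycle pi.
Variable E : seq (seq nat).
Hypothesis E_codes : forall j, labels 4 j -> coded4 (pi (sigma m (nu j))) (nth [::] E j.-1).

Lemma coded4_next g s j : labels 4 j -> coded4 (pi g) s ->
  coded4 (pi (g * sigma m (nu j))%g) (next4 E s j).
Proof.
move=> j4 cs; have [s4 sE] := cs.
have /andP[/andP[_ js] ij] := codes4_labels s4 j4.
have l4 : labels 4 (index j s).+1 by rewrite /labels /=.
have := sE _ l4; rewrite [_.-1]/= nth_index // => <-.
rewrite (cocycle_next piP); apply: coded4_comp => //.
exact: (E_codes l4).
Qed.

Lemma coded4_run w : all (fun j => 1 <= j <= 4) w ->
  coded4 (pi (aword m (map nu w))) (run4 E w).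
Proof.
elim/last_ind: w => [|w j IHw].
  by rewrite aword_nil (cocycle1 piP) => _; apply: coded4_id.
rewrite all_rcons => /andP[j4 w4]; rewrite map_rcons -cats1 aword_cat aword1.
by rewrite /run4 foldl_rcons; apply: coded4_next => //; apply: IHw.
Qed.

Lemma coded4_consistent : consistent4 E.
Proof.
have [_ mnu] := nu_num.
have key i j : labels 4 i -> labels 4 j ->
    run4 E (alt_word (matD 4 i j) i j) = run4 E (alt_word (matD 4 i j) j i).
  move=> i4 j4; have al k a b : labels 4 a -> labels 4 b ->
      all (fun j => 1 <= j <= 4) (alt_word k a b).
    elim: k a b => [//|k IHk] a b a4 b4; rewrite alt_cons /= IHk // andbT; exact: a4.
  have mapalt k a b : map nu (alt_word k a b) = alt_word k (nu a) (nu b).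
    by elim: k a b => [//|k IHk] a b; rewrite !alt_cons /= IHk.
  apply: coded4_inj (coded4_run (al _ _ _ i4 j4)) _.
  suff -> : aword m (map nu (alt_word (matD 4 i j) i j)) =
      aword m (map nu (alt_word (matD 4 i j) j i)) by apply: coded4_run; apply: al.
  by rewrite !mapalt -mnu //; apply: aword_braid; apply: braid_alt.
apply/allP => -[u v]; rewrite !inE => /or4P[|||/or3P[]] /eqP[-> ->]; apply/eqP.
- exact: (key 1 2).
- exact: (key 1 3).
- exact: (key 2 3).
- exact: (key 1 4).
- exact: (key 2 4).
- exact: (key 3 4).
Qed.

End D4.

Section D4Cocycle.
Variables (S : choiceType) (m : coxeter_matrix S) (nu : nat -> S).
Hypothesis nu_num : numbering m 4 (matD 4) nu.

Lemma cocycle_D4 (pi : artin m -> S -> S) : cocycle pi -> (exists g, pi g <> id) ->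
  (forall g h, pi (g * h)%g = pi g \o pi h) /\ tabulated m pi.
Proof.
move=> piP [g0 g0P]; have pd g : diagram_perm m (pi g) by case: piP.
have ex j : exists s, coded4 nu (pi (sigma m (nu j))) s by apply: coded4_exists nu_num _ (pd _).
have [e eP] := choice ex.
pose E := [:: e 1; e 2; e 3; e 4].
have EP j : labels 4 j -> coded4 nu (pi (sigma m (nu j))) (nth [::] E j.-1).
  by case: j => [|[|[|[|[|j]]]]] // _; apply: eP.
have e4 j : e j \in codes4 by case: (eP j).
have cons := coded4_consistent nu_num piP EP.
have := check4; move=> /allP/(_ _ (e4 1))/allP/(_ _ (e4 2))/allP/(_ _ (e4 3))/allP/(_ _ (e4 4)).
rewrite -/E cons => /and3P[/eqP e12 /eqP e23 sol].
have surj v : exists2 j, labels 4 j & nu j = v.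
  by case: nu_num => -[_ _ surj] _; have [j j4 <-] := surj v I; exists j.
have leaf j : 1 <= j <= 3 -> pi (sigma m (nu j)) = pi (sigma m (nu 1)).
  move=> j3; apply: (coded4_eq nu_num (s := e 1)); last exact: eP.
  have e21 : e 2 = e 1 := esym e12.
  have e31 : e 3 = e 1 by rewrite -e21; exact: esym e23.
  case: j j3 => [|[|[|[|j]]]] // _.
    by rewrite -e21; apply: eP.
  by rewrite -e31; apply: eP.
have inv g i : pi (sigma m (pi g i)) = pi (sigma m i).
  have [j j4 <-] := surj i; have [s [s4 sE]] := coded4_exists nu_num (pd g).
  rewrite sE //; have : (nth 0 s j.-1 == j) || ((1 <= nth 0 s j.-1 <= 3) && (1 <= j <= 3)).
    have : all (fun s => all (fun j => (nth 0 s j.-1 == j) ||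
      ((1 <= nth 0 s j.-1 <= 3) && (1 <= j <= 3))) id4) codes4 by vm_compute.
    move=> /allP/(_ s s4)/allP; apply; by move: j j4 {sE} => [|[|[|[|[|j]]]]].
  by case/orP=> [/eqP->//|/andP[/leaf-> /leaf->]].
split; first exact: cocycle_hom.
case/orP: sol => [/eqP E1|/has_In[p /entries4_table tp /eqP Ep]].
  case: g0P; apply: (cocycle_trivial piP) => i; have [j j4 <-] := surj i.
  apply: (coded4_eq nu_num (s := id4)) (coded4_id nu).
  have := EP j j4; rewrite E1; congr (coded4 _ _ _).
  by move: j j4 => [|[|[|[|[|j]]]]].
exists 4, (matD 4), p, nu; split=> // i j i4 j4.
have [_ ->] := EP i i4; last exact: j4.
by rewrite Ep; move: i i4 => [|[|[|[|[|i]]]]] // _; move: j j4 => [|[|[|[|[|j]]]]].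
Qed.

End D4Cocycle.

(** * The classification of formations *)

Theorem theorem3p7 (S : choiceType) (m : coxeter_matrix S)
    (m_irr : irreducible m) (m_sph : spherical m)
    (F : formation (artin m)) (F_nontrivial : ~ trivial_formation F) :
  exists! alpha : diagram_hom m,
    listed alpha /\
    exists alphaA : associative (circ alpha),
      equiv_formation F (twisted_formation alphaA).
Proof.
have [pi [piP tw]] := formation_cocycle m_sph F.
have [g0 g0P] : exists g, pi g <> id.
  apply: contrapT => triv; apply: F_nontrivial; apply: formation_trivial tw _ => g.
  by apply: contrapT => gP; apply: triv; exists g.
have pd g : diagram_perm m (pi g) by case: piP.
have [hom [n [M [p [nu [tp nnu piE]]]]]] :
    (forall g h, pi (g * h)%g = pi g \o pi h) /\ tabulated m pi.
  case: (symmetric_types m_sph m_irr (pd g0) g0P) => [two|[nu nnu]].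
    by apply: cocycle_two_type two => //; exists g0.
  by apply: cocycle_D4 nnu _ piP _; exists g0.
have [alpha [alphaE [alphaA eqF]]] := formation_twisted tw pd hom.
exists alpha; split; last first.
  by move=> beta [_ [betaA eqF']]; apply: twisted_unique eqF eqF'.
split; last by exists alphaA.
exists n, M, p, nu; split=> // i i1; exists (pi (sigma m (nu i))).
by split=> // j j1; apply: piE.
Qed.
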